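(* Let $G^*$ be a dual-adapted rooted 3,4-map, let $\mathcal{L}^*$ be a dual 4-GS labeling of $G^*$, and let $\overrightarrow{A}_o^*$ and $\overrightarrow{A}_e^*$ be the corresponding augmented dual bipolar contractions of $G^*$. Let $h_o^*$ be an $\overrightarrow{A}_o^*$-increasing function, and let $h_e^*$ be an $\overrightarrow{A}_e^*$-increasing function. Placing each non-root vertex $v$ at coordinates $(h_o^*(v),h_e^*(v))\in\mathbb{R}^2$, and drawing each non-root edge of $G^*$ using the $\mathcal{L}^*$-rule, yields an SPO drawing of $G^*$.
   Context: Primal maps. A planar map is a connected planar graph drawn in the plane without edge crossings, up to continuous deformation. A 3,4-angulation of the square is a planar map $G$ whose inner (bounded) faces have degree 3 or 4 and whose outer face has degree 4 and is incident to 4 distinct vertices, denoted $v_1,v_2,v_3,v_4$ in clockwise order (walking $v_1\to v_2\to v_3\to v_4\to v_1$ one has the inner faces on the right). It is adapted if every simple cycle which is not the contour of a face has length at least 4. Indices and labels in $\{1,2,3,4\}$ are taken modulo 4. Dual maps. A rooted 3,4-map is the dual $G^*$ of a 3,4-angulation of the square $G$; its root vertex $v_\infty$ is dual to the outer face of $G$. $G^*$ is dual-adapted if $G$ is adapted. The root edge $e_i^*$ is dual to $\{v_i,v_{i+1}\}$ and the root face $f_i^*$ is dual to $v_i$. Other edges, faces, vertices are called non-root; a non-root arc is a non-root edge with a chosen direction; non-root corners are the corners not incident to $v_\infty$. $G^*$ is drawn as the dual of $G$, so that $G'=G^*\setminus v_\infty$ lies inside the outer cycle of $G$ and the root edges go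 to infinity. Dual 4-GS labelings. The label jump from a corner labeled $i$ to a corner labeled $i'$ is the $\delta\in\{0,1,2,3\}$ with $i+\delta\equiv i'$ mod 4. For an arc $a$, $\mathrm{li}(a),\mathrm{ri}(a),\mathrm{rt}(a),\mathrm{lt}(a)$ denote the labels of the corners next to $a$: left at the initial vertex, right at the initial vertex, right at the terminal vertex, left at the terminal vertex. A dual 4-GS labeling of $G^*$ assigns a label in $\{1,2,3,4\}$ to each non-root corner such that: (L0* ) the non-root corners in $f_i^*$ have label $i$; (L1* ) around every non-root face and every non-root vertex, the sum of label jumps between consecutive corners in clockwise order is 4; (L2* ) consecutive corners around a (non-root) vertex have distinct labels; (L3* ) for every non-root arc $a$ whose initial vertex has degree 3, the jump from $\mathrm{li}(a)$ to $\mathrm{ri}(a)$ plus the jump from $\mathrm{ri}(a)$ to $\mathrm{rt}(a)$ is at least 2. Colors. Let $[i:j[$ be the cyclic interval $\{i,\dots,j-1\}$ modulo 4 (empty if $i=j$). A non-root arc $a$ has color $k$ if $k\in[\mathrm{li}(a):\mathrm{ri}(a)[$. The colors of an edge are the colors of its two arcs; every non-root arc has at least one color. Dual acyclic orientations. $A_o^*$ is the set of non-root arcs $a$ with $4\in[\mathrm{ri}(a):\mathrm{rt}(a)[$, or $2\in[\mathrm{lt}(a):\mathrm{li}(a)[$, or $(\mathrm{ri}(a),\mathrm{rt}(a),\mathrm{lt}(a),\mathrm{li}(a))=(1,1,3,3)$. $A_e^*$ is the set of non-root arcs $a$ with $3\in[\mathrm{ri}(a):\mathrm{rt}(a)[$,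 or $1\in[\mathrm{lt}(a):\mathrm{li}(a)[$, or $(\mathrm{ri}(a),\mathrm{rt}(a),\mathrm{lt}(a),\mathrm{li}(a))=(4,4,2,2)$. $\overline{A_o^*}$ (resp. $\overline{A_e^*}$) is the set of non-root edges not in the support of $A_o^*$ (resp. $A_e^*$). Diagonals. Clockwise around a non-root face, the corners of each given label form a (possibly empty) interval. In each non-root face $f$, the odd (resp. even) diagonal arc goes from the vertex at the last corner labeled 4 (resp. 3) clockwise around $f$ to the vertex at the last corner labeled 2 (resp. 1) clockwise around $f$, if both corners exist. The augmented dual bipolar contraction $\overrightarrow{A}_o^*$ (resp. $\overrightarrow{A}_e^*$) is obtained from $A_o^*$ (resp. $A_e^*$) by adding all odd (resp. even) diagonal arcs and contracting all edges of $\overline{A_o^*}$ (resp. $\overline{A_e^*}$). Increasing functions. A real-valued function $h^*$ on the non-root vertices is $\overrightarrow{A}_o^*$-increasing (resp. $\overrightarrow{A}_e^*$-increasing) if $h^*(u)=h^*(v)$ for every edge $\{u,v\}$ in $\overline{A_o^*}$ (resp. $\overline{A_e^*}$), and $h^*(u)<h^*(v)$ for every arc $(u,v)$ in $A_o^*$ (resp. $A_e^*$) and every odd (resp. even) diagonal arc $(u,v)$. $\mathcal{L}^*$-rule for drawing edges. For a point $A\in\mathbb{R}^2$, let $\gamma_1(A),\gamma_2(A),\gamma_3(A),\gamma_4(A)$ be the half-lines starting at $A$ in the negative $x$-, positive $y$-, positive $x$-, negative $y$-direction respectively. Given a placement $\alpha$ of the non-root vertices, a non-root edge $e=\{u,v\}$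 having exactly two colors, of different parity, say $(u,v)$ of color $i$ and $(v,u)$ of color $j$, is drawn as the bent edge $[\alpha(u),X]\cup[X,\alpha(v)]$ where $X$ is the intersection of $\gamma_i(\alpha(u))$ and $\gamma_j(\alpha(v))$ (assumed non-empty); every other non-root edge is drawn as the straight segment between its ends. Drawings. An SPO (suspended planar orthogonal) drawing of $G^*$ is a planar drawing of the map obtained from $G^*$ by disconnecting $e_1^*,\dots,e_4^*$ from $v_\infty$ ($v_\infty$ is not drawn), in which each edge is a sequence of horizontal and vertical segments, and $e_1^*,e_2^*,e_3^*,e_4^*$ are drawn as dangling arrows in the outer face with directions west, north, east, south respectively. In the claim the root edges are drawn as such dangling arrows, and the claim includes that the $\mathcal{L}^*$-rule can be applied to every non-root edge. *)

(* Defs.v *)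
From HB Require Import structures.
From mathcomp Require Import all_boot all_order all_algebra all_fingroup.

Set Implicit Arguments.
Unset Strict Implicit.
Unset Printing Implicit Defensive.

Import Order.TTheory GRing.Theory Num.Theory.
Local Open Scope ring_scope.

(* Maps on an oriented sphere.  A dart is an arc (an edge with a direction);
   [cw] sends an arc to the next one in clockwise order around its initial
   vertex and [flip] reverses arcs.  Loops and multiple edges are allowed. *)
Record cmap := CMap {
  dart : finType;
  cw : {perm dart};
  flip : {perm dart};
  flip_involutive : involutive flip;
  flip_neq : forall d, flip d != d }.

(* The set of arcs with the same initial vertex as [d] stands for that vertex. *)
Definition vert (M : cmap) (d : dart M) : {set dart M} := porbit (cw M) d.

(* The next arc along the face on the right of [d], i.e. clockwise around that
   face: after reaching the end of [d] one leaves along the arc preceding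
   [flip d] in clockwise order.  Recall that (s * t) x = t (s x) in {perm _}. *)
Definition face_perm (M : cmap) : {perm dart M} := (flip M * (cw M)^-1)%g.

Definition rface (M : cmap) (d : dart M) : {set dart M} :=
  porbit (face_perm M) d.

Definition map_connected (M : cmap) : Prop :=
  forall d d' : dart M,
    connect (fun x y => (y == cw M x) || (y == flip M x)) d d'.

Definition planar (M : cmap) : Prop :=
  map_connected M /\
  (#|porbits (cw M)| + #|porbits (face_perm M)| = #|porbits (flip M)| + 2)%N.

(* The arc dual to [d] crosses it from its right side to its left side, so the
   clockwise order of arcs around a dual vertex is the clockwise order around
   the corresponding face. *)
Definition dual (M : cmap) : cmap :=
  {| dart := dart M; cw := face_perm M; flip := flip M;
     flip_involutive := @flip_involutive M; flip_neq := @flip_neq M |}.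

(* The face on the right of the arc dual to [d] is dual to the terminal vertex
   of [d], that is, to the initial vertex of [flip d]. *)
Lemma dual_rfaceE (M : cmap) (d d' : dart M) :
  (d' \in @rface (dual M) d) = (flip M d' \in vert (flip M d)).
Proof.
have oK := @flip_involutive M.
have iter_face n x : iter n (face_perm (dual M)) x =
    flip M (iter n (cw M) (flip M x)).
  elim: n => [|n IHn] /=; first by rewrite oK.
  rewrite {}IHn /face_perm /= permM invMg invgK permM oK.
  apply: (canRL (g := flip M)) => //.
  have -> : ((flip M)^-1)%g = flip M.
    by apply/permP => y; apply: (@perm_inj _ (flip M)); rewrite permKV oK.
  by rewrite oK.
apply/porbitP/porbitP => -[i].
  by rewrite permX iter_face => ->; exists i; rewrite permX oK.
move=> e; exists i.
by rewrite permX iter_face -permX -e oK.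
Qed.

(* Indices and labels {1,2,3,4} modulo 4 are elements of 'Z_4, with 4 = 0. *)
Definition jump (i j : 'Z_4) : nat := nat_of_ord (j - i)%R.

(* [root_arc r i] is the arc from v_i to v_{i+1}; the outer face is on its
   left, and [root_arc r 1 = r]. *)
Definition root_arc (G : cmap) (r : dart G) (i : 'Z_4) : dart G :=
  iter (jump 1 i) (fun d => cw G (flip G d)) r.

Definition root_vertex (G : cmap) (r : dart G) (i : 'Z_4) : {set dart G} :=
  vert (root_arc r i).

Definition outer_face (G : cmap) (r : dart G) : {set dart G} :=
  rface (flip G r).

Record square_34_angulation (G : cmap) (r : dart G) : Prop := {
  angulation_planar : planar G;
  angulation_outer_degree : #|outer_face r| = 4%N;
  angulation_outer_vertices : injective (root_vertex r);
  angulation_inner_degree : forall d, d \notin outer_face r ->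
    #|rface d| = 3%N \/ #|rface d| = 4%N }.

(* The last clause forbids going back and forth along a single edge. *)
Definition simple_cycle (M : cmap) (c : seq (dart M)) : Prop :=
  [/\ c != [::],
      path.cycle (fun d d' => vert (flip M d) == vert d') c,
      uniq [seq vert d | d <- c] &
      forall d, d \in c -> flip M d \notin c].

Definition face_contour (M : cmap) (c : seq (dart M)) : Prop :=
  exists d : dart M, c =i rface d \/ [seq flip M x | x <- c] =i rface d.

Definition adapted (M : cmap) : Prop :=
  forall c : seq (dart M),
    simple_cycle c -> ~ face_contour c -> (4 <= size c)%N.

(* From here on, arcs, vertices and faces are those of [dual G].  A corner is
   named by the arc preceding it in clockwise order around its vertex: the
   corner [a] lies on the right of the arc [a] at its initial vertex. *)

Definition v_infty (G : cmap) (r : dart G) : {set dart (dual G)} :=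
  @vert (dual G) (flip G r).

Definition nonroot_corner (G : cmap) (r : dart G) (c : dart (dual G)) : bool :=
  c \notin v_infty r.

Definition nonroot_arc (G : cmap) (r : dart G) (a : dart (dual G)) : bool :=
  (a \notin v_infty r) && (flip (dual G) a \notin v_infty r).

(* The face on the right of [a] is the root face f_i^*, see [dual_rfaceE]. *)
Definition in_root_face (G : cmap) (r : dart G) (i : 'Z_4)
    (a : dart (dual G)) : bool :=
  vert (flip G a) == root_vertex r i.

Definition nonroot_face (G : cmap) (r : dart G) (a : dart (dual G)) : bool :=
  [forall i : 'Z_4, ~~ in_root_face r i a].

(* k \in [i:j[ *)
Definition cyc_itv (i j k : 'Z_4) : bool := (jump i k < jump i j)%N.

Definition ri (G : cmap) (L : dart (dual G) -> 'Z_4) (a : dart (dual G)) :=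
  L a.
Definition li (G : cmap) (L : dart (dual G) -> 'Z_4) (a : dart (dual G)) :=
  L ((cw (dual G))^-1%g a).
Definition rt (G : cmap) (L : dart (dual G) -> 'Z_4) (a : dart (dual G)) :=
  li L (flip (dual G) a).
Definition lt (G : cmap) (L : dart (dual G) -> 'Z_4) (a : dart (dual G)) :=
  ri L (flip (dual G) a).

(* The values of [L] at the corners incident to v_infty are irrelevant. *)
Record dual_4GS_labeling (G : cmap) (r : dart G)
    (L : dart (dual G) -> 'Z_4) : Prop := {
  GS_L0 : forall c i, nonroot_corner r c -> in_root_face r i c -> L c = i;
  GS_L1_face : forall a, nonroot_face r a ->
    (\sum_(c in rface a) jump (L c) (L (face_perm (dual G) c)) = 4)%N;
  GS_L1_vertex : forall a, nonroot_corner r a ->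
    (\sum_(c in vert a) jump (L c) (L (cw (dual G) c)) = 4)%N;
  GS_L2 : forall c, nonroot_corner r c -> L c != L (cw (dual G) c);
  GS_L3 : forall a, nonroot_arc r a -> #|vert a| = 3%N ->
    (2 <= jump (li L a) (ri L a) + jump (ri L a) (rt L a))%N }.

Definition colors (G : cmap) (L : dart (dual G) -> 'Z_4) (a : dart (dual G)) :
    {set 'Z_4} :=
  [set k | cyc_itv (li L a) (ri L a) k].

Definition edge_colors (G : cmap) (L : dart (dual G) -> 'Z_4)
    (a : dart (dual G)) : {set 'Z_4} :=
  colors L a :|: colors L (flip (dual G) a).

(* The edge of [a] has exactly two colors, of different parity, with [i] a
   color of [a] and [j] a color of the opposite arc. *)
Definition bent_colors (G : cmap) (L : dart (dual G) -> 'Z_4)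
    (a : dart (dual G)) (i j : 'Z_4) : bool :=
  [&& i \in colors L a, j \in colors L (flip (dual G) a),
      edge_colors L a == [set i; j] & odd i != odd j].

(* A_o^* *)
Definition odd_arc (G : cmap) (r : dart G) (L : dart (dual G) -> 'Z_4)
    (a : dart (dual G)) : bool :=
  nonroot_arc r a &&
  [|| cyc_itv (ri L a) (rt L a) 4, cyc_itv (lt L a) (li L a) 2 |
      [&& ri L a == 1, rt L a == 1, lt L a == 3 & li L a == 3]].

(* A_e^* *)
Definition even_arc (G : cmap) (r : dart G) (L : dart (dual G) -> 'Z_4)
    (a : dart (dual G)) : bool :=
  nonroot_arc r a &&
  [|| cyc_itv (ri L a) (rt L a) 3, cyc_itv (lt L a) (li L a) 1 |
      [&& ri L a == 4, rt L a == 4, lt L a == 2 & li L a == 2]].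

(* [c] is the last corner labeled [k] in clockwise order around its face. *)
Definition last_corner (G : cmap) (L : dart (dual G) -> 'Z_4) (k : 'Z_4)
    (c : dart (dual G)) : bool :=
  (L c == k) && (L (face_perm (dual G) c) != k).

(* There is a diagonal arc from the vertex at corner [c] to the vertex at
   corner [c'], the last corners labeled [k] and [l] of a non-root face. *)
Definition diagonal (G : cmap) (r : dart G) (L : dart (dual G) -> 'Z_4)
    (k l : 'Z_4) (c c' : dart (dual G)) : bool :=
  [&& nonroot_face r c, c' \in rface c, last_corner L k c & last_corner L l c'].

Definition odd_diagonal (G : cmap) (r : dart G) (L : dart (dual G) -> 'Z_4) :=
  diagonal r L 4 2.
Definition even_diagonal (G : cmap) (r : dart G) (L : dart (dual G) -> 'Z_4) :=
  diagonal r L 3 1.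

From mathcomp Require Import all_classical all_reals all_analysis.
Import numFieldNormedType.Exports.
Local Open Scope classical_set_scope.

(* Functions on non-root vertices are given on all sets of arcs; only their
   values at the sets [vert a] with [nonroot_corner r a] matter. *)
Definition increasing (R : realType) (G : cmap) (r : dart G)
    (A : pred (dart (dual G))) (D : rel (dart (dual G)))
    (h : {set dart (dual G)} -> R) : Prop :=
  [/\ forall a, nonroot_arc r a -> ~~ A a -> ~~ A (flip (dual G) a) ->
        h (vert a) = h (vert (flip (dual G) a)),
      forall a, A a -> h (vert a) < h (vert (flip (dual G) a)) &
      forall c c', D c c' -> h (vert c) < h (vert c')].

Definition odd_increasing (R : realType) (G : cmap) (r : dart G)
    (L : dart (dual G) -> 'Z_4) (h : {set dart (dual G)} -> R) : Prop :=
  increasing r (odd_arc r L) (odd_diagonal r L) h.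
Definition even_increasing (R : realType) (G : cmap) (r : dart G)
    (L : dart (dual G) -> 'Z_4) (h : {set dart (dual G)} -> R) : Prop :=
  increasing r (even_arc r L) (even_diagonal r L) h.

(* gamma_k(A); the directions 1, 2, 3, 4 (west, north, east, south) are in
   clockwise order. *)
Definition half_line (R : realType) (k : 'Z_4) (A : R * R) : set (R * R) :=
  [set P | [\/ k = 1 /\ (P.1 <= A.1 /\ P.2 = A.2),
               k = 2 /\ (P.1 = A.1 /\ A.2 <= P.2),
               k = 3 /\ (A.1 <= P.1 /\ P.2 = A.2) |
               k = 4 /\ (P.1 = A.1 /\ P.2 <= A.2)]].

Definition segment (R : realType) (A B : R * R) : set (R * R) :=
  [set P | exists2 t : R, 0 <= t <= 1 &
     P = (A.1 + t * (B.1 - A.1), A.2 + t * (B.2 - A.2))].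

(* Polygonal lines are given by their sequences of vertices. *)
Definition pt (R : realType) (p : seq (R * R)) (i : nat) : R * R :=
  nth (0, 0) p i.

Definition side (R : realType) (p : seq (R * R)) (i : nat) : set (R * R) :=
  segment (pt p i) (pt p i.+1).

Definition polyline (R : realType) (p : seq (R * R)) : set (R * R) :=
  [set P | exists2 i, (i.+1 < size p)%N & side p i P].

Definition orthogonal_polyline (R : realType) (p : seq (R * R)) : Prop :=
  forall i, (i.+1 < size p)%N ->
    (pt p i).1 = (pt p i.+1).1 \/ (pt p i).2 = (pt p i.+1).2.

(* No self-intersection, except that the two ends may coincide (loops). *)
Definition simple_polyline (R : realType) (p : seq (R * R)) : Prop :=
  [/\ (1 < size p)%N,
      forall i, (i.+1 < size p)%N -> pt p i <> pt p i.+1 &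
      forall i j P, (i < j)%N -> (j.+1 < size p)%N -> side p i P -> side p j P ->
        (j = i.+1 /\ P = pt p j) \/
        [/\ i = 0%N, j.+2 = size p, P = pt p 0 & P = pt p j.+1]].

(* The unbounded face of the complement of [D]. *)
Definition unbounded_face (R : realType) (D : set (R * R)) : set (R * R) :=
  [set P | (~` D) P /\ ~ bounded_set (connected_component (~` D) P)].

(* The part of the drawing formed by the non-root vertices and edges. *)
Definition skeleton (R : realType) (G : cmap) (r : dart G)
    (pos : {set dart (dual G)} -> R * R)
    (draw : dart (dual G) -> seq (R * R)) : set (R * R) :=
  [set P | (exists2 a, nonroot_corner r a & P = pos (vert a)) \/
           (exists2 a, nonroot_arc r a & polyline (draw a) P)].

(* [draw a] is the line representing [a], for each arc [a] issued from a
   non-root vertex; for the arcs [root_arc r i], which go to v_infty, it is the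
   dangling arrow (its length being unspecified). *)
Record SPO_drawing (R : realType) (G : cmap) (r : dart G)
    (pos : {set dart (dual G)} -> R * R)
    (draw : dart (dual G) -> seq (R * R)) : Prop := {
  SPO_vertices : forall a b, nonroot_corner r a -> nonroot_corner r b ->
    pos (vert a) = pos (vert b) -> vert a = vert b;
  SPO_start : forall a, nonroot_corner r a -> pt (draw a) 0 = pos (vert a);
  SPO_rev : forall a, nonroot_arc r a ->
    draw (flip (dual G) a) = rev (draw a);
  SPO_simple : forall a, nonroot_corner r a -> simple_polyline (draw a);
  SPO_orthogonal : forall a, nonroot_corner r a -> orthogonal_polyline (draw a);
  SPO_edge_vertex : forall a b, nonroot_corner r a -> nonroot_corner r b ->
    polyline (draw a) (pos (vert b)) ->
    vert b = vert a \/ vert b = vert (flip (dual G) a);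
  (* by the previous condition, the common vertex is an end of both edges *)
  SPO_edge_edge : forall a b P, nonroot_corner r a -> nonroot_corner r b ->
    b != a -> b != flip (dual G) a ->
    polyline (draw a) P -> polyline (draw b) P ->
    exists2 c, nonroot_corner r c & P = pos (vert c);
  (* the drawing induces the rotation system of the map: around each vertex,
     [cw a] is the first arc after [a] in clockwise order *)
  SPO_rotation : forall a b i j k, nonroot_corner r a -> b \in vert a ->
    b != a ->
    half_line i (pos (vert a)) (pt (draw a) 1) ->
    half_line j (pos (vert a)) (pt (draw (cw (dual G) a)) 1) ->
    half_line k (pos (vert a)) (pt (draw b) 1) ->
    (0 < jump i j <= jump i k)%N;
  SPO_arrow : forall i : 'Z_4, let a : dart (dual G) := root_arc r i in
    exists2 Q, half_line i (pos (vert a)) Q & draw a = [:: pos (vert a); Q];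
  SPO_arrow_outer : forall (i : 'Z_4) P,
    let a : dart (dual G) := root_arc r i in
    polyline (draw a) P -> P <> pos (vert a) ->
    unbounded_face (skeleton r pos draw) P }.

(* The L^*-rule for drawing the edge of the arc [a]. *)
Definition Lstar_rule (R : realType) (G : cmap) (L : dart (dual G) -> 'Z_4)
    (pos : {set dart (dual G)} -> R * R) (a : dart (dual G))
    (p : seq (R * R)) : Prop :=
  let u := pos (vert a) in
  let v := pos (vert (flip (dual G) a)) in
  (exists i j X, [/\ bent_colors L a i j, half_line i u X, half_line j v X &
                     p = [:: u; X; v]]) \/
  ((~ exists i j, bent_colors L a i j) /\ p = [:: u; v]).

(* Main.v *)
(* The argument uses no topology of the plane beyond the connectedness of a ray.
   Cut the vertices by a horizontal level into low and high ones, ties being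
   broken one horizontal component at a time, and consider the upward arcs
   crossing the level.  From such an arc one passes to the next one by following
   the face on its right clockwise up to the first downward arc, and reversing it.
   Around a non-root face the labels form four monotone staircases; together with
   the diagonal arcs this forces the vertical part of the next arc to lie strictly
   to the right.  So there is no cycle, and each chain ends in f_4^* or f_3^*,
   whose boundary from the south to the north arrow is monotone and hence crosses
   the level only once.  As the next-arc map is injective, all crossing arcs lie
   on one chain and have distinct abscissas.  This separates vertical parts from
   each other and from the vertices, and a quarter turn does the same for
   horizontal parts.  A vertical part cannot meet the inside of a horizontal part,
   because for a level at the height of the latter two consecutive crossing arcs,
   on the face above it, lie on either side of it.  The arrows are covered by
   letting the root edges have a finite but arbitrarily large length.  That the
   label jumps around each edge add up to exactly 4, which gives the possible
   shapes of an edge, follows from Euler's formula. *)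
Require Import Defs.
From HB Require Import structures.
From mathcomp Require Import all_boot all_order all_algebra all_fingroup.
From mathcomp Require Import zify ring lra.

Set Implicit Arguments.
Unset Strict Implicit.
Unset Printing Implicit Defensive.

Import Order.TTheory GRing.Theory Num.Theory.
Local Open Scope ring_scope.

(** Many vertices may share a height, and the delicate cases (a vertical part that touches a vertex,
    two edges that meet end to end) occur exactly at such heights, where a generic level says
    nothing. A level is therefore a height together with a choice of side for each horizontal
    component at that height: raising or lowering the component of one end of an edge makes the edge
    cross a level that it only reaches. All that the arguments on faces need to know about an edge
    is its two labels on the right and its two directions, as listed in [om_arc_table]. An edge with
    three or four colors is straight, and its directions are chosen so that this table still
    applies. The table involves only differences modulo 4, which is why turned drawings satisfy the
    same axioms. *)

(* The dual map with v_infty split into the four ends of the root edges, together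
   with a placement of its vertices and of these ends.  [om_ext] marks the arcs
   issued from the ends, [om_root i] is the arc of e_i^*, and [om_root_face i]
   the arcs with f_i^* on their right.  [om_coord k] is the coordinate that
   increases in direction [k], and [om_dir a] is the direction in which the
   drawing of [a] leaves its initial vertex.  Every field is invariant under
   the quarter turn [k -> k + 1]. *)
Record ortho (R : realFieldType) (D : finType) := Ortho {
  om_cw : {perm D};
  om_face : {perm D};
  om_flip : D -> D;
  om_ext : pred D;
  om_root : 'Z_4 -> D;
  om_root_face : 'Z_4 -> pred D;
  om_label : D -> 'Z_4;
  om_dir : D -> 'Z_4;
  om_coord : 'Z_4 -> D -> R;
  om_flipK : involutive om_flip;
  om_cw_face : forall a, om_cw (om_face a) = om_flip a;
  om_ext_cw : forall a, om_ext (om_cw a) = om_ext a;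
  om_ext_flip : forall a, om_ext a -> ~~ om_ext (om_flip a);
  om_extP : forall a, om_ext a -> exists i, a = om_flip (om_root i);
  om_ext_root : forall i, om_ext (om_flip (om_root i));
  om_face_root : forall i, om_face (om_root i) = om_flip (om_root (i + 1));
  om_coord_opp : forall k a, om_coord (k + 2) a = - om_coord k a;
  om_coord_cw : forall k a, ~~ om_ext a -> om_coord k (om_cw a) = om_coord k a;
  om_coord_dir : forall a, om_coord (om_dir a) a < om_coord (om_dir a) (om_flip a);
  om_coord_straight : forall a, om_dir (om_flip a) = om_dir a + 2 ->
    om_coord (om_dir a + 1) a = om_coord (om_dir a + 1) (om_flip a);
  om_coord_max : forall i a, a != om_flip (om_root i)
    -> om_coord i a < om_coord i (om_flip (om_root i));
  om_dir_root : forall i, om_dir (om_root i) = i;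
  om_dir_flip_root : forall i, om_dir (om_flip (om_root i)) = i + 2;
  om_dir_inj : forall a b, ~~ om_ext a -> b \in porbit om_cw a ->
    om_dir a = om_dir b -> a = b;
  om_dir_ex : forall a i, ~~ om_ext a ->
    exists2 b, b \in porbit om_cw a & om_dir b = i \/ om_dir b = i + 2;
  om_arc_table : forall a, ~~ om_ext a -> ~~ om_ext (om_flip a) ->
    [\/ om_label (om_face a) = om_label a /\
          [\/ om_dir a = om_label a + 2 /\ om_dir (om_flip a) = om_label a,
              om_dir a = om_label a + 3 /\ om_dir (om_flip a) = om_label a + 1 |
              om_dir a = om_label a + 3 /\ om_dir (om_flip a) = om_label a],
        [/\ om_label (om_face a) = om_label a + 1, om_dir a = om_label a + 3 &
            om_dir (om_flip a) = om_label a + 1] |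
        [/\ om_label (om_face a) = om_label a + 2, om_dir a = om_label a + 3 &
            om_dir (om_flip a) = om_label a + 2]];
  om_root_face_next : forall i a, om_root_face i (om_face a) = om_root_face i a;
  om_root_face_orbit : forall i a, om_root_face i a ->
    a \in porbit om_face (om_flip (om_root i));
  om_root_face_root : forall i, om_root_face i (om_flip (om_root i));
  om_root_face_uniq : forall i j a, om_root_face i a -> om_root_face j a -> i = j;
  om_root_face_label : forall i a, ~~ om_ext a -> om_root_face i a -> om_label a = i;
  om_face_sum : forall a, (forall i, ~~ om_root_face i a) ->
    (\sum_(c in porbit om_face a) jump (om_label c) (om_label (om_face c)) = 4)%N;
  om_diagonal : forall k c c', (forall i, ~~ om_root_face i c)
    -> c' \in porbit om_face c ->
    om_label c = k -> om_label (om_face c) != k -> om_label c' = k + 2 ->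
      om_label (om_face c') != k + 2 ->
    om_coord (k + 3) c < om_coord (k + 3) c' }.

Lemma Z4P (x : 'Z_4) : [\/ x = 0, x = 1, x = 2 | x = 3].
Proof.
case: x => [[|[|[|[|]]]] h] //; [apply: Or41|apply: Or42|apply: Or43|apply: Or44];
  exact: val_inj.
Qed.

Lemma Z4E : ((0 + 1)%R = 1%R :> 'Z_4) *
  ((0 + 2)%R = 2%R :> 'Z_4) *
  ((0 + 3)%R = 3%R :> 'Z_4) *
  ((1 + 1)%R = 2%R :> 'Z_4) *
  ((1 + 2)%R = 3%R :> 'Z_4) *
  ((1 + 3)%R = 0%R :> 'Z_4) *
  ((2 + 1)%R = 3%R :> 'Z_4) *
  ((2 + 2)%R = 0%R :> 'Z_4) *
  ((2 + 3)%R = 1%R :> 'Z_4) *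
  ((3 + 1)%R = 0%R :> 'Z_4) *
  ((3 + 2)%R = 1%R :> 'Z_4) *
  ((3 + 3)%R = 2%R :> 'Z_4).
Proof. by do !split; apply: val_inj. Qed.

(** * Labels and staircases around a face *)

Section ArcTables.
Context (R : realFieldType) (D : finType) (S : ortho R D).

Local Notation sg := (om_cw S).
Local Notation psi := (om_face S).
Local Notation tau := (om_flip S).
Local Notation ext := (om_ext S).
Local Notation rho := (om_root S).
Local Notation rf := (om_root_face S).
Local Notation lab := (om_label S).
Local Notation dir := (om_dir S).
Local Notation H := (om_coord S).
Local Notation Y := (H 0).
Local Notation X := (H 1).

(* In the sections up to the quarter turns, direction 0 points upwards: [Y] is the
   height and [X] the abscissa.  The labels 0, 1, 2, 3 then occur on the SE, SW,
   NW and NE sides of a face. *)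
Lemma H2E a : H 2 a = - Y a. Proof. by rewrite -om_coord_opp Z4E. Qed.
Lemma H3E a : H 3 a = - X a. Proof. by rewrite -om_coord_opp Z4E. Qed.

(** Indexed by the directions of [a] and [tau a]. Equal directions are absent: one coordinate would
    increase both ways. *)
Variant dirs_spec (a : D) : 'Z_4 -> 'Z_4 -> Prop :=
| Dirs01 of Y a < Y (tau a) & X (tau a) < X a : dirs_spec a 0 1
| Dirs02 of Y a < Y (tau a) & X a = X (tau a) : dirs_spec a 0 2
| Dirs03 of Y a < Y (tau a) & X a < X (tau a) : dirs_spec a 0 3
| Dirs10 of Y (tau a) < Y a & X a < X (tau a) : dirs_spec a 1 0
| Dirs12 of Y a < Y (tau a) & X a < X (tau a) : dirs_spec a 1 2
| Dirs13 of Y a = Y (tau a) & X a < X (tau a) : dirs_spec a 1 3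
| Dirs20 of Y (tau a) < Y a & X a = X (tau a) : dirs_spec a 2 0
| Dirs21 of Y (tau a) < Y a & X (tau a) < X a : dirs_spec a 2 1
| Dirs23 of Y (tau a) < Y a & X a < X (tau a) : dirs_spec a 2 3
| Dirs30 of Y (tau a) < Y a & X (tau a) < X a : dirs_spec a 3 0
| Dirs31 of Y a = Y (tau a) & X (tau a) < X a : dirs_spec a 3 1
| Dirs32 of Y a < Y (tau a) & X (tau a) < X a : dirs_spec a 3 2.

Lemma dirsP a : dirs_spec a (dir a) (dir (tau a)).
Proof.
have h1 := om_coord_dir S a; have h2 := om_coord_dir S (tau a); have h3 :=
  @om_coord_straight _ _ S a.
rewrite om_flipK in h2.
case: (Z4P (dir a)) => ea; case: (Z4P (dir (tau a))) => et;
  rewrite ?ea ?et ?Z4E ?H2E ?H3E in h1 h2 h3 *;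
  first [move: (h3 erefl) => {}h3; rewrite ?H2E in h3 | clear h3];
  clear ea et; first [exfalso; lra | constructor; lra].
Qed.

(** Indexed by the two labels on the right of [a], then the two directions. In the name of a
    constructor, the first digit is the label at the start and the second is the row of
    [om_arc_table]. *)
Variant table_spec (a : D) : 'Z_4 -> 'Z_4 -> 'Z_4 -> 'Z_4 -> Prop :=
| Table00 of Y (tau a) < Y a & X a = X (tau a) : table_spec a 0 0 2 0
| Table01 of Y a = Y (tau a) & X (tau a) < X a : table_spec a 0 0 3 1
| Table02 of Y (tau a) < Y a & X (tau a) < X a : table_spec a 0 0 3 0
| Table03 of Y a = Y (tau a) & X (tau a) < X a : table_spec a 0 1 3 1
| Table04 of Y a < Y (tau a) & X (tau a) < X a : table_spec a 0 2 3 2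
| Table10 of Y a = Y (tau a) & X (tau a) < X a : table_spec a 1 1 3 1
| Table11 of Y a < Y (tau a) & X a = X (tau a) : table_spec a 1 1 0 2
| Table12 of Y a < Y (tau a) & X (tau a) < X a : table_spec a 1 1 0 1
| Table13 of Y a < Y (tau a) & X a = X (tau a) : table_spec a 1 2 0 2
| Table14 of Y a < Y (tau a) & X a < X (tau a) : table_spec a 1 3 0 3
| Table20 of Y a < Y (tau a) & X a = X (tau a) : table_spec a 2 2 0 2
| Table21 of Y a = Y (tau a) & X a < X (tau a) : table_spec a 2 2 1 3
| Table22 of Y a < Y (tau a) & X a < X (tau a) : table_spec a 2 2 1 2
| Table23 of Y a = Y (tau a) & X a < X (tau a) : table_spec a 2 3 1 3
| Table24 of Y (tau a) < Y a & X a < X (tau a) : table_spec a 2 0 1 0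
| Table30 of Y a = Y (tau a) & X a < X (tau a) : table_spec a 3 3 1 3
| Table31 of Y (tau a) < Y a & X a = X (tau a) : table_spec a 3 3 2 0
| Table32 of Y (tau a) < Y a & X a < X (tau a) : table_spec a 3 3 2 3
| Table33 of Y (tau a) < Y a & X a = X (tau a) : table_spec a 3 0 2 0
| Table34 of Y (tau a) < Y a & X (tau a) < X a : table_spec a 3 1 2 1.

Lemma tableP a : ~~ ext a -> ~~ ext (tau a) ->
  table_spec a (lab a) (lab (psi a)) (dir a) (dir (tau a)).
Proof.
move=> na nt.
have := dirsP a; case: (om_arc_table na nt) => [[-> [][-> ->]]|[-> -> ->]|[-> -> ->]];
case: (Z4P (lab a)) => ->; rewrite ?Z4E => h; inversion h; by constructor.
Qed.

End ArcTables.

Lemma jump0 (i j : 'Z_4) : (jump i j == 0)%N = (i == j).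
Proof. by case: (Z4P i) => ->; case: (Z4P j) => ->. Qed.

Lemma jump1 (i j : 'Z_4) : (jump i j == 1)%N = (j == i + 1).
Proof. by case: (Z4P i) => ->; case: (Z4P j) => ->. Qed.

Lemma jump_modn (i j : 'Z_4) : ((jump i j + i) %% 4 = j)%N.
Proof. by case: (Z4P i) => ->; case: (Z4P j) => ->. Qed.

Section Walks.
Context (R : realFieldType) (D : finType) (S : ortho R D).

Local Notation sg := (om_cw S).
Local Notation psi := (om_face S).
Local Notation tau := (om_flip S).
Local Notation ext := (om_ext S).
Local Notation rho := (om_root S).
Local Notation rf := (om_root_face S).
Local Notation lab := (om_label S).
Local Notation dir := (om_dir S).
Local Notation H := (om_coord S).
Local Notation Y := (H 0).
Local Notation X := (H 1).

Definition inner_face (a : D) : bool := [forall i, ~~ rf i a].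

Lemma inner_faceP a : reflect (forall i, ~~ rf i a) (inner_face a).
Proof. exact: forallP. Qed.

Lemma inner_face_iter n a : inner_face (iter n psi a) = inner_face a.
Proof. by elim: n => //= n <-; apply: eq_forallb => i; rewrite om_root_face_next. Qed.

Lemma inner_face_porbit a b : b \in porbit psi a -> inner_face b = inner_face a.
Proof. by case/porbitP => n ->; rewrite permX inner_face_iter. Qed.

Lemma rf_rho1 i : rf (i + 1) (rho i).
Proof. by rewrite -om_root_face_next om_face_root om_root_face_root. Qed.

Lemma inner_face_ext a : inner_face a -> ~~ ext a.
Proof.
move/inner_faceP => h; apply/negP => /om_extP[i e].
by have := h i; rewrite e om_root_face_root.
Qed.

Lemma inner_face_ext_tau a : inner_face a -> ~~ ext (tau a).
Proof.
move/inner_faceP => h; apply/negP => /om_extP[i e].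
have {}e : a = rho i by apply: (can_inj (om_flipK S)).
by have := h (i + 1); rewrite e rf_rho1.
Qed.

Lemma ext_psi a : ext (psi a) = ext (tau a).
Proof. by rewrite -om_cw_face om_ext_cw. Qed.

Lemma H_psi k a : ~~ ext (tau a) -> H k (psi a) = H k (tau a).
Proof. by move=> h; rewrite -om_cw_face om_coord_cw // ext_psi. Qed.

(** The staircase property: for label 1, for instance, the side is the SW one and is followed
    clockwise to the west and upwards. *)
Lemma H_mono_arc a j : ~~ ext a -> ~~ ext (tau a) -> lab (psi a) = lab a ->
  j = lab a + 2 \/ j = lab a + 3 -> H j a <= H j (psi a).
Proof.
move=> na nt; rewrite H_psi // => e hj; move: e.
by case: hj => ->; case: (tableP na nt) => // hY hX _; rewrite ?Z4E ?H2E ?H3E; lra.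
Qed.

Lemma H_incr_arc a : ~~ ext a -> ~~ ext (tau a) -> lab (psi a) = lab a + 1 ->
  H (lab a + 3) a < H (lab a + 3) (psi a).
Proof.
move=> na nt; rewrite H_psi //.
by case: (tableP na nt) => // hY hX _; rewrite ?Z4E ?H2E ?H3E; lra.
Qed.

Definition turning (c : D) (n : nat) : nat :=
  \sum_(i < n) jump (lab (iter i psi c)) (lab (iter i.+1 psi c)).

Lemma turnS c n : turning c n.+1 =
  (turning c n + jump (lab (iter n psi c)) (lab (iter n.+1 psi c)))%N.
Proof. by rewrite /turning big_ord_recr. Qed.

Lemma turnSl c n : turning c n.+1 = (jump (lab c) (lab (psi c)) + turning (psi c) n)%N.
Proof.
rewrite /turning big_ord_recl; congr (_ + _)%N.
by apply: eq_bigr => i _; rewrite /= -iterSr.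
Qed.

Lemma turn_modn c n : ((turning c n + lab c) %% 4 = lab (iter n psi c))%N.
Proof.
elim: n => [|n IHn]; first by rewrite /turning big_ord0 add0n modn_small.
rewrite turnS -[RHS](jump_modn (lab (iter n psi c))) -IHn modnDmr.
by rewrite addnAC [(turning c n + _ + _)%N]addnC.
Qed.

Lemma turn_add c m n : turning c (m + n) = (turning c m + turning (iter m psi c) n)%N.
Proof.
elim: n => [|n IHn]; first by rewrite addn0 [turning _ 0]big_ord0 addn0.
by rewrite addnS !turnS IHn -!iterD -addnA addSn [(n + m)%N]addnC.
Qed.

Lemma turn_le c m n : (m <= n)%N -> (turning c m <= turning c n)%N.
Proof. by move=> /subnKC <-; rewrite turn_add leq_addr. Qed.

Lemma turn_porbit c : inner_face c -> turning c #|porbit psi c| = 4%N.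
Proof.
move=> /inner_faceP nc; rewrite -[RHS](om_face_sum nc).
rewrite (eq_bigl _ _ (porbit_traject psi c)) -big_uniq ?uniq_traject_porbit //=.
rewrite (big_nth c) size_traject big_mkord; apply: eq_bigr => i _.
by rewrite nth_traject.
Qed.

(* [c'] follows [c] within the interval of corners with the same label *)
Definition walk (c c' : D) : Prop :=
  exists2 n, c' = iter n psi c & turning c n = 0%N.

Lemma walk_head c c' : walk c c' -> c = c' \/ walk (psi c) c'.
Proof.
case=> -[|n] -> e; [by left | right; exists n; first by rewrite -iterSr].
by move: e; rewrite turnSl => /eqP; rewrite addn_eq0 => /andP[_ /eqP].
Qed.

Lemma walk_lab c c' : walk c c' -> lab c' = lab c.
Proof.
by case=> n -> e; apply: val_inj; rewrite /= -turn_modn e add0n modn_small.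
Qed.

Lemma walk_last c c' :
  walk c c' -> c = c' \/ exists2 p, psi p = c' & walk c p.
Proof.
case=> -[|n] -> e; [by left | right; exists (iter n psi c) => //].
exists n => //.
by move: e; rewrite turnS => /eqP; rewrite addn_eq0 => /andP[/eqP].
Qed.

Lemma walk_mono c c' j : inner_face c -> walk c c' ->
  j = lab c + 2 \/ j = lab c + 3 -> H j c <= H j c'.
Proof.
move=> nc [n -> +] hj; elim: n => //= n IHn.
rewrite turnS => /eqP; rewrite addn_eq0 jump0 => /andP[/eqP e1 /eqP e2].
have nn : inner_face (iter n psi c) by rewrite inner_face_iter.
have lx : lab (iter n psi c) = lab c by apply: walk_lab; exists n.
apply: (le_trans (IHn e1)); apply: H_mono_arc; rewrite ?lx //.
- exact: inner_face_ext.
- exact: inner_face_ext_tau.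
- by rewrite -lx.
Qed.

(** Direction [lab c + 3] is monotone for the label of [c] and also, being [(lab c + 1) + 2], for
    the next label; the single jump between them is strict. *)
Lemma turn1_incr c n : inner_face c -> turning c n = 1%N ->
  H (lab c + 3) c < H (lab c + 3) (iter n psi c).
Proof.
move=> nc; elim: n => [|n IHn]; first by rewrite /turning big_ord0.
have nn : inner_face (iter n psi c) by rewrite inner_face_iter.
have [nn1 nn2] := (inner_face_ext nn, inner_face_ext_tau nn).
have e0 := turn_modn c n; rewrite turnS /=.
set x := iter n psi c in IHn e0 nn nn1 nn2 *.
move/eqP; rewrite addn_eq1 => /orP[]/andP[/eqP e1 /eqP e2].
  apply: (lt_le_trans (IHn e1)); apply: H_mono_arc => //.
    by apply/eqP; rewrite eq_sym -jump0 e2.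
  left; have -> : lab x = lab c + 1.
    by apply: val_inj; rewrite /= -e0 e1; case: (Z4P (lab c)) => ->.
  by rewrite -addrA Z4E.
have w : walk c x by exists n.
apply: (le_lt_trans (walk_mono nc w (or_intror erefl))).
rewrite -(walk_lab w); apply: H_incr_arc => //.
by apply/eqP; rewrite -jump1 e2.
Qed.

(** The step counts [n] and [m] split one full turn, of total 4, at [c']. *)
Lemma porbit_turn c c' : inner_face c -> c' \in porbit psi c ->
  exists n, [/\ c' = iter n psi c, (turning c n <= 4)%N &
    exists2 m, c = iter m psi c' & (turning c n + turning c' m = 4)%N].
Proof.
move=> nc; rewrite porbit_traject => /trajectP[n ltn ->]; exists n.
have tN := turn_porbit nc; set N := #|_| in ltn tN.
split=> //; first by rewrite -tN turn_le // ltnW.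
exists (N - n)%N; first by rewrite -iterD subnK ?iter_porbit // ltnW.
by rewrite -tN -{2}(subnKC (ltnW ltn)) turn_add.
Qed.

(** Equal labels force the turning from [c] to [c'] to be 0 or 4; in the second case the way back
    has turning 0. *)
Lemma walk_total c c' : inner_face c -> c' \in porbit psi c ->
  lab c' = lab c -> walk c c' \/ walk c' c.
Proof.
move=> nc o e; have [n [e1 l4 [m e2 e4]]] := porbit_turn nc o.
have := turn_modn c n; rewrite -e1 e => e0.
have : turning c n = 0%N \/ turning c n = 4%N.
  by have := ltn_ord (lab c); move: e0; case: (turning c n) l4 => [|[|[|[|[|]]]]] //;
    case: (Z4P (lab c)) => ->; auto.
case=> e3; [by left; exists n | right; exists m => //].
by lia.
Qed.

(** The turning from [c] to [c'] is 1 modulo 4 and at most 4, hence 1. *)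
Lemma corner_lt1 c c' : inner_face c -> c' \in porbit psi c ->
  lab c' = lab c + 1 -> H (lab c + 3) c < H (lab c + 3) c'.
Proof.
move=> nc o e; have [n [e1 l4 _]] := porbit_turn nc o.
have := turn_modn c n; rewrite -e1 e => e0.
rewrite e1; apply: turn1_incr => //.
by move: e0; case: (turning c n) l4 => [|[|[|[|[|]]]]] //;
  case: (Z4P (lab c)) => ->.
Qed.

Lemma walk_to_last c c' : inner_face c -> c' \in porbit psi c ->
  lab c' != lab c ->
  exists z, [/\ walk c z, lab z = lab c, lab (psi z) != lab c & z \in porbit psi c].
Proof.
move=> nc; case/porbitP => n -> h.
have ex : exists n, lab (iter n psi c) != lab c by exists n; rewrite -permX.
case: (ex_minnP ex) => -[|m]; first by rewrite eqxx.
move=> hm min.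
have eqm i : (i <= m)%N -> lab (iter i psi c) = lab c.
  move=> im; apply/eqP; apply/negPn/negP => /min; lia.
exists (iter m psi c); split=> //; try exact: eqm.
  exists m => //; rewrite /turning big1 // => i _; apply/eqP.
  by rewrite jump0 !eqm //; have := ltn_ord i; lia.
by rewrite -permX mem_porbit.
Qed.

(* The monotone walks to the last corners are joined by the diagonal arc. *)
Lemma corner_lt2 c c' : inner_face c -> c' \in porbit psi c ->
  lab c' = lab c + 2 -> H (lab c + 3) c < H (lab c + 3) c'.
Proof.
move=> nc o e; have nc' : inner_face c' by rewrite (inner_face_porbit o).
have o' : c \in porbit psi c' by rewrite porbit_sym.
have ne : lab c' != lab c by rewrite e; case: (Z4P (lab c)) => ->.
have [z [w1 l1 l1' o1]] := walk_to_last nc o ne.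
have [z' [w2 l2 l2' o2]] : exists z, [/\ walk c' z, lab z = lab c',
   lab (psi z) != lab c' & z \in porbit psi c'].
  by apply: walk_to_last o' _ => //; rewrite eq_sym.
have nz : inner_face z by rewrite (inner_face_porbit o1).
have lt : H (lab c + 3) z < H (lab c + 3) z'.
  apply: om_diagonal => //; try (by rewrite ?l2 -?e); first exact/inner_faceP.
  rewrite -eq_porbit_mem in o1; rewrite -eq_porbit_mem in o.
  by rewrite (eqP o1) -(eqP o).
have h1 := walk_mono nc w1 (or_intror erefl).
have h2 := walk_mono nc' w2 (or_intror erefl).
have hop a : H (lab c' + 3) a = - H (lab c + 3) a by rewrite -om_coord_opp e addrAC.
by rewrite !hop lerN2 in h2; lra.
Qed.

End Walks.

(** * The arcs crossing a horizontal level *)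

Section Cuts.
Context (R : realFieldType) (D : finType) (S : ortho R D).

Local Notation sg := (om_cw S).
Local Notation psi := (om_face S).
Local Notation tau := (om_flip S).
Local Notation ext := (om_ext S).
Local Notation rho := (om_root S).
Local Notation rf := (om_root_face S).
Local Notation lab := (om_label S).
Local Notation dir := (om_dir S).
Local Notation H := (om_coord S).
Local Notation Y := (H 0).
Local Notation X := (H 1).

(* the abscissa of the vertical part of a non-horizontal arc *)
Definition xcross (a : D) : R := if dir a == 0 then X a else X (tau a).

(* Vertices at height exactly [t] are below the level [t] when they satisfy [q]. *)
Definition below (t : R) (q : pred D) (a : D) : bool :=
  (Y a < t) || ((Y a == t) && q a).

(* [q] must not separate the ends of a horizontal edge. *)
Record cut (t : R) (q : pred D) : Prop := {
  cut_sg : forall a, ~~ ext a -> q (sg a) = q a;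
  cut_flat : forall a, Y a = Y (tau a) -> q (tau a) = q a;
  cut_top : ~~ below t q (tau (rho 0)) }.

Context (t : R) (q : pred D) (cutP : cut t q).
Local Notation s := (below t q).

Definition crossing (a : D) : bool := s a && ~~ s (tau a).

Lemma low_lt c c' : Y c < Y c' -> s c' -> s c.
Proof.
move=> lt /orP[h|/andP[/eqP h _]]; rewrite /below; first by rewrite (lt_trans lt h).
by rewrite -h lt.
Qed.

Lemma low_flat a : Y a = Y (tau a) -> s (tau a) = s a.
Proof. by move=> e; rewrite /below -e (cut_flat cutP e). Qed.

Lemma low_arc a : Y a <= Y (tau a) -> s (tau a) -> s a.
Proof.
by rewrite le_eqVlt => /orP[/eqP e|]; [rewrite (low_flat e) | exact: low_lt].
Qed.

Lemma low_psi a : ~~ ext (tau a) -> s (psi a) = s (tau a).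
Proof. by move=> h; rewrite /below H_psi // -om_cw_face (cut_sg cutP) // ext_psi. Qed.

Lemma up_lt a : crossing a -> Y a < Y (tau a).
Proof.
case/andP => h1 h2; rewrite ltNge; apply: contra h2 => h2.
by apply: low_arc; rewrite om_flipK.
Qed.

Lemma xvE a : Y a < Y (tau a) ->
  (dir a = 0 -> xcross a = X a) /\ (dir (tau a) = 2 -> xcross a = X (tau a)).
Proof. by rewrite /xcross; case: (dirsP S a). Qed.

Lemma up_inner l : inner_face S l -> crossing l ->
  lab l = 1 /\ xcross l = X l \/ lab (psi l) = 2 /\ xcross l = X (psi l).
Proof.
move=> nl /up_lt; have [n1 n2] := (inner_face_ext nl, inner_face_ext_tau nl).
by rewrite /xcross H_psi //; case: (tableP n1 n2) => hY hX lt;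
  first [exfalso; lra | by left | by right].
Qed.

Lemma down_inner r : inner_face S r -> crossing (tau r) ->
  lab r = 3 /\ xcross (tau r) = X r \/ lab (psi r) = 0 /\ xcross (tau r) = X (psi r).
Proof.
move=> nl /up_lt; have [n1 n2] := (inner_face_ext nl, inner_face_ext_tau nl).
by rewrite /xcross om_flipK H_psi //; case: (tableP n1 n2) => hY hX lt;
  first [exfalso; lra | by left | by right].
Qed.

(** The vertical part of [l] is at a corner labeled 1 or 2, that of [r] at one labeled 3 or 0. The
    staircases and the diagonal compare the abscissas of all these pairs except 1 and 3, which are
    only compared by height; that pair takes the rest of the proof. *)
Lemma cut_step l r : inner_face S l -> r \in porbit psi l ->
  crossing l -> crossing (tau r) -> xcross l < xcross (tau r).
Proof.
move=> nl o ul ur; have nr : inner_face S r by rewrite (inner_face_porbit o).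
have P1 x : porbit psi (psi x) = porbit psi x by have := porbit_perm psi 1 x;
  rewrite expg1.
have Pl := P1 l.
have Pr : porbit psi (psi r) = porbit psi l.
  by rewrite -eq_porbit_mem in o; rewrite -(eqP o) P1.
have [npl npr] : inner_face S (psi l) /\ inner_face S (psi r).
  by rewrite (inner_face_iter S 1 l) (inner_face_iter S 1 r).
have op a b : porbit psi a = porbit psi l -> porbit psi b = porbit psi l ->
  b \in porbit psi a by move=> -> <-; exact: porbit_id.
have orr : porbit psi r = porbit psi l by apply/eqP; rewrite eq_porbit_mem.
case: (up_inner nl ul) => -[ll ->]; case: (down_inner nr ur) => -[lr xr];
  rewrite ?xr; last first.
- have := corner_lt2 npl (op _ _ Pl Pr); rewrite ll lr !Z4E; exact.
- have := corner_lt1 npl (op _ _ Pl orr); rewrite ll lr !Z4E; exact.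
- have := corner_lt1 npr (op _ _ Pr erefl); rewrite ll lr !Z4E !H3E => /(_ erefl).
  by rewrite ltrN2.
have [n1 n2] := (inner_face_ext nl, inner_face_ext_tau nl).
have [m1 m2] := (inner_face_ext nr, inner_face_ext_tau nr).
(* Here [l] itself runs from the SW to the NE side, and [r] follows on the NE side. *)
have [el|nel] := eqVneq (lab (psi l)) 3.
  have lt : X l < X (psi l).
    by move: ll el; rewrite H_psi //; case: (tableP n1 n2).
  case: (walk_total nr (op _ _ orr Pl)); first by rewrite el lr.
    move/walk_last => [->//|[p /perm_inj -> /walk_lab e]].
    by move: e; rewrite ll lr.
  move=> w; apply: (lt_le_trans lt); apply: (walk_mono npl w).
  by rewrite el !Z4E; left.
have [er|ner] := eqVneq (lab (psi r)) 1.
  have lt : X (psi r) < X r.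
    by move: lr er; rewrite H_psi //; case: (tableP m1 m2).
  case: (walk_total nl (op _ _ erefl Pr)); first by rewrite er ll.
    move/walk_last => [->//|[p /perm_inj -> /walk_lab e]].
    by move: e; rewrite ll lr.
  move=> w; apply: le_lt_trans lt.
  have := walk_mono npr w (j := 3); rewrite er !Z4E !H3E lerN2; apply; by left.
have [el|nel2] := eqVneq (lab (psi l)) 2.
  have -> : X l = X (psi l).
    by move: ll el; rewrite H_psi //; case: (tableP n1 n2).
  have := corner_lt1 npl (op _ _ Pl orr); rewrite el lr !Z4E; exact.
have [er|ner2] := eqVneq (lab (psi r)) 0.
  have -> : X r = X (psi r).
    by move: lr er; rewrite H_psi //; case: (tableP m1 m2).
  have := corner_lt1 npr (op _ _ Pr erefl); rewrite ll er !Z4E !H3E => /(_ erefl).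
  by rewrite ltrN2.
(* The two staircases are separated vertically, so no level crosses both. *)
have el : lab (psi l) = 1.
  by move: ll nel nel2; case: (tableP n1 n2).
have er : lab (psi r) = 3.
  by move: lr ner ner2; case: (tableP m1 m2).
have := corner_lt2 npl (op _ _ Pl Pr); rewrite el er !Z4E => /(_ erefl) lt.
have := low_lt lt; rewrite !low_psi //.
by case/andP: ul ur => _ /negPf -> /andP[-> _] => /(_ erefl).
Qed.

(** The last clause makes [tau b] the first downward arc after [a] on the face; injectivity in
    [next_inj] rests on it. *)
Definition next_crossing (a b : D) : Prop :=
  [/\ inner_face S a, crossing a, crossing b & exists n, tau b = iter n psi a /\
    forall i, (0 < i <= n)%N -> ~~ s (iter i psi a)].

Lemma next_ex a : inner_face S a -> crossing a -> exists b, next_crossing a b.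
Proof.
move=> na ua.
(* A full turn comes back to [a], which is low, so the face does return below the level. *)
have ex : exists n, (0 < n)%N && s (iter n psi a).
  exists #|porbit psi a|; rewrite iter_porbit lt0n card_porbit_neq0.
  by case/andP: ua.
case: (ex_minnP ex) => -[|n] //= hs min.
have no i : (0 < i <= n)%N -> ~~ s (iter i psi a).
  by move=> hi; apply/negP => h; have := min i; rewrite h; lia.
have nn : inner_face S (iter n psi a) by rewrite inner_face_iter.
exists (tau (iter n psi a)); split=> //.
  rewrite /crossing om_flipK -low_psi ?inner_face_ext_tau // hs /=.
  case: n no {min nn} hs => [|n] no hs; last by apply: no; lia.
  by move: hs => /=; rewrite low_psi ?inner_face_ext_tau //;
    case/andP: ua => _ /negPf ->.
by exists n; rewrite om_flipK.
Qed.

Lemma next_porbit a b : next_crossing a b -> tau b \in porbit psi a.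
Proof. by case=> _ _ _ [n [-> _]]; rewrite -permX mem_porbit. Qed.

Lemma next_xv a b : next_crossing a b -> xcross a < xcross b.
Proof.
move=> nx; have [na ua ub _] := nx.
by rewrite -(om_flipK S b); apply: cut_step; rewrite ?om_flipK //; exact: next_porbit.
Qed.

(** Cancelling [n] steps would otherwise place [a], which is low, among the high corners after
    [a']. *)
Lemma iter_meet_eq a a' n m : s a ->
  (forall i, (0 < i <= m)%N -> ~~ s (iter i psi a')) -> (n <= m)%N ->
  iter n psi a = iter m psi a' -> a = a'.
Proof.
move=> sa no nm; rewrite -(subnKC nm) iterD -!permX => /perm_inj.
case e: (m - n)%N => [|k]; first by rewrite expg0 perm1.
move=> ea; have : ~~ s (iter k.+1 psi a') by apply: no; lia.
by rewrite -permX -ea sa.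
Qed.

Lemma next_inj a a' b : next_crossing a b -> next_crossing a' b -> a = a'.
Proof.
case=> _ /andP[sa _] _ [n [e1 l1]] [_ /andP[sa' _] _ [m [e l2]]].
rewrite e1 in e.
case: (leqP n m) => [nm|/ltnW mn]; first exact: iter_meet_eq e.
by apply/esym; apply: iter_meet_eq mn (esym e).
Qed.

Inductive chain : D -> D -> Prop :=
| chain_refl a : chain a a
| chain_next a b c : next_crossing a b -> chain b c -> chain a c.

Lemma chain_last a b : chain a b -> a = b \/ exists2 c, chain a c & next_crossing c b.
Proof.
elim=> [x|x y z nx _ [<-|[c ch nc]]]; [by left | right | right].
  by exists x => //; exact: chain_refl.
by exists c => //; exact: chain_next nx ch.
Qed.

Lemma chain_head a b : chain a b -> a = b \/ exists2 c, next_crossing a c & chain c b.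
Proof. by case=> [x|x y z nx ch]; [left | right; exists y]. Qed.

Lemma chain_xv a b : chain a b -> a = b \/ xcross a < xcross b.
Proof.
elim=> [x|x y z nx _ [<-|lt]]; first by left.
  by right; exact: next_xv.
by right; apply: lt_trans lt; exact: next_xv.
Qed.

(* Abscissas increase along a chain, so it cannot cycle. *)
Lemma chain_end a : crossing a -> exists z, [/\ chain a z,
  crossing z & ~~ inner_face S z].
Proof.
have [n] := ubnP #|[set d | xcross a < xcross d]|; elim: n a => // n IHn a le ua.
have [na|na] := boolP (inner_face S a); last by exists a; split=> //; exact: chain_refl.
have [b nx] := next_ex na ua; have lt := next_xv nx.
have [_ _ ub _] := nx; have [||z [ch uz nz]] := IHn b.
- rewrite -ltnS; apply: leq_trans le; apply: proper_card; apply/properP; split.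
    by apply/subsetP => d; rewrite !inE; exact: lt_trans.
  by exists b; rewrite !inE ?lt ?ltxx.
- by [].
by exists z; split=> //; exact: chain_next nx ch.
Qed.

(** Backwards from [z] there is only one way, since [next_crossing] is injective; so one chain is a
    tail of the other. *)
Lemma chain_comparable a b z : chain a z -> chain b z -> chain a b \/ chain b a.
Proof.
move=> ch; elim: ch b => [x|x y w nx _ IH] b cb; first by right.
case: (IH _ cb) => [h|/chain_last[->|[c ch nc]]]; first by left; exact: chain_next nx h.
  by left; apply: chain_next nx _; exact: chain_refl.
by right; rewrite (next_inj nx nc).
Qed.

(** After an outgoing arrow, [psi] jumps from one end at infinity to the next, and coordinates are
    not carried along. A root walk never makes this jump. *)
Definition root_walk (a b : D) : Prop := exists2 n, b = iter n psi a &
  forall j, (j < n)%N -> ~~ ext (tau (iter j psi a)).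

Lemma root_walk_from i a : rf i a -> root_walk (tau (rho i)) a.
Proof.
move=> ra; have := om_root_face_orbit ra; set x0 := tau _.
case/porbitP => k ek.
have ex : exists n, a == iter n psi x0 by exists k; rewrite -permX ek.
case: (ex_minnP ex) => n /eqP e min; exists n => // j jn.
apply/negP => /om_extP[l /(can_inj (om_flipK S)) el].
(* A jump within face [i] lands on [x0] again, against the minimality of [n]. *)
have e1 : iter j.+1 psi x0 = tau (rho (l + 1)) by rewrite /= el om_face_root.
have : rf i (iter j.+1 psi x0).
  by rewrite -permX; elim: j.+1 => [|m IH];
    rewrite ?expg0 ?perm1 ?om_root_face_root // expgSr permM om_root_face_next.
rewrite e1 => /om_root_face_uniq -/(_ _ (om_root_face_root S _)) el1.
have : a = iter (n - j.+1) psi x0.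
  by rewrite e -{1}(subnK jn) iterD e1 -el1.
by move/eqP/min; lia.
Qed.

Lemma root_walk_total i a b : rf i a -> rf i b -> root_walk a b \/ root_walk b a.
Proof.
move=> /root_walk_from[n -> hn] /root_walk_from[m -> hm].
wlog nm : n m hn hm / (n <= m)%N.
  by move=> w; case: (leqP n m) => [|/ltnW] h; [|rewrite or_comm]; exact: w.
left; exists (m - n)%N; first by rewrite -iterD subnK.
by move=> j lt; rewrite -iterD; apply: hm; lia.
Qed.

Lemma root_walk_to i a : rf (i + 1) a -> root_walk a (rho i).
Proof.
move=> ra; case: (root_walk_total ra (rf_rho1 S i)) => // -[[|n] -> h].
  by exists 0%N.
by have := h 0%N isT; rewrite om_ext_root.
Qed.

Variant root_arc_spec (i : 'Z_4) (a : D) : Prop :=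
| RootIn of a = tau (rho i)
| RootOut j of a = rho j & i = j + 1
| RootInner of ~~ ext a & ~~ ext (tau a) & lab a = i & lab (psi a) = i.

Lemma root_arcP i a : rf i a -> root_arc_spec i a.
Proof.
move=> ra; have [/om_extP[j e]|na] := boolP (ext a).
  by apply: RootIn; rewrite (om_root_face_uniq ra (j := j)) ?e ?om_root_face_root.
have [/om_extP[j /(can_inj (om_flipK S)) e]|nt] := boolP (ext (tau a)).
  by apply: (@RootOut _ _ j) => //; rewrite (om_root_face_uniq ra (j := j + 1))
    // e rf_rho1.
by apply: RootInner => //; apply: om_root_face_label;
  rewrite ?om_root_face_next // ext_psi.
Qed.

Lemma dirs_tau_rho i : dir (tau (rho i)) = i + 2 /\ dir (tau (tau (rho i))) = i.
Proof. by rewrite om_flipK om_dir_root om_dir_flip_root. Qed.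

(** Directions 0, 1, 2 being north, east, south here, faces 1 and 2 are the NE and SE ones; having
    them on the right means going up along the east side. *)
Lemma root_face_east i a : rf i a -> i = 1 \/ i = 2 -> Y a <= Y (tau a).
Proof.
move=> ra hi; case: (root_arcP ra) => [e|j e ei|na nt la lp].
- have := dirsP S a; rewrite e; case: (dirs_tau_rho i) => -> ->.
  by case: hi => ->; rewrite Z4E => h; inversion h; lra.
- have := dirsP S a; rewrite e om_dir_root om_dir_flip_root.
  case: hi ei => ->; case: (Z4P j) => -> //; rewrite Z4E => _ h; inversion h; lra.
- by case: hi la lp => ->; case: (tableP na nt) => // *; lra.
Qed.

Lemma root_face_west i a : rf i a -> i = 0 \/ i = 3 -> Y (tau a) <= Y a.
Proof.
move=> ra hi; case: (root_arcP ra) => [e|j e ei|na nt la lp].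
- have := dirsP S a; rewrite e; case: (dirs_tau_rho i) => -> ->.
  by case: hi => ->; rewrite Z4E => h; inversion h; lra.
- have := dirsP S a; rewrite e om_dir_root om_dir_flip_root.
  case: hi ei => ->; case: (Z4P j) => -> //; rewrite Z4E => _ h; inversion h; lra.
- by case: hi la lp => ->; case: (tableP na nt) => // *; lra.
Qed.

Lemma root_walk_rf i a j : rf i a -> rf i (iter j psi a).
Proof. by move=> h; elim: j => //= j; rewrite om_root_face_next. Qed.

Lemma root_walk_high i a b : i = 1 \/ i = 2 -> rf i a -> root_walk a b ->
  ~~ s a -> ~~ s b.
Proof.
move=> hi ra [n -> h] sa; elim: n h => //= n IHn h.
rewrite low_psi; last exact: h.
have sn : ~~ s (iter n psi a) by apply: IHn => j jn; apply: h; lia.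
by apply: contra sn; apply: low_arc; apply: root_face_east hi; exact: root_walk_rf.
Qed.

(** Here [a] itself may be low and only its end is known to be high, whence the condition
    [a <> b]. *)
Lemma root_walk_high_tau i a b : i = 1 \/ i = 2 -> rf i a -> root_walk a b ->
  a <> b -> ~~ s (tau a) -> ~~ s b.
Proof.
move=> hi ra [[|n] -> h] // _ sa.
have nt : ~~ ext (tau a) by exact: (h 0%N).
apply: (@root_walk_high i (psi a)) => //; rewrite ?om_root_face_next ?low_psi //.
by exists n; [rewrite -iterSr | move=> j jn; rewrite -iterSr; apply: h].
Qed.

Lemma chain_end_rf i z : crossing z -> rf i z -> i = 1 \/ i = 2.
Proof.
move=> uz rz; have lt := up_lt uz.
by case: (Z4P i) => ei; rewrite ei; auto; have := root_face_west rz;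
  rewrite ei leNgt lt => h; exfalso; have := h ltac:(auto).
Qed.

(* From the south to the north end along f_4^* and f_3^*, heights are monotone, so
   the level is crossed only once. *)
Lemma chain_end_uniq z z' : crossing z -> crossing z' -> ~~ inner_face S z ->
  ~~ inner_face S z' -> z = z'.
Proof.
move=> uz uz' /forallPn[i]; rewrite negbK => ri /forallPn[j]; rewrite negbK => rj.
have hi := chain_end_rf uz ri; have hj := chain_end_rf uz' rj.
have same k x y : crossing x -> crossing y -> rf k x -> rf k y -> k = 1 \/ k = 2 ->
  x = y.
  move=> {}ux {}uy rx ry hk; apply/eqP; apply: contraT => /eqP ne.
  case: (root_walk_total rx ry) => w.
    case/andP: ux => _ /(root_walk_high_tau hk rx w ne).
    by case/andP: uy => ->.
  case/andP: uy => _ /(root_walk_high_tau hk ry w (nesym ne)).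
  by case/andP: ux => ->.
(* From face 2 to face 1 one passes over the east arrow [rho 1]. It is horizontal, so its two ends
   are on the same side of the level. *)
have cross x y : crossing x -> crossing y -> rf 2 x -> rf 1 y -> False.
  move=> ux uy rx ry; have r1x : rf (1 + 1) x by rewrite Z4E.
  have w := root_walk_to r1x.
  have fl : Y (rho 1) = Y (tau (rho 1)).
    by have := dirsP S (rho 1); rewrite om_dir_root om_dir_flip_root Z4E => h;
      inversion h.
  have ne : x <> rho 1 by move=> e; have := up_lt ux; rewrite e fl ltxx.
  case/andP: ux => _ /(root_walk_high_tau (or_intror erefl) rx w ne).
  rewrite -low_flat // => /(root_walk_high (or_introl erefl) (om_root_face_root S 1)).
  by move/(_ _ (root_walk_from ry)); case/andP: uy => ->.
case: hi ri => -> ri; case: hj rj => -> rj.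
- exact: (same 1 _ _ uz uz' ri rj (or_introl erefl)).
- by case: (cross z' z).
- by case: (cross z z').
- exact: (same 2 _ _ uz uz' ri rj (or_intror erefl)).
Qed.

Lemma chain_total a b : crossing a -> crossing b -> chain a b \/ chain b a.
Proof.
move=> /chain_end[z [ca uz nz]] /chain_end[z' [cb uz' nz']].
rewrite (chain_end_uniq uz' uz nz' nz) in cb.
exact: chain_comparable ca cb.
Qed.

Lemma cut_xv_inj a b : crossing a -> crossing b -> xcross a = xcross b -> a = b.
Proof.
move=> ua ub e; case: (chain_total ua ub) => /chain_xv[//|]; by rewrite e ltxx.
Qed.

End Cuts.

(** * The face above the horizontal part of an edge *)

Section Faces.
Context (R : realFieldType) (D : finType) (S : ortho R D).

Local Notation sg := (om_cw S).
Local Notation psi := (om_face S).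
Local Notation tau := (om_flip S).
Local Notation ext := (om_ext S).
Local Notation rho := (om_root S).
Local Notation rf := (om_root_face S).
Local Notation lab := (om_label S).
Local Notation dir := (om_dir S).
Local Notation H := (om_coord S).
Local Notation Y := (H 0).
Local Notation X := (H 1).

Lemma straight_west a : dir (tau a) = dir a + 2 -> X (tau a) < X a ->
  dir a = 3 /\ Y a = Y (tau a).
Proof. by case: (dirsP S a) => // hY hX _ lt; exfalso; lra. Qed.

Lemma straight_up a : dir (tau a) = dir a + 2 -> Y a < Y (tau a) -> dir a = 0.
Proof. by case: (dirsP S a) => // hY hX _ lt; exfalso; lra. Qed.

(** After a jump of 2 along [l], only 2 is left for the rest of the turn, while reaching the skipped
    label would take 3. *)
Lemma label_gap l c : inner_face S l -> c \in porbit psi l ->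
  lab (psi l) = lab l + 2 -> lab c <> lab l + 1.
Proof.
move=> nl o e ec; have [n [e1 l4 _]] := porbit_turn nl o.
have := turn_modn S l n; rewrite -e1 ec => e0.
case: n e1 l4 e0 => [e1|n _ + +].
  by move/eqP: ec; rewrite e1 /= -subr_eq0 opprD addrA subrr.
rewrite turnSl e; have -> : jump (lab l) (lab l + 2) = 2%N.
  by case: (Z4P (lab l)) => ->.
case: (turning _ _ _) => [|[|[|m]]]; case: (Z4P (lab l)) => -> //.
Qed.

(** The total turning is 4, so the label changes somewhere; the first change is by 1 or 2, as the
    arc table has no jump of 3. *)
Lemma label_next c : inner_face S c -> exists2 z, z \in porbit psi c &
  lab z = lab c + 1 \/ lab z = lab c + 2.
Proof.
move=> nc; have [b ob nb] : exists2 b, b \in porbit psi c & lab b != lab c.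
  case: (pickP (fun b => (b \in porbit psi c) && (lab b != lab c))).
    by move=> b /andP[]; exists b.
  move=> h; have := turn_porbit nc; rewrite /turning big1 // => i _; apply/eqP.
  have e m : lab (iter m psi c) = lab c.
    by have := h (iter m psi c); rewrite -permX mem_porbit /= => /negbFE/eqP.
  by rewrite jump0 !e.
have [z [w lz nz oz]] := walk_to_last nc ob nb.
exists (psi z).
  have := porbit_perm psi 1 z; rewrite expg1 => e.
  by rewrite -eq_porbit_mem e eq_porbit_mem.
have nzf : inner_face S z by rewrite (inner_face_porbit oz).
have := om_arc_table (inner_face_ext nzf) (inner_face_ext_tau nzf).
rewrite lz; case=> [[e _]|[-> _ _]|[-> _ _]]; [|by left|by right].
by rewrite e eqxx in nz.
Qed.

(** Counterpart of [walk_to_last] in counterclockwise order: [p] is the corner just before the label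
    interval of [c]. *)
Lemma label_prev c : inner_face S c -> exists2 p, p \in porbit psi c &
  lab p != lab c /\ walk S (psi p) c.
Proof.
move=> nc; have [b ob nb] := label_next nc.
have {}nb : lab b != lab c by case: nb => ->; case: (Z4P (lab c)) => ->.
have ex : exists n, lab (iter n (psi^-1)%g c) != lab c.
  by move: ob; rewrite -porbitV => /porbitP[n e]; exists n; rewrite -permX -e.
case: (ex_minnP ex) => -[|m]; first by rewrite eqxx.
move=> hm min; exists (iter m.+1 (psi^-1)%g c).
  by rewrite -porbitV -permX mem_porbit.
split=> //; rewrite /= permKV; exists m.
  by elim: m {hm min} => //= m IH; rewrite -iterS iterSr permKV.
have it i j : (i + j = m)%N -> iter i psi (iter m (psi^-1)%g c) = iter j (psi^-1)%g c.
  elim: i j => [|i IH] j /= h; first by rewrite -h.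
  by rewrite (IH j.+1) ?addnS //= permKV.
rewrite /turning big1 // => i _; apply/eqP; rewrite jump0; have := ltn_ord i => im.
have e j : (j <= m)%N -> lab (iter j psi (iter m (psi^-1)%g c)) = lab c.
  move=> jm; rewrite (it _ (m - j)%N) ?subnKC //.
  by apply/eqP/negPn/negP => /min; lia.
by rewrite !e // ltnW.
Qed.

Context (t : R) (q : pred D) (cutP : cut S t q).
Local Notation s := (below S t q).
Local Notation crossing := (crossing S t q).
Local Notation xcross := (xcross S).

Lemma low_above a : t < Y a -> s a = false.
Proof. by move=> h; rewrite /below ltNge (ltW h) /= (gt_eqF h). Qed.

Lemma low_turn a b : s a -> ~~ s b -> b \in porbit psi a ->
  exists2 c, c \in porbit psi a & s c && ~~ s (psi c).
Proof.
move=> sa sb /porbitP[k ek].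
have ex : exists n, ~~ s (iter n psi a) by exists k; rewrite -permX -ek.
case: (ex_minnP ex) => -[|n]; first by rewrite /= sa.
move=> h min; exists (iter n psi a); first by rewrite -permX mem_porbit.
by rewrite h andbT; apply/negPn/negP => /min; rewrite ltnn.
Qed.

(** Heights alone do not decide ties, so the vertical monotonicity of the SW side, and of the SE
    side in [walk_low0], is restated in terms of the level. *)
Lemma walk_low1 a b : inner_face S a -> lab a = 1 -> walk S a b -> s b -> s a.
Proof.
move=> na la [n -> +]; elim: n => //= n IHn; rewrite turnS => /eqP.
rewrite addn_eq0 jump0 => /andP[/eqP e1 /eqP e2]; have {}IHn := IHn e1.
have nn : inner_face S (iter n psi a) by rewrite inner_face_iter.
have [n1 n2] := (inner_face_ext nn, inner_face_ext_tau nn).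
rewrite (low_psi cutP n2) => h; apply: IHn; apply: (low_arc cutP) h.
have ln : lab (iter n psi a) = 1 by rewrite -la; apply: (@walk_lab _ _ S); exists n.
move: e2; rewrite /= ln => /esym lp.
by move: ln lp; case: (tableP n1 n2) => // *; lra.
Qed.

Lemma walk_low0 a b : inner_face S a -> lab a = 0 -> walk S a b -> s a -> s b.
Proof.
move=> na la [n -> +]; elim: n => //= n IHn; rewrite turnS => /eqP.
rewrite addn_eq0 jump0 => /andP[/eqP e1 /eqP e2] h; have {}h := IHn e1 h.
have nn : inner_face S (iter n psi a) by rewrite inner_face_iter.
have [n1 n2] := (inner_face_ext nn, inner_face_ext_tau nn).
rewrite (low_psi cutP n2); apply: (low_arc cutP); rewrite ?om_flipK //.
have ln : lab (iter n psi a) = 0 by rewrite -la; apply: (@walk_lab _ _ S); exists n.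
move: e2; rewrite /= ln => /esym lp.
by move: ln lp; case: (tableP n1 n2) => // *; lra.
Qed.

Lemma up_innerP l : inner_face S l -> crossing l ->
  [\/ lab l = 1 /\ xcross l = X l,
      [/\ lab l = 2, lab (psi l) = 2 & xcross l = X (psi l)] |
      [/\ lab l = 0, lab (psi l) = 2 & xcross l = X (psi l)]].
Proof.
move=> nl /(up_lt cutP); have [n1 n2] := (inner_face_ext nl, inner_face_ext_tau nl).
rewrite /xcross H_psi //; case: (tableP n1 n2) => hY hX lt;
  first [exfalso; lra | by apply: Or31 | by apply: Or32 | by apply: Or33].
Qed.

Lemma down_innerP r : inner_face S r -> crossing (tau r) ->
  [\/ lab (psi r) = 0 /\ xcross (tau r) = X (psi r),
      [/\ lab r = 3, lab (psi r) = 3 & xcross (tau r) = X r] |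
      [/\ lab r = 3, lab (psi r) = 1, xcross (tau r) = X r & X (psi r) < X r]].
Proof.
move=> nl /(up_lt cutP); have [n1 n2] := (inner_face_ext nl, inner_face_ext_tau nl).
rewrite /xcross om_flipK H_psi //; case: (tableP n1 n2) => hY hX lt;
  first [exfalso; lra | by apply: Or31 | by apply: Or32 | by apply: Or33].
Qed.

(* the end of an arc at the height of the horizontal part of its drawing *)
Definition anchor (k : D) : D := if dir k == 3 then k else tau k.

Section Horizontal.
Context (k : D) (kX : X (tau k) < X k) (tk : t = Y (anchor k)) (sk : s (anchor k)).

(* As [k] is traversed westwards, the face on its right lies above it. *)
Lemma bottomP : inner_face S k ->
  [\/ [/\ lab k = 0, Y k = t & s k] /\
        [\/ lab (psi k) = 0, [/\ lab (psi k) = 1, Y (psi k) = t & s (psi k)] |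
            lab (psi k) = 2 /\ t < Y (psi k)],
      [/\ lab k = 1, lab (psi k) = 1, Y (psi k) = t, s (psi k) & s k] |
      [/\ lab k = 3, lab (psi k) = 1, Y (psi k) = t, s (psi k) & t < Y k]].
Proof.
move=> nk; have [n1 n2] := (inner_face_ext nk, inner_face_ext_tau nk).
have flat := @low_flat _ _ _ _ _ cutP k.
have hs := low_psi cutP n2; have hy := H_psi 0 n2.
move: sk tk; rewrite /anchor hs hy.
case: (tableP n1 n2) => //= hY hX sa ta;
  try (by move: kX; rewrite ?hX ?ltxx // (lt_gtF hX)); try (have {}flat := flat hY).
all: first
 [ solve [apply: Or31; split; [by split | first [by apply: Or31
   | by apply: Or32; split=> //; [rewrite ta | rewrite flat]
   | by apply: Or33; rewrite ta]]]
 | solve [apply: Or32; split=> //;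
   first [congruence | exact: low_lt sa | by rewrite flat]]
 | solve [apply: Or33; split=> //; by rewrite ta] ].
Qed.

Section InnerFace.
Context (nk : inner_face S k).

Let nk1 : inner_face S (psi k).
Proof. by rewrite (inner_face_iter S 1). Qed.

Let ok1 : psi k \in porbit psi k.
Proof. by have := mem_porbit psi 1 k; rewrite expg1. Qed.

Let porb a b : a \in porbit psi k -> b \in porbit psi k -> b \in porbit psi a.
Proof. by rewrite -!eq_porbit_mem => /eqP -> /eqP <-;
  rewrite eq_porbit_mem porbit_id. Qed.

Let porb1 a : a \in porbit psi k -> psi a \in porbit psi k.
Proof.
by rewrite -!eq_porbit_mem => /eqP <-; have := porbit_perm psi 1 a; rewrite expg1 => ->.
Qed.

Let lt1 a b : a \in porbit psi k -> b \in porbit psi k ->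
  [/\ lab a = 0 -> lab b = 1 -> X b < X a, lab a = 1 -> lab b = 2 -> Y a < Y b,
      lab a = 2 -> lab b = 3 -> X a < X b & lab a = 3 -> lab b = 0 -> Y b < Y a].
Proof.
move=> oa ob; have na : inner_face S a by rewrite (inner_face_porbit oa).
have h := corner_lt1 na (porb oa ob).
by split=> ea eb; move: h; rewrite ea eb !Z4E ?H2E ?H3E ?ltrN2; apply.
Qed.

Let lt2 a b : a \in porbit psi k -> b \in porbit psi k ->
  (lab a = 0 -> lab b = 2 -> X b < X a) /\ (lab a = 1 -> lab b = 3 -> Y a < Y b).
Proof.
move=> oa ob; have na : inner_face S a by rewrite (inner_face_porbit oa).
have h := corner_lt2 na (porb oa ob).
by split=> ea eb; move: h; rewrite ea eb !Z4E ?H2E ?H3E ?ltrN2; apply.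
Qed.

(** With the anchor of [k] counted as low, the level passes just above the horizontal part of [k],
    and the upward arcs of the face are met beyond the west end of [k]. *)
Lemma bottom_up l : l \in porbit psi k -> crossing l -> xcross l <= X (psi k).
Proof.
move=> ol ul; have nl : inner_face S l by rewrite (inner_face_porbit ol).
have npl : inner_face S (psi l) by rewrite (inner_face_iter S 1).
have opl := porb1 ol; case/andP: (ul) => sl _.
have sl0 : s (psi l) = false.
  by rewrite (low_psi cutP) ?inner_face_ext_tau //; case/andP: ul => _ /negPf.
(* The hypothesis [lab k = 1 -> s k] excludes, by [walk_low1], an upward arc that comes before [k]
   on the SW side. *)
have case1 : lab (psi k) = 1 -> Y (psi k) = t -> s (psi k) ->
    (lab k = 1 -> s k) -> xcross l <= X (psi k).
  move=> k1' Yk1 sk1 hk1.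
  case: (up_innerP nl ul) => [[l1 ->]|[l2 l2' _]|[l0 l2' _]].
  - case: (walk_total nk1 (porb ok1 ol)); first by rewrite l1 k1'.
      by move=> w; have := walk_mono nk1 w (j := 3);
         rewrite k1' !Z4E !H3E lerN2; apply; left.
    case/walk_last => [->//|[p /perm_inj -> w]].
    have lk := walk_lab w; rewrite l1 in lk.
    case: (walk_head w) => [e|w1]; first by rewrite e sk1 in sl0.
    have lpl : lab (psi l) = 1 by rewrite -(walk_lab w1).
    by have := walk_low1 npl lpl w1 (hk1 lk); rewrite sl0.
  - have [_ /(_ k1' l2)] := lt1 ok1 ol; rewrite Yk1 => /low_above h _ _.
    by rewrite h in sl.
  - have := label_gap nl (porb ol ok1); rewrite l0 l2' k1' !Z4E => /(_ erefl).
    by case.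
case: (bottomP nk) => [[[k0 Yk sk0] [k0'|[]|[k2' Yk2]]]|[]|[]]; last 2 first.
- by move=> *; exact: case1.
- by move=> k3 *; apply: case1 => //; rewrite k3.
- case: (up_innerP nl ul) => [[l1 ->]|[l2 l2' ->]|[l0 l2' ->]].
  + by have [/(_ k0' l1) /ltW] := lt1 ok1 ol.
  + by have [/(_ k0' l2') /ltW] := lt2 ok1 opl.
  + by have [/(_ k0' l2') /ltW] := lt2 ok1 opl.
- by move=> *; apply: case1 => //; rewrite k0.
have l2' : lab (psi l) = 2 /\ xcross l = X (psi l).
  case: (up_innerP nl ul) => [[l1 _]|[]|[]] //.
  by have := label_gap nk ol; rewrite k0 k2' l1 !Z4E => /(_ erefl).
case: l2' => l2' ->.
case: (walk_total npl (porb opl ok1)); first by rewrite l2'.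
  by move=> w; apply: (walk_mono npl w); rewrite l2' !Z4E; right.
case/walk_last => [->//|[p /perm_inj -> w]].
have := walk_mono nk1 w (j := 0); rewrite k2' !Z4E => /(_ (or_introl erefl)) le.
by have := low_above (lt_le_trans Yk2 le); rewrite sl.
Qed.

Lemma bottom_down r : r \in porbit psi k -> crossing (tau r) -> X k <= xcross (tau r).
Proof.
move=> ol ur; have nr : inner_face S r by rewrite (inner_face_porbit ol).
have npr : inner_face S (psi r) by rewrite (inner_face_iter S 1).
have okk := porbit_id psi k.
have opr := porb1 ol; have := ur; rewrite /crossing om_flipK.
rewrite -(low_psi cutP) ?inner_face_ext_tau // => /andP[sr1 /negPf sr].
case: (bottomP nk) => [[[k0 Yk sk0] _]|[k1 k1' Yk1 sk1 _]|[k3 k1' Yk1 sk1 Yk]];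
case: (down_innerP nr ur) => [[r0' ->]|[r3 r3' ->]|[r3 r1' -> Xr]].
- case: (walk_total npr (porb opr okk)); first by rewrite k0.
    by move=> w; have := walk_mono npr w (j := 3);
       rewrite r0' !Z4E !H3E lerN2; apply; right.
  case/walk_last => [->//|[p /perm_inj -> w]].
  by have := walk_low0 nk k0 w sk0; rewrite sr.
- have [_ _ _ /(_ r3' k0)] := lt1 opr okk; rewrite Yk => /low_above.
  by rewrite sr1.
- by have := label_gap nr (porb ol okk); rewrite r3 r1' k0 !Z4E => /(_ erefl).
- by have [/(_ r0' k1) /ltW] := lt1 opr okk.
- have [_ /(_ k1' r3')] := lt2 ok1 opr; rewrite Yk1 => /low_above.
  by rewrite sr1.
- apply: (le_trans _ (ltW Xr)).
  case: (walk_total npr (porb opr okk)); first by rewrite k1.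
    by move=> w; have := walk_mono npr w (j := 3);
       rewrite r1' !Z4E !H3E lerN2; apply; left.
  case/walk_last => [->//|[p /perm_inj -> /walk_lab]].
  by rewrite r3 k1.
- by have := label_gap nk opr; rewrite k3 k1' r0' !Z4E => /(_ erefl).
all: case: (walk_total nk ol); rewrite ?r3 // => w;
  first by apply: (walk_mono nk w); rewrite k3 !Z4E; left.
all: case/walk_head: w => [->//|w].
  have := walk_mono npr w (j := 2); rewrite r3' !Z4E !H2E lerN2.
  move=> /(_ (or_intror erefl)) le.
  by have := low_above (lt_le_trans Yk le); rewrite sr1.
by have := walk_lab w; rewrite k3 r1'.
Qed.

(** One end of [k] is low. A strictly higher corner is found, according to the case of [bottomP],
    before the label interval of [k], after that of [psi k], or at [k] itself; in between, the
    boundary must cross upwards. *)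
Lemma bottom_ex : exists2 l, l \in porbit psi k & crossing l.
Proof.
have okk := porbit_id psi k.
have [b ob sb] : exists2 b, b \in porbit psi k & ~~ s b.
  case: (bottomP nk) => [[[k0 Yk sk0] _]|[k1 k1' Yk1 sk1 _]|[k3 k1' Yk1 sk1 Yk]].
  - have [p op [lp w]] := label_prev nk; exists p => //.
    have np : inner_face S p by rewrite (inner_face_porbit op).
    have npp : inner_face S (psi p) by rewrite (inner_face_iter S 1).
    have lpp := walk_lab w; rewrite k0 in lpp.
    have := walk_mono npp w (j := 2); rewrite -lpp !Z4E !H2E lerN2.
    move=> /(_ (or_introl erefl)); rewrite Yk => le.
    have [n1 n2] := (inner_face_ext np, inner_face_ext_tau np).
    suff lt : Y (psi p) < Y p by rewrite low_above // (le_lt_trans le).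
    move: lp; rewrite k0 H_psi //; move: lpp.
    by case: (tableP n1 n2).
  - have [z oz hz] := label_next nk1.
    have {}oz : z \in porbit psi k.
      by have := porbit_perm psi 1 k; rewrite expg1 => <-.
    exists z => //; rewrite low_above // -Yk1.
    rewrite k1' !Z4E in hz; case: hz => hz.
      by have [_ /(_ k1' hz)] := lt1 ok1 oz.
    by have [_ /(_ k1' hz)] := lt2 ok1 oz.
  - by exists k; rewrite // low_above.
have [a oa sa] : exists2 a, a \in porbit psi k & s a.
  case: (bottomP nk) => [[[]]|[]|[]] *; [by exists k | by exists (psi k) ..].
have [l ol /andP[sl sl']] := low_turn sa sb (porb oa ob).
have {}ol : l \in porbit psi k.
  by rewrite -eq_porbit_mem in oa; rewrite -(eqP oa).
exists l => //; rewrite /crossing sl -(low_psi cutP) // inner_face_ext_tau //.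
by rewrite (inner_face_porbit ol).
Qed.

(** Along the chain, [e] comes either up to an upward arc [l] of the face, or from the successor of
    [l] on, and this successor reverses a downward arc of the same face. *)
Lemma bottom_inner e : crossing e -> ~ (X (tau k) < xcross e < X k).
Proof.
move=> ue /andP[h1 h2]; have [l ol ul] := bottom_ex.
have := bottom_up ol ul; rewrite H_psi ?inner_face_ext_tau // => le.
case: (chain_total cutP ue ul) => [/(chain_xv cutP)[e1|lt]|];
  first by rewrite e1 ltNge le in h1.
  by have := lt_trans h1 lt; rewrite ltNge le.
case/chain_head => [e1|[b nx /(chain_xv cutP) ch]].
  by rewrite -e1 ltNge le in h1.
have [_ _ ub _] := nx; have ob := next_porbit nx.
have {}ob : tau b \in porbit psi k.
  by move: ol; rewrite -eq_porbit_mem => /eqP <-.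
have := bottom_down ob; rewrite om_flipK => /(_ ub) le'.
case: ch => [eb|lt]; first by rewrite -eb ltNge le' in h2.
by have := lt_trans lt h2; rewrite ltNge le'.
Qed.

End InnerFace.

Lemma root_face_down i a : i = 0 \/ i = 1 -> rf i a -> X (tau a) <= X a.
Proof.
move=> hi ra; case: (root_arcP ra) => [e|j e ei|na nt la lp].
- have := dirsP S a; rewrite e; case: (dirs_tau_rho S i) => -> ->.
  by case: hi => ->; rewrite Z4E => h; inversion h; rewrite ?le_eqVlt; apply/orP; auto;
     left; apply/eqP.
- have := dirsP S a; rewrite e om_dir_root om_dir_flip_root.
  case: hi ei => ->; case: (Z4P j) => -> //; rewrite Z4E => _ h; inversion h; lra.
- by case: hi la lp => ->; case: (tableP na nt) => // *; lra.
Qed.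

Lemma root_walk_down i a b : i = 0 \/ i = 1 -> rf i a -> root_walk S a b -> X b <= X a.
Proof.
move=> hi ra [n -> h]; elim: n h => //= n IHn h.
have nt := h n (ltnSn n); rewrite H_psi //.
apply: (le_trans (root_face_down hi (root_walk_rf n ra))).
by apply: IHn => j jn; apply: h; lia.
Qed.

Lemma root_walk_end i a b : rf i a -> root_walk S a b -> s a -> ~~ s (tau b) ->
  exists z, [/\ crossing z, rf i z, root_walk S a z & root_walk S z b].
Proof.
move=> ra [n -> h] sa sb.
elim: n a ra h sa sb => [|n IHn] a ra h sa sb.
  by exists a; split=> //; [rewrite /crossing sa | exists 0%N | exists 0%N].
have nt := h 0%N isT; have [st|st] := boolP (s (tau a)); last first.
  by exists a; split=> //; [rewrite /crossing sa | exists 0%N | exists n.+1].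
have [||||z [uz rz w1 w2]] := IHn (psi a); rewrite ?om_root_face_next ?(low_psi cutP)
  //.
- by move=> j jn; rewrite -iterSr; apply: h.
- by rewrite -iterSr.
exists z; split=> //; last by rewrite iterSr.
case: w1 => m -> hm; exists m.+1; first by rewrite iterSr.
by case=> [|j] //=; rewrite -iterS iterSr => jm; apply: hm.
Qed.

Lemma root_walk_start i a b : rf i a -> root_walk S a b -> ~~ s a -> s b ->
  exists r, [/\ crossing (tau r), rf i r & root_walk S (psi r) b].
Proof.
move=> ra [n -> h] sa sb.
elim: n a ra h sa sb => [|n IHn] a ra h sa sb; first by rewrite sb in sa.
have nt := h 0%N isT.
have w : root_walk S (psi a) (iter n.+1 psi a).
  by exists n; [rewrite iterSr | move=> j jn; rewrite -iterSr; apply: h].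
have [st|st] := boolP (s (tau a)).
  by exists a; split=> //; rewrite /crossing st om_flipK.
have [||||r [ur rr w2]] := IHn (psi a); rewrite ?om_root_face_next ?(low_psi cutP) //.
- by move=> j jn; rewrite -iterSr; apply: h.
- by rewrite -iterSr.
by exists r; split=> //; rewrite iterSr.
Qed.

(** The face above [k] is now one of the two northern root faces. It carries the first crossing arc
    (face 0) or the last one (face 1), so all crossings lie on one side of [k]. *)
Lemma bottom_root i e : rf i k -> crossing e -> ~ (X (tau k) < xcross e < X k).
Proof.
move=> rk ue /andP[h1 h2].
have flat := @low_flat _ _ _ _ _ cutP k.
have : i = 0 /\ s k \/ [/\ i = 1, ~~ ext (tau k) & s (tau k)].
  move: sk tk; rewrite /anchor => sa _.
  case: (root_arcP rk) => [ek|j ek ei|na nt la lp].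
  - have [ed et] : dir k = i + 2 /\ dir (tau k) = i by rewrite ek; exact: dirs_tau_rho.
    have [|d3 fl] := @straight_west k _ kX; first by rewrite ed et -addrA Z4E addr0.
    right; split; last by move: sa; rewrite flat // d3.
      by move: d3; rewrite ed; case: (Z4P i) => ->.
    by rewrite ek om_flipK; apply: contraT => /negbNE/om_ext_flip; rewrite om_ext_root.
  - have [ed et] : dir k = j /\ dir (tau k) = j + 2.
      by rewrite ek om_dir_root om_dir_flip_root.
    have [|d3 fl] := @straight_west k _ kX; first by rewrite ed et.
    by left; split; [rewrite ei -ed d3 Z4E | move: sa; rewrite d3].
  - move: la lp sa; case: (tableP na nt) => //= hY hX <- // _ sa;
      try (by move: kX; rewrite ?hX ?ltxx // (lt_gtF hX)); try (by left);
      by right; split=> //; rewrite flat.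
case=> [[i0 sk0]|[i1 nt st]].
  rewrite i0 in rk; have w := root_walk_from rk.
  (* Face 0: from the north end to [k], the boundary descends through the level along [r]. No arc
     has [tau r] as its successor, since the face on the right of [r] is a root face. *)
  have [r [ur rr w2]] := root_walk_start (om_root_face_root S 0) w (cut_top cutP) sk0.
  have [xr nr] : xcross (tau r) = X (tau r) /\ ~~ ext (tau r).
    have lt := up_lt cutP ur; rewrite om_flipK in lt.
    rewrite /xcross; case: (root_arcP rr) => [er|j er ej|na nt la lp].
    - by rewrite er om_flipK om_dir_root eqxx; split=> //;
        apply: contraT => /negbNE/om_ext_flip; rewrite om_ext_root.
    - have := @straight_up (tau r); rewrite er om_flipK om_dir_root om_dir_flip_root -addrA Z4E addr0.
      by rewrite -er => /(_ erefl lt) ej'; move: ej; rewrite -[j](addrK 2) ej'.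
    - by move: la lp; case: (tableP na nt) => // hY hX _ _; exfalso; lra.
  have rr1 : rf 0 (psi r) by rewrite om_root_face_next.
  have := root_walk_down (or_introl erefl) rr1 w2; rewrite H_psi // -xr => le.
  case: (chain_total cutP ue ur) => [/chain_last[e1|[c _ nx]]|/(chain_xv cutP)].
  - by rewrite e1 ltNge le in h2.
  - have := inner_face_porbit (next_porbit nx); case: nx => -> _ _ _.
    by rewrite om_flipK => /inner_faceP/(_ 0); rewrite rr.
  - by case=> [e1|lt]; [rewrite -e1 ltNge le in h2|have := lt_trans lt h2;
    rewrite ltNge le].
rewrite i1 in rk.
have r1 : rf 1 (psi k) by rewrite om_root_face_next.
have r1' : rf (0 + 1) (psi k) by rewrite Z4E.
have sp : s (psi k) by rewrite (low_psi cutP).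
(* Face 1: from [psi k] to the north end, the boundary climbs through the level along [z], which has
   no successor. *)
have [z [uz rz w1 _]] := root_walk_end r1 (root_walk_to r1') sp (cut_top cutP).
have xz : xcross z = X z.
  have lt := up_lt cutP uz.
  rewrite /xcross; case: (root_arcP rz) => [ez|j ez ej|na nt' la lp].
  - have [ed et] : dir z = 1 + 2 /\ dir (tau z) = 1 by rewrite ez; exact: dirs_tau_rho.
    by have := @straight_up z; rewrite ed et !Z4E => /(_ erefl lt).
  - have j0 : j = 0 by apply: (addIr 1); rewrite -ej add0r.
    by rewrite ez om_dir_root j0 eqxx.
  - by move: la lp; case: (tableP na nt') => // hY hX _ _; exfalso; lra.
have := root_walk_down (or_intror erefl) r1 w1; rewrite H_psi // -xz => le.
case: (chain_total cutP ue uz) => [/(chain_xv cutP)|/chain_head[e1|[c [nz]]]].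
- by case=> [e1|lt]; [rewrite e1 ltNge le in h1|have := lt_trans h1 lt;
  rewrite ltNge le].
- by rewrite -e1 ltNge le in h1.
- by move/inner_faceP: nz => /(_ 1); rewrite rz.
Qed.

Lemma bottom_clear e : crossing e -> ~ (X (tau k) < xcross e < X k).
Proof.
have [nk|/forallPn[i]] := boolP (inner_face S k); first exact: bottom_inner.
by rewrite negbK; exact: bottom_root.
Qed.

End Horizontal.

End Faces.

(** Since [e] neither branches nor merges, a path that reverses direction retraces the step it has
    just made, so all reversals can be removed. *)
Lemma functional_connect (T : finType) (e : rel T) (x y : T) :
  (forall x y z, e x y -> e x z -> y = z) ->
  (forall x y z, e x z -> e y z -> x = y) ->
  connect (fun x y => e x y || e y x) x y -> connect e x y \/ connect e y x.
Proof.
move=> fe ie /connectP[p]; elim: p x => [|z p IHp] x /=.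
  by move=> _ ->; left.
case/andP => exz pth /(IHp _ pth) {pth IHp}; case/orP: exz => exz.
- case=> [h|/connectP[p' + e']]; first by left; apply: connect_trans h; exact: connect1.
  case: (lastP p') e' => [e' _|p1 w].
    by left; rewrite -[y]e'; exact: connect1.
  rewrite last_rcons rcons_path => <- /andP[pth ez].
  by right; rewrite (ie _ _ _ exz ez); apply/connectP; exists p1.
case=> [/connectP[[|w p'] /=]|h].
- by move=> _ ->; right; exact: connect1.
- case/andP => ez pth e'; left; rewrite (fe _ _ _ exz ez).
  by apply/connectP; exists p'.
- by right; apply: connect_trans h _; exact: connect1.
Qed.

(** * Separation of vertical and horizontal parts *)

Section Separation.
Context (R : realFieldType) (D : finType) (S : ortho R D).

Local Notation sg := (om_cw S).
Local Notation psi := (om_face S).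
Local Notation tau := (om_flip S).
Local Notation ext := (om_ext S).
Local Notation rho := (om_root S).
Local Notation rf := (om_root_face S).
Local Notation lab := (om_label S).
Local Notation dir := (om_dir S).
Local Notation H := (om_coord S).
Local Notation Y := (H 0).
Local Notation X := (H 1).
Local Notation xcross := (xcross S).

(** In the map, the arcs issued from the ends form the single orbit v_infty; splitting v_infty makes
    each of them a vertex of its own. *)
Definition vertex_of (a : D) : {set D} := if ext a then [set a] else porbit sg a.

Lemma vt_id a : a \in vertex_of a.
Proof. by rewrite /vertex_of; case: ifP => _; rewrite ?set11 ?porbit_id. Qed.

Lemma porbit_ext a b : b \in porbit sg a -> ext b = ext a.
Proof. by case/porbitP => n ->; rewrite permX; elim: n => //= n; rewrite om_ext_cw. Qed.

Lemma vt_eqP a b : vertex_of a = vertex_of b -> a = b \/ ~~ ext a /\ b \in porbit sg a.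
Proof.
move=> e; have : b \in vertex_of a by rewrite e vt_id.
by rewrite /vertex_of; case: ifP => // _; rewrite ?inE; [move=> /eqP -> | ]; auto.
Qed.

Lemma H_vt k a b : vertex_of a = vertex_of b -> H k a = H k b.
Proof.
case/vt_eqP => [->//|[na /porbitP[n ->]]]; rewrite permX.
elim: n => //= n ->; rewrite om_coord_cw //.
by rewrite (@porbit_ext a) // -permX mem_porbit.
Qed.

Lemma vt_dir a b : vertex_of a = vertex_of b -> dir a = dir b -> a = b.
Proof. by case/vt_eqP => [->//|[na o]]; exact: om_dir_inj. Qed.

Lemma vt_porbit a b : ~~ ext a -> b \in porbit sg a -> vertex_of b = vertex_of a.
Proof.
move=> na o; rewrite /vertex_of (porbit_ext o) (negPf na).
by apply/eqP; rewrite eq_porbit_mem.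
Qed.

(** The equality of heights is needed because a bent edge may also leave eastwards. *)
Definition east (x y : {set D}) : bool :=
  [exists d, [&& vertex_of d == x, vertex_of (tau d) == y, Y d == Y (tau d)
    & dir d == 1]].

(** The horizontal components used to break ties. A vertex has at most one arc in each direction, so
    a component is a path, ordered by abscissa. *)
Definition fconn (a b : D) : bool :=
  connect (fun x y => east x y || east y x) (vertex_of a) (vertex_of b).

Lemma eastP x y : reflect (exists d, [/\ vertex_of d = x, vertex_of (tau d) = y,
  Y d = Y (tau d) & dir d = 1]) (east x y).
Proof.
apply: (iffP existsP) => -[d].
  by case/and4P => /eqP ? /eqP ? /eqP ? /eqP ?; exists d.
by case=> /eqP ? /eqP ? /eqP ? /eqP ?; exists d; apply/and4P.
Qed.

Lemma flat_dirs d : Y d = Y (tau d) ->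
  dir d = 1 /\ dir (tau d) = 3 \/ dir d = 3 /\ dir (tau d) = 1.
Proof. by case: (dirsP S d) => hY hX e; auto; exfalso; lra. Qed.

Lemma east_fun x y z : east x y -> east x z -> y = z.
Proof.
case/eastP => d [<- <- _ e1] /eastP[d' [e <- _ e2]].
by have -> // : d = d'; apply: vt_dir; rewrite ?e1 ?e2.
Qed.

Lemma east_inj x y z : east x z -> east y z -> x = y.
Proof.
case/eastP => d [<- <- f1 e1] /eastP[d' [<- e f2 e2]].
have [[_ d1]|[]] := flat_dirs f1; last by rewrite e1.
have [[_ d2]|[]] := flat_dirs f2; last by rewrite e2.
by have /(can_inj (om_flipK S)) -> // : tau d = tau d'; apply: vt_dir; rewrite ?d1 ?d2.
Qed.

Definition flat_at (i : 'Z_4) (a : D) : Prop :=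
  exists d, [/\ vertex_of d = vertex_of a, Y d = Y (tau d) & dir d = i].

Lemma flat_at_dir i a : dir a = i -> Y a <> Y (tau a) -> ~ flat_at i a.
Proof. by move=> da ne [d [/vt_dir e f dd]]; apply: ne; rewrite -e ?dd. Qed.

Lemma flat_at_vt i a b : vertex_of a = vertex_of b -> flat_at i a -> flat_at i b.
Proof. by move=> e [d [e1 e2 e3]]; exists d; rewrite -e. Qed.

Lemma east_connect a b : connect east (vertex_of a) (vertex_of b) ->
  Y a = Y b /\ (vertex_of a = vertex_of b \/ [/\ X a < X b, flat_at 1 a & flat_at 3 b]).
Proof.
case/connectP => p; elim: p a => [|z p IHp] a /=.
  by move=> _ e; split; [exact: H_vt | left].
case/andP => /eastP[d [e1 e2 f d1]]; rewrite -e2 => pth lst.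
have [yb h] := IHp _ pth lst; rewrite -(H_vt 0 e1) f; split=> //; right.
have lt : X d < X (tau d) by have := om_coord_dir S d; rewrite d1.
have fa : flat_at 1 a by exists d.
have ft : flat_at 3 (tau d).
  exists (tau d); rewrite om_flipK; split=> //.
  by have [[]|[]] := flat_dirs f; rewrite d1.
rewrite -(H_vt 1 e1); case: h => [e|[lt2 _ fb]].
  by split=> //; [rewrite -(H_vt 1 e) | exact: flat_at_vt ft].
by split=> //; apply: lt_trans lt2.
Qed.

Variant fconn_spec (a b : D) : Prop :=
| FconnEq of Y a = Y b & vertex_of a = vertex_of b
| FconnLt of Y a = Y b & X a < X b & flat_at 1 a & flat_at 3 b
| FconnGt of Y a = Y b & X b < X a & flat_at 3 a & flat_at 1 b.

Lemma fconnP a b : fconn a b -> fconn_spec a b.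
Proof.
move=> /(functional_connect east_fun east_inj) [] /east_connect[e [e'|[]]] *.
- exact: FconnEq.
- exact: FconnLt.
- by apply: FconnEq.
- exact: FconnGt.
Qed.

Lemma fconn_Y a b : fconn a b -> Y a = Y b.
Proof. by case/fconnP. Qed.

Lemma fconn_refl a : fconn a a.
Proof. exact: connect0. Qed.

Lemma fconn_flat w a : Y a = Y (tau a) -> fconn w (tau a) = fconn w a.
Proof.
move=> f; rewrite /fconn; set e := (fun x y => _).
have sym : connect_sym e by apply: sym_connect_sym => x y; rewrite /e orbC.
apply/esym/(same_connect_r sym)/connect1; rewrite /e.
have [[d1 d2]|[d1 d2]] := flat_dirs f; apply/orP; [left | right].
  by apply/eastP; exists a.
by apply/eastP; exists (tau a); rewrite om_flipK.
Qed.

(** At height [t], the component of [w] is put above the level for [b = true] and below it for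
    [b = false], all others being on the opposite side. One high point [z] suffices for [cut_top],
    as the end of the north arrow is higher than all the rest. *)
Lemma cut_fconn (b : bool) w t z :
  let q := fun a => b (+) fconn w a in
  ~~ below S t q z -> cut S t q.
Proof.
move=> q lz; split.
- move=> a na; rewrite /q /fconn; do 2!congr (_ _).
  by apply: vt_porbit => //; have := mem_porbit sg 1 a; rewrite expg1.
- by move=> a f; rewrite /q fconn_flat.
- have [<-//|ne] := eqVneq z (tau (rho 0)).
  by apply: contra lz; apply: low_lt; exact: om_coord_max.
Qed.

Lemma lowE_lt t q a : Y a < t -> below S t q a.
Proof. by rewrite /below => ->. Qed.

Lemma fconn_sym a b : fconn a b = fconn b a.
Proof.
by rewrite /fconn; apply: sym_connect_sym => x y; rewrite orbC.
Qed.

Lemma fconn_X a b : fconn a b -> X a = X b -> vertex_of a = vertex_of b.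
Proof. by case/fconnP => // _ lt _ _ e; move: lt; rewrite e ltxx. Qed.

(* A bent edge leaving [a] horizontally occupies that side of the vertex,
   hence it ends the horizontal component. *)
Lemma fconn_bent a b : fconn a b -> Y a <> Y (tau a) ->
  (dir a = 1 -> X b <= X a) /\ (dir a = 3 -> X a <= X b).
Proof.
move=> fc ne; split=> d; have := flat_at_dir d ne;
  by case: (fconnP fc) => [_ /(H_vt 1)->|_ /ltW ? ? ?|_ /ltW ? ? ?].
Qed.

Lemma bent_dirs a : Y a < Y (tau a) ->
  [/\ dir a <> 0 -> dir a = 1 /\ X a < xcross a \/ dir a = 3 /\ xcross a < X a &
      dir (tau a) <> 2 -> dir (tau a) = 1 /\ X (tau a) < xcross a \/
                          dir (tau a) = 3 /\ xcross a < X (tau a)].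
Proof.
rewrite /xcross; case: (dirsP S a) => hY hX lt; split=> // _;
  first [by left | by right | exfalso; lra].
Qed.

Lemma vertical_vertical a b y :
  Y a < Y (tau a) -> Y b < Y (tau b) -> xcross a = xcross b ->
  Y a <= y <= Y (tau a) -> Y b <= y <= Y (tau b) ->
  a = b \/ exists c, X c = xcross a /\ Y c = y.
Proof.
wlog le : a b / Y b <= Y a.
  move=> w; have [/w h|/ltW /w h] := leP (Y b) (Y a); first exact: h.
  move=> ua ub e ha hb; case: (h ub ua (esym e) hb ha) => [->|]; [by left | right].
  by rewrite e.
move=> ua ub exv /andP[a1 a2] /andP[b1 b2].
(* The touching case: [b] ends on the component where [a] starts. If both are bent there, each bend
   lies beyond an extremity of the component, and a common abscissa forces the same vertex and
   direction, that is [a = tau b]. *)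
have [fc|nfc] := boolP (fconn (tau b) a).
  right; have e := fconn_Y fc; have ey : Y a = y by apply/eqP; rewrite eq_le a1 -e b2.
  have [da|/eqP da] := eqVneq (dir a) 0; first by exists a; rewrite (xvE ua).1.
  have [db|/eqP db] := eqVneq (dir (tau b)) 2.
    by exists (tau b); rewrite e exv (xvE ub).2.
  exfalso; have [/(_ da) ha _] := bent_dirs ua; have [_ /(_ db) hb] := bent_dirs ub.
  have na : Y a <> Y (tau a) by move=> h; rewrite h ltxx in ua.
  have nb : Y (tau b) <> Y (tau (tau b)) by rewrite om_flipK => h; rewrite h ltxx in ub.
  have [b3 b4] := fconn_bent fc nb; rewrite fconn_sym in fc.
  have [a3 a4] := fconn_bent fc na.
  have same : dir a = dir (tau b) -> X a <= X (tau b) -> X (tau b) <= X a -> False.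
    move=> d h1 h2; have /vt_dir/(_ d) eab : vertex_of a = vertex_of (tau b).
      by apply: fconn_X => //; apply/eqP; rewrite eq_le h1.
    by move: ua; rewrite eab om_flipK => h; have := lt_trans ub h; rewrite ltxx.
  case: ha => -[d1 x1]; case: hb => -[d2 x2].
  - by apply: same; rewrite ?d1 //; auto.
  - by have := a3 d1; lra.
  - by have := a4 d1; lra.
  - by apply: same; rewrite ?d1 //; auto.
(* Otherwise only the component of [tau b] is raised above the height of [a]; both [a] and [b] then
   cross the level. *)
pose q := fun v => true (+) fconn (tau b) v.
have sa : below S (Y a) q a by rewrite /below eqxx /q /= nfc orbT.
have sta : ~~ below S (Y a) q (tau a) by rewrite low_above.
have cq : cut S (Y a) q by exact: cut_fconn sta.
left; apply: (cut_xv_inj cq) => //; first by rewrite /crossing sa.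
apply/andP; split.
  rewrite /below /q; case: (ltgtP (Y b) (Y a)) le => //= e _.
  by apply/negP => /fconn_Y; lra.
rewrite /below /q fconn_refl /= andbF orbF -leNgt.
exact: le_trans a1 b2.
Qed.

Lemma vertical_vertex a v :
  Y a < Y (tau a) -> ~~ ext v -> X v = xcross a -> Y a <= Y v <= Y (tau a) ->
  vertex_of v = vertex_of a \/ vertex_of v = vertex_of (tau a).
Proof.
move=> ua nv xva /andP[a1 a2]; have [ba bt] := bent_dirs ua.
have na : Y a <> Y (tau a) by move=> h; rewrite h ltxx in ua.
have nt : Y (tau a) <> Y (tau (tau a)) by rewrite om_flipK; exact: nesym.
have [fc|nfc] := boolP (fconn (tau a) v).
  right; apply/esym/fconn_X => //; rewrite xva.
  have [dt|/eqP dt] := eqVneq (dir (tau a)) 2; first by rewrite (xvE ua).2.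
  have [h1 h2] := fconn_bent fc nt.
  by case: (bt dt) => -[d lt]; exfalso; [have := h1 d | have := h2 d]; lra.
have [fc|nfc'] := boolP (fconn a v).
  left; apply/esym/fconn_X => //; rewrite xva.
  have [dt|/eqP dt] := eqVneq (dir a) 0; first by rewrite (xvE ua).1.
  have [h1 h2] := fconn_bent fc na.
  by case: (ba dt) => -[d lt]; exfalso; [have := h1 d | have := h2 d]; lra.
(* Some arc [w] leaves [v] vertically. It and [a], up to reversal of [w], cross a common level at
   the same abscissa, so [w] is [a] or [tau a]. *)
have [w ow dw] := om_dir_ex 0 nv; have ev := vt_porbit nv ow.
rewrite -ev; have [xw yw] := (H_vt 1 ev, H_vt 0 ev).
have dirw := om_coord_dir S w; case: dw => dw; rewrite dw ?Z4E ?H2E in dirw.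
  pose q := fun x => true (+) fconn (tau a) x.
  have sw : below S (Y v) q w by rewrite /below yw eqxx /q /= /fconn ev nfc orbT.
  have stw : ~~ below S (Y v) q (tau w) by rewrite low_above -?yw.
  have cq : cut S (Y v) q by exact: cut_fconn stw.
  left; congr vertex_of; apply: (cut_xv_inj cq); first by rewrite /crossing sw.
    apply/andP; split; last by rewrite /below /q fconn_refl /= andbF orbF -leNgt.
    rewrite /below /q; case: (ltgtP (Y a) (Y v)) a1 => //= e _.
    by apply/negP => /fconn_Y; lra.
  by rewrite (xvE dirw).1 // xw.
rewrite ltrN2 in dirw; rewrite Z4E in dw.
pose q := fun x => false (+) fconn a x.
have sw : ~~ below S (Y v) q w by rewrite /below yw ltxx eqxx /q /= /fconn ev.
have stw : below S (Y v) q (tau w) by rewrite lowE_lt -?yw.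
have cq : cut S (Y v) q by exact: cut_fconn sw.
right; rewrite -(om_flipK S w); congr (vertex_of (tau _)); apply: (cut_xv_inj cq).
- by rewrite /crossing stw om_flipK.
- apply/andP; split.
    by rewrite /below /q fconn_refl /= andbT orbC -le_eqVlt.
  rewrite /below /q negb_or -leNgt a2 /=; apply/negP => /andP[_ /fconn_Y e].
  by rewrite e ltxx in ua.
- have lt : Y (tau w) < Y (tau (tau w)) by rewrite om_flipK.
  by have := (xvE lt).2; rewrite om_flipK xw xva; apply.
Qed.

Lemma vertical_horizontal a k :
  Y a < Y (tau a) -> X (tau k) < xcross a < X k ->
  Y a <= Y (anchor S k) <= Y (tau a) ->
  exists c, X c = xcross a /\ Y c = Y (anchor S k).
Proof.
move=> ua /[dup] xk /andP[x1 x2] /andP[a1 a2]; set c := anchor S k in a1 a2 *.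
have kX : X (tau k) < X k by exact: lt_trans x2.
(* If the anchor is off the component of [tau a], raising this component makes [a] cross the level
   of the anchor, which [bottom_clear] forbids. *)
have [fc|nfc] := boolP (fconn (tau a) c); last first.
  pose q := fun x => true (+) fconn (tau a) x.
  have sc : below S (Y c) q c by rewrite /below eqxx /q /= nfc orbT.
  have sta : ~~ below S (Y c) q (tau a).
    by rewrite /below /q fconn_refl /= andbF orbF -leNgt.
  have cq : cut S (Y c) q by exact: cut_fconn sta.
  exfalso; apply: (bottom_clear cq kX erefl sc _ xk).
  apply/andP; split=> //; rewrite /below /q; case: (ltgtP (Y a) (Y c)) a1 => //= e _.
  by apply/negP => /fconn_Y; lra.
have [_ bt] := bent_dirs ua; have yc := fconn_Y fc.
have [dt|/eqP dt] := eqVneq (dir (tau a)) 2.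
  by exists (tau a); rewrite (xvE ua).2.
have nt : Y (tau a) <> Y (tau (tau a)).
  by rewrite om_flipK => h; rewrite h ltxx in ua.
have [h1 h2] := fconn_bent fc nt.
exfalso; have ck : dir k = 3 /\ c = k \/
    [/\ dir (tau k) = 1, c = tau k & Y (tau k) <> Y k].
  rewrite /c /anchor; case: (dirsP S k) => hY hX /=; auto; try (exfalso; lra);
    by right; split=> // h; rewrite h ltxx in hY.
case: (bt dt) => -[d lt].
  case: ck => [[dk e]|[dk e nk]]; first by have := h1 d; rewrite e; lra.
  have fk : fconn (tau k) (tau a) by rewrite fconn_sym -e.
  have nk' : Y (tau k) <> Y (tau (tau k)) by rewrite om_flipK.
  have [/(_ dk) h3 _] := fconn_bent fk nk'.
  have : vertex_of (tau a) = vertex_of (tau k).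
    rewrite -e; apply: fconn_X => //; rewrite e.
    by apply/eqP; rewrite eq_le h3 -e h1.
  move/vt_dir; rewrite d dk => /(_ erefl)/(can_inj (om_flipK S)) eak.
  move: x1 x2; rewrite /xcross -eak; case: ifP => _; by rewrite ltxx.
case: ck => [[dk e]|[dk e nk]]; last by have := h2 d; rewrite e; lra.
have [fl|nfl] := eqVneq (Y k) (Y (tau k)).
  have fc' : fconn (tau a) (tau k) by rewrite fconn_flat // -e.
  by have := (fconn_bent fc' nt).2 d; lra.
have fk : fconn k (tau a) by rewrite fconn_sym -e.
have [_ /(_ dk) h3] := fconn_bent fk (elimN eqP nfl).
have : vertex_of (tau a) = vertex_of k.
  by rewrite -e; apply: fconn_X => //; apply/eqP; rewrite eq_le h2 //= e.
move/vt_dir; rewrite d dk => /(_ erefl) eak.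
move: x1 x2; rewrite -eak om_flipK /xcross; case: ifP => _; by rewrite ltxx.
Qed.

End Separation.

(** * Quarter turns *)

Section Rotation.
Context (R : realFieldType) (D : finType) (S : ortho R D) (j : 'Z_4).

Lemma rot_table a : ~~ om_ext S a -> ~~ om_ext S (om_flip S a) ->
  let lab' b := om_label S b - j in let dir' b := om_dir S b - j in
  [\/ lab' (om_face S a) = lab' a /\
        [\/ dir' a = lab' a + 2 /\ dir' (om_flip S a) = lab' a,
            dir' a = lab' a + 3 /\ dir' (om_flip S a) = lab' a + 1 |
            dir' a = lab' a + 3 /\ dir' (om_flip S a) = lab' a],
      [/\ lab' (om_face S a) = lab' a + 1, dir' a = lab' a + 3 &
          dir' (om_flip S a) = lab' a + 1] |
      [/\ lab' (om_face S a) = lab' a + 2, dir' a = lab' a + 3 &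
          dir' (om_flip S a) = lab' a + 2]].
Proof.
move=> na nt /=; rewrite ![_ - j + _]addrAC.
case: (om_arc_table na nt) => [[-> h]|[-> -> ->]|[-> -> ->]];
  [|by apply: Or32|by apply: Or33].
by apply: Or31; split=> //; case: h => -[-> ->]; [apply: Or31|apply: Or32|apply: Or33].
Qed.

(** Direction 0 of the new structure is direction [j] of the old one: indices are shifted by [j],
    the values of labels and directions by [- j]. *)
Definition rotated : ortho R D.
Proof.
pose f i := i + j.
refine (@Ortho R D (om_cw S) (om_face S) (om_flip S) (om_ext S)
  (fun i => om_root S (i + j))
  (fun i => om_root_face S (i + j)) (fun a => om_label S a - j)
    (fun a => om_dir S a - j)
  (fun k => om_coord S (k + j)) (om_flipK S) (@om_cw_face _ _ S) (@om_ext_cw _ _ S)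
    (@om_ext_flip _ _ S)
  _ _ _ _ _ _ _ _ _ _ _ _ rot_table _ _ _ _ _ _ _).
- by move=> a /om_extP[i ->]; exists (i - j); rewrite subrK.
- by move=> i; exact: om_ext_root.
- by move=> i; rewrite om_face_root addrAC.
- by move=> k a; rewrite addrAC om_coord_opp.
- by move=> k a; exact: om_coord_cw.
- by move=> a; rewrite subrK; exact: om_coord_dir.
- move=> a; rewrite [_ - j + 2]addrAC => /(addIr _) /om_coord_straight.
  by rewrite [_ - j + 1 + j]addrAC subrK.
- by move=> i a; exact: om_coord_max.
- by move=> i; rewrite om_dir_root addrK.
- by move=> i; rewrite om_dir_flip_root addrAC addrK.
- by move=> a b na o /(addIr _); exact: om_dir_inj.
- move=> a i na; have [b o [e|e]] := om_dir_ex (i + j) na; exists b => //; rewrite e.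
    by left; rewrite addrK.
  by right; rewrite addrAC addrK.
- by move=> i a; exact: om_root_face_next.
- by move=> i a; exact: om_root_face_orbit.
- by move=> i; exact: om_root_face_root.
- by move=> i i' a r1 r2; apply: (addIr j); exact: om_root_face_uniq r1 r2.
- by move=> i a na /(om_root_face_label na) ->; rewrite addrK.
- move=> a h; apply: etrans (_ : _ = _) (@om_face_sum _ _ S a _); last first.
    by move=> i; rewrite -(subrK j i); exact: h.
  apply: eq_bigr => c _; rewrite /jump; congr nat_of_ord.
  by rewrite opprB addrA subrK.
- move=> k c c' h o e1 n1 e2 n2.
  rewrite [k + 3 + j]addrAC; apply: om_diagonal o _ _ _ _.
  + by move=> i; rewrite -(subrK j i); exact: h.
  + by rewrite -e1 subrK.
  + by rewrite -(inj_eq (addIr (- j))) addrK.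
  + by rewrite addrAC -e2 subrK.
  + by rewrite addrAC -(inj_eq (addIr (- j))) addrK.
Defined.

End Rotation.

Section Plane.
Context (R : realFieldType) (D : finType) (S : ortho R D).

Local Notation tau := (om_flip S).
Local Notation dir := (om_dir S).
Local Notation x := (om_coord S 3).
Local Notation y := (om_coord S 2).

(** In [rotated S 2] direction 0 is north and [xcross] is [vx]; in [rotated S 3] direction 0 is east
    and [xcross] is the opposite of [hy]. *)
Definition vx (a : D) : R := if dir a == 2 then x a else x (tau a).
Definition hy (a : D) : R := if dir a == 3 then y a else y (tau a).

Lemma H0E a : om_coord S 0 a = - y a. Proof. by rewrite -om_coord_opp Z4E. Qed.
Lemma H1E a : om_coord S 1 a = - x a. Proof. by rewrite -om_coord_opp Z4E. Qed.

Lemma sub_eq (i j k : 'Z_4) : (i - j == k) = (i == k + j).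
Proof. by rewrite subr_eq. Qed.

Lemma vertical_verticalP a b t :
  y a < y (tau a) -> y b < y (tau b) -> vx a = vx b ->
  y a <= t <= y (tau a) -> y b <= t <= y (tau b) ->
  a = b \/ exists c, x c = vx a /\ y c = t.
Proof.
have := @vertical_vertical _ _ (rotated S 2) a b t.
by rewrite /vx /xcross /= !sub_eq !Z4E; exact.
Qed.

Lemma horizontal_horizontalP a b t :
  x a < x (tau a) -> x b < x (tau b) -> hy a = hy b ->
  x a <= t <= x (tau a) -> x b <= t <= x (tau b) ->
  a = b \/ exists c, x c = t /\ y c = hy a.
Proof.
move=> h1 h2 h3 h4 h5.
have := @vertical_vertical _ _ (rotated S 3) a b t.
rewrite /hy /xcross /= !sub_eq !Z4E !H0E -!(fun_if -%R) in h3 *.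
move=> /(_ h1 h2); rewrite h3 => /(_ erefl h4 h5) [->|[c []]]; first by left.
by rewrite H0E => /oppr_inj ? ?; right; exists c.
Qed.

Lemma vertical_vertexP a v :
  y a < y (tau a) -> ~~ om_ext S v -> x v = vx a -> y a <= y v <= y (tau a) ->
  vertex_of S v = vertex_of S a \/ vertex_of S v = vertex_of S (tau a).
Proof.
have := @vertical_vertex _ _ (rotated S 2) a v.
by rewrite /vx /xcross /= !sub_eq !Z4E; exact.
Qed.

Lemma horizontal_vertexP a v :
  x a < x (tau a) -> ~~ om_ext S v -> y v = hy a -> x a <= x v <= x (tau a) ->
  vertex_of S v = vertex_of S a \/ vertex_of S v = vertex_of S (tau a).
Proof.
move=> h1 h2 h3; have := @vertical_vertex _ _ (rotated S 3) a v.
rewrite /hy /xcross /= !sub_eq !Z4E !H0E -!(fun_if -%R) in h3 *.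
by rewrite h3; apply.
Qed.

Lemma vertical_horizontalP a b :
  y a < y (tau a) -> x b < vx a < x (tau b) -> y a <= hy b <= y (tau a) ->
  exists c, x c = vx a /\ y c = hy b.
Proof.
move=> h1 h2 h3; have /andP[l1 l2] := h2; have lt := lt_trans l1 l2.
(* [vertical_horizontal] takes its horizontal part westwards, hence [tau b]. *)
have e : hy b = y (anchor (rotated S 2) (tau b)).
  rewrite /hy /anchor /= sub_eq Z4E om_flipK.
  have h4 := om_coord_dir S b; have h5 := om_coord_dir S (tau b); have h6 :=
    @om_coord_straight _ _ S b.
  rewrite om_flipK in h5.
  case: (Z4P (dir b)) => ea; case: (Z4P (dir (tau b))) => et;
    rewrite ?ea ?et ?Z4E ?H0E ?H1E in h4 h5 h6 * => //=;
    first [move: (h6 erefl) => {}h6 | clear h6]; clear ea et; lra.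
have := @vertical_horizontal _ _ (rotated S 2) a (tau b).
by rewrite /vx /xcross /= !sub_eq !Z4E om_flipK -e in h2 *; apply.
Qed.

End Plane.

(** * The lines of the edges and their intersections *)

Section Lines.
Context (R : realFieldType) (D : finType) (S : ortho R D).

Local Notation tau := (om_flip S).
Local Notation dir := (om_dir S).
Local Notation x := (om_coord S 3).
Local Notation y := (om_coord S 2).
Local Notation vx := (vx S).
Local Notation hy := (hy S).

Variant xy_spec (a : D) : 'Z_4 -> 'Z_4 -> Prop :=
| XY01 of y (tau a) < y a & x a < x (tau a) : xy_spec a 0 1
| XY02 of y (tau a) < y a & x a = x (tau a) : xy_spec a 0 2
| XY03 of y (tau a) < y a & x (tau a) < x a : xy_spec a 0 3
| XY10 of y a < y (tau a) & x (tau a) < x a : xy_spec a 1 0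
| XY12 of y (tau a) < y a & x (tau a) < x a : xy_spec a 1 2
| XY13 of y a = y (tau a) & x (tau a) < x a : xy_spec a 1 3
| XY20 of y a < y (tau a) & x a = x (tau a) : xy_spec a 2 0
| XY21 of y a < y (tau a) & x a < x (tau a) : xy_spec a 2 1
| XY23 of y a < y (tau a) & x (tau a) < x a : xy_spec a 2 3
| XY30 of y a < y (tau a) & x a < x (tau a) : xy_spec a 3 0
| XY31 of y a = y (tau a) & x a < x (tau a) : xy_spec a 3 1
| XY32 of y (tau a) < y a & x a < x (tau a) : xy_spec a 3 2.

Lemma xyP a : xy_spec a (dir a) (dir (tau a)).
Proof. by case: (dirsP S a) => hY hX; rewrite !(H0E, H1E) in hY hX; constructor;
  lra. Qed.

Definition between (u v w : R) : bool := (u <= w <= v) || (v <= w <= u).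

(** Only upward or eastward arcs carry points, so the two parts of a bent edge may belong to
    opposite arcs; a point of the edge is on [a] or on [tau a]. *)
Definition on_line (a : D) (P : R * R) : Prop :=
  [/\ y a < y (tau a), P.1 = vx a & y a <= P.2 <= y (tau a)] \/
  [/\ x a < x (tau a), P.2 = hy a & x a <= P.1 <= x (tau a)].

Lemma on_horizontal a P : odd (dir a) -> P.2 = y a ->
  between (x a) (x (tau a)) P.1 -> on_line a P \/ on_line (tau a) P.
Proof.
rewrite /on_line /hy /between om_flipK.
case: (xyP a) => //= hY hX _ eP /orP[] bt; try (exfalso; lra);
  by [left; right; split; lra | right; right; split; lra].
Qed.

Lemma on_vertical a P : ~~ odd (dir a) -> P.1 = x a ->
  between (y a) (y (tau a)) P.2 -> on_line a P \/ on_line (tau a) P.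
Proof.
rewrite /on_line /vx /between om_flipK.
case: (xyP a) => //= hY hX _ eP /orP[] bt; try (exfalso; lra);
  by [left; left; split; lra | right; left; split; lra].
Qed.

(* An end of a horizontal part is a vertex or the bend, which also lies on the
   vertical part. *)
Lemma horizontal_end b P : x b < x (tau b) -> P.2 = hy b ->
  P.1 = x b \/ P.1 = x (tau b) ->
  [\/ exists c, x c = P.1 /\ y c = P.2,
      [/\ y b < y (tau b), P.1 = vx b & y b <= P.2 <= y (tau b)] |
      [/\ y (tau b) < y b, P.1 = vx (tau b) & y (tau b) <= P.2 <= y b]].
Proof.
rewrite /hy /vx om_flipK; case: (xyP b) => //= hY hX lt e2 [] e1;
  first [exfalso; lra
  | by apply: Or31; exists b; split; lra | by apply: Or31; exists (tau b); split; lra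
  | by apply: Or32; split; lra | by apply: Or33; split; lra].
Qed.

Lemma on_vertical_cross a b P :
  [/\ y a < y (tau a), P.1 = vx a & y a <= P.2 <= y (tau a)] ->
  on_line b P ->
  [\/ a = b, a = tau b | exists c, x c = P.1 /\ y c = P.2].
Proof.
move=> [a1 a2 a3].
have vv c : y c < y (tau c) -> P.1 = vx c -> y c <= P.2 <= y (tau c) ->
    a = c \/ exists c, x c = P.1 /\ y c = P.2.
  by move=> c1 c2 c3; rewrite a2; apply: vertical_verticalP; rewrite // -a2.
case=> -[b1 b2 b3]; first by case: (vv b b1 b2 b3) => ?; [exact: Or31 | exact: Or33].
have [end_|/norP[n1 n2]] := boolP ((P.1 == x b) || (P.1 == x (tau b))).
  have e : P.1 = x b \/ P.1 = x (tau b) by case/orP: end_ => /eqP; auto.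
  case: (horizontal_end b1 b2 e) => [?|[c1 c2 c3]|[c1 c2 c3]]; first exact: Or33.
    by case: (vv b c1 c2 c3) => ?; [exact: Or31 | exact: Or33].
  by case: (vv (tau b)); rewrite ?om_flipK // => ?; [exact: Or32 | exact: Or33].
have [||c] := @vertical_horizontalP _ _ S a b a1.
- by rewrite -a2 !lt_def n1 eq_sym n2; case/andP: b3 => -> ->.
- by rewrite -b2.
by rewrite -a2 -b2 => ?; apply: Or33; exists c.
Qed.

Lemma on_cross a b P : on_line a P -> on_line b P ->
  [\/ a = b, a = tau b | exists c, x c = P.1 /\ y c = P.2].
Proof.
case=> ha hb; first exact: on_vertical_cross hb.
case: (hb) => hb'; last first.
  case: ha hb' => a1 a2 a3 [b1 b2 b3].
  case: (horizontal_horizontalP a1 b1 _ a3 b3); first by rewrite -a2.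
    by move=> ->; apply: Or31.
  by rewrite -a2 => ?; apply: Or33.
have oa : on_line a P by right.
case: (on_vertical_cross hb' oa) => [->|->|?]; [by apply: Or31| |exact: Or33].
by rewrite om_flipK; apply: Or32.
Qed.

Lemma on_vertex a v : ~~ om_ext S v -> on_line a (x v, y v) ->
  vertex_of S v = vertex_of S a \/ vertex_of S v = vertex_of S (tau a).
Proof.
move=> nv [] [h1 h2 h3]; first exact: vertical_vertexP.
exact: horizontal_vertexP.
Qed.

(** Some arc [w] leaves [v] vertically and the point of [u] is on it, so [u] is an end of [w]; the
    far end is at another height. *)
Lemma position_inj u v : ~~ om_ext S u -> ~~ om_ext S v -> x u = x v -> y u = y v ->
  vertex_of S u = vertex_of S v.
Proof.
move=> nu nv ex ey; have [w ow dw] := om_dir_ex 0 nv.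
have ew := vt_porbit nv ow; rewrite -ew.
have [xw yw] := (H_vt 3 ew, H_vt 2 ew).
have odw : ~~ odd (dir w) by case: dw => ->; rewrite ?Z4E.
have ne : y w <> y (tau w).
  by case: dw (xyP w) => ->; rewrite ?Z4E => h; inversion h => e; lra.
have bt : between (y w) (y (tau w)) (y u).
  by rewrite /between ey -yw !lexx /= andbT le_total.
have on : vertex_of S u = vertex_of S w \/ vertex_of S u = vertex_of S (tau w).
  case: (@on_vertical w (x u, y u) odw) => //=; first by rewrite ex.
    exact: on_vertex.
  by move/(on_vertex nu); rewrite om_flipK => -[]; auto.
by case: on => // /(H_vt 2); rewrite ey -yw => /ne.
Qed.

Definition position (a : D) : R * R := (x a, y a).

Definition bend (a : D) : R * R :=
  if odd (dir a) then (x (tau a), y a) else (x a, y (tau a)).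

Definition line (a : D) : seq (R * R) :=
  if dir (tau a) == dir a + 2 then [:: position a; position (tau a)]
  else [:: position a; bend a; position (tau a)].

Lemma line_rev a : line (tau a) = rev (line a).
Proof.
rewrite /line /bend om_flipK; by case: (xyP a) => //= *; rewrite /position;
  do ?congr (_ :: _).
Qed.

End Lines.

Lemma porbit1 (T : finType) (s : {perm T}) x : s x \in porbit s x.
Proof. by have := mem_porbit s 1 x; rewrite expg1. Qed.

Lemma sum_porbits (T : finType) (s : {perm T}) (P : pred T) (F : T -> nat) c :
  (forall x y, P x -> y \in porbit s x -> P y) ->
  (forall x, P x -> \sum_(y in porbit s x) F y = c)%N ->
  (\sum_(x | P x) F x = #|[set porbit s x | x in P]| * c)%N.
Proof.
move=> Pc Fc; rewrite (partition_big (porbit s) [in [set porbit s x | x in P]]) /=.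
  rewrite -sum_nat_const; apply: eq_bigr => O /imsetP[x Px ->].
  rewrite -(Fc x Px); apply: eq_bigl => y; rewrite eq_porbit_mem.
  by apply: andb_idl => /(Pc _ _ Px).
by move=> x Px; apply: imset_f.
Qed.

(** * The root edges and Euler's formula *)

Section Angulation.
Context (G : cmap) (r : dart G) (sqG : square_34_angulation r).

Local Notation D := (dart G).
Local Notation tau := (@flip G : D -> D).
Local Notation sg := (face_perm G).
Local Notation psi := (face_perm (dual G)).
Local Notation rho := (root_arc r).

Let tauK : involutive tau := @flip_involutive G.

Lemma flipV : ((flip G)^-1)%g = flip G.
Proof. by apply/permP => y; apply: (@perm_inj _ (flip G)); rewrite permKV tauK. Qed.

Lemma face_permE x : sg x = ((cw G)^-1)%g (tau x).
Proof. by rewrite /face_perm permM. Qed.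

Lemma face_perm_dualE x : psi x = tau (cw G (tau x)).
Proof. by rewrite /face_perm permM /= invMg invgK permM flipV. Qed.

Lemma sg_psiE x : sg (psi x) = tau x.
Proof. by rewrite face_permE face_perm_dualE tauK permK. Qed.

Lemma psi_tau x : psi (tau x) = ((sg)^-1)%g x.
Proof. by apply: (@perm_inj _ sg); rewrite sg_psiE permKV tauK. Qed.

Lemma root_arcS i : rho (i + 1) = cw G (tau (rho i)).
Proof.
have e n : tau (iter n (fun d => cw G (tau d)) r) = iter n (sg^-1)%g (tau r).
  elim: n => //= n <-; apply: (@perm_inj _ sg); rewrite permKV.
  by rewrite face_permE tauK permK.
case: (Z4P i) => ei; subst i; rewrite Z4E // /root_arc.
(* The wrap-around from 0 to 1: four steps close up around the outer face, of degree 4. *)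
have N4 : #|porbit sg^-1%g (tau r)| = 4%N.
  by rewrite porbitV; exact: angulation_outer_degree sqG.
have := iter_porbit sg^-1%g (tau r); rewrite N4 -e.
by move/(can_inj tauK) => {1}<-.
Qed.

Lemma psi_root_arc i : psi (rho i) = tau (rho (i + 1)).
Proof. by rewrite face_perm_dualE root_arcS. Qed.

Lemma sg_root_arc i : sg (tau (rho (i + 1))) = tau (rho i).
Proof. by rewrite -psi_root_arc sg_psiE. Qed.

Definition at_infty (a : D) : bool := a \in v_infty r.

Lemma at_infty_porbit a b : b \in porbit sg a -> at_infty b = at_infty a.
Proof.
by rewrite /at_infty /v_infty /vert /= -!eq_porbit_mem => /eqP ->.
Qed.

Lemma at_infty_root i : at_infty (tau (rho i)).
Proof.
have step k : at_infty (tau (rho (k + 1))) -> at_infty (tau (rho k)).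
  by rewrite -[tau (rho k)]sg_root_arc (at_infty_porbit (porbit1 _ _)).
have e1 : at_infty (tau (rho 1)) by rewrite /at_infty /v_infty /vert porbit_id.
have e0 : at_infty (tau (rho 0)) by apply: step; rewrite Z4E.
have e3 : at_infty (tau (rho 3)) by apply: step; rewrite Z4E.
by case: (Z4P i) => -> //; apply: step; rewrite Z4E.
Qed.

Lemma at_inftyP a : at_infty a -> exists i, a = tau (rho i).
Proof.
rewrite /at_infty /v_infty /vert => /porbitP[n ->].
elim: n => [|n [i IH]]; first by exists 1; rewrite expg0 perm1.
exists (i - 1); rewrite expgSr permM {}IH.
by rewrite -{1}(subrK 1 i); exact: sg_root_arc.
Qed.

Lemma vert_root i : vert (rho i) = root_vertex r i.
Proof. by []. Qed.

Lemma vert_root_flip i : vert (tau (rho i)) = root_vertex r (i + 1).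
Proof.
rewrite -vert_root root_arcS /vert; apply/esym/eqP.
by rewrite eq_porbit_mem porbit1.
Qed.

Lemma root_arc_inj : injective rho.
Proof. by move=> i j e; apply: (angulation_outer_vertices sqG);
  rewrite /root_vertex e. Qed.

(** A loop at v_infty would be a root arc that reverses another, giving v_{j+2} = v_j, but the outer
    vertices are distinct. *)
Lemma at_infty_flip a : at_infty a -> ~~ at_infty (tau a).
Proof.
case/at_inftyP => i ->; rewrite tauK; apply/negP => /at_inftyP[j e].
have := vert_root_flip i; have := vert_root_flip j.
rewrite -e {2}e tauK !vert_root => /(angulation_outer_vertices sqG) ei.
move=> /(angulation_outer_vertices sqG); rewrite ei -addrA Z4E.
by case: (Z4P j) => ->.
Qed.

Lemma at_infty_root_arc i : at_infty (rho i) = false.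
Proof. by apply/negbTE; rewrite -(tauK (rho i)); apply: at_infty_flip;
  exact: at_infty_root. Qed.

Lemma in_root_face_psi i a : in_root_face r i (psi a) = in_root_face r i a.
Proof.
rewrite /in_root_face face_perm_dualE tauK /vert.
by have := porbit_perm (cw G) 1 (tau a); rewrite expg1 => ->.
Qed.

Lemma in_root_face_orbit i a : in_root_face r i a -> a \in porbit psi (tau (rho i)).
Proof.
rewrite /in_root_face => /eqP e.
have := dual_rfaceE (M := G) (tau (rho i)) a; rewrite /rface => ->.
by rewrite tauK /vert -eq_porbit_mem; apply/eqP.
Qed.

Lemma in_root_face_root i : in_root_face r i (tau (rho i)).
Proof. by rewrite /in_root_face tauK. Qed.

Lemma in_root_face_rootS i : in_root_face r (i + 1) (rho i).
Proof. by rewrite -in_root_face_psi psi_root_arc in_root_face_root. Qed.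

Lemma in_root_face_uniq i j a : in_root_face r i a -> in_root_face r j a -> i = j.
Proof.
move=> /eqP e1 /eqP e2; apply: (angulation_outer_vertices sqG).
by rewrite -e1 -e2.
Qed.

Lemma nonroot_face_init a : nonroot_face r a -> ~~ at_infty a.
Proof. by move/forallP => h; apply/negP => /at_inftyP[i e]; have := h i;
  rewrite e in_root_face_root. Qed.

Lemma nonroot_face_term a : nonroot_face r a -> ~~ at_infty (tau a).
Proof.
move/forallP => h; apply/negP => /at_inftyP[i /(can_inj tauK) e].
by have := h (i + 1); rewrite e in_root_face_rootS.
Qed.

Lemma card_faces : #|porbits psi| = #|porbits (cw G)|.
Proof.
have e a : porbit psi a = [set tau x | x in porbit (cw G) (tau a)].
  apply/setP => b; have := dual_rfaceE (M := G) a b; rewrite /rface => ->.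
  apply/idP/imsetP => [h|[x h ->]]; last by rewrite tauK.
  by exists (tau b); rewrite ?tauK.
have -> : porbits psi = [set tau @: (O : {set D}) | O in porbits (cw G)].
  apply/setP => O; apply/imsetP/imsetP => [[a _ ->]|[O' /imsetP[a _ ->] ->]].
    by exists (porbit (cw G) (tau a)); rewrite ?e // imset_f.
  by exists (tau a); rewrite ?e ?tauK.
by apply: card_imset; apply: imset_inj; exact: can_inj tauK.
Qed.

Lemma card_darts : #|D| = (#|porbits (flip G)| * 2)%N.
Proof.
have two x : (\sum_(y in porbit (flip G) x) 1 = 2)%N.
  rewrite sum1_card; have -> : porbit (flip G) x = [set x; tau x].
    apply/setP => y; rewrite !inE; apply/porbitP/orP.
      case=> n ->; elim: n => [|n IH]; first by rewrite expg0 perm1 eqxx; left.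
      rewrite expgSr permM; case: IH => /eqP ->; rewrite ?tauK eqxx; auto.
    by case=> /eqP ->; [exists 0%N; rewrite expg0 perm1 | exists 1%N; rewrite expg1].
  by rewrite cards2 eq_sym flip_neq.
have := @sum_porbits _ (flip G) predT (fun=> 1%N) 2 (fun _ _ _ _ => isT)
  (fun x _ => two x).
by rewrite sum1_card => ->.
Qed.

Lemma card_nonroot_vertices : #|porbits sg| = #|[set porbit sg x | x in [pred a | ~~ at_infty a]]|.+1.
Proof.
have -> : porbits sg = v_infty r |: [set porbit sg x | x in [pred a | ~~ at_infty a]].
  apply/setP => O; rewrite in_setU1; apply/imsetP/orP.
    case=> a _ ->; have [ea|na] := boolP (at_infty a).
      by left; rewrite eq_porbit_mem.
    by right; apply: imset_f.
  by case=> [/eqP ->|/imsetP[a _ ->]]; [exists (tau r) | exists a].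
rewrite cardsU1 -add1n; congr (_ + _)%N.
case: imsetP => // -[a na e]; exfalso; move/negP: na; apply.
by rewrite /at_infty e porbit_id.
Qed.

Lemma card_nonroot_faces : #|porbits psi| = (#|[set porbit psi x | x in nonroot_face r]| + 4)%N.
Proof.
pose Rt := [set porbit psi (tau (rho i)) | i : 'Z_4].
have -> : porbits psi = [set porbit psi x | x in nonroot_face r] :|: Rt.
  apply/setP => O; rewrite in_setU; apply/imsetP/orP.
    case=> a _ ->; have [ea|] := boolP (nonroot_face r a).
      by left; apply: imset_f.
    rewrite negb_forall => /existsP[i]; rewrite negbK => /in_root_face_orbit o.
    by right; apply/imsetP; exists i => //; apply/eqP; rewrite eq_porbit_mem.
  by case=> [/imsetP[a _ ->]|/imsetP[i _ ->]]; [exists a | exists (tau (rho i))].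
have rfp i a b : b \in porbit psi a -> in_root_face r i b = in_root_face r i a.
  by case/porbitP => n ->; elim: n => [|n IH];
    rewrite ?expg0 ?perm1 // expgSr permM in_root_face_psi.
rewrite cardsU (_ : _ :&: _ = set0) ?cards0 ?subn0; last first.
  apply/setP => O; rewrite !inE; apply/negbTE/andP => -[/imsetP[a na ->]].
  case/imsetP => i _ /eqP; rewrite eq_porbit_mem => /rfp e.
  by move/forallP: na => /(_ i); rewrite e in_root_face_root.
rewrite [#|Rt|]card_imset ?card_ord // => i j /eqP; rewrite eq_porbit_mem => /rfp e.
by apply: (@in_root_face_uniq i j (tau (rho i)));
  rewrite ?in_root_face_root // e in_root_face_root.
Qed.

End Angulation.

Lemma jump_cycle (i j k l : 'Z_4) :
  (4 %| jump i j + jump j k + jump k l + jump l i)%N.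
Proof.
by case: (Z4P i) => ->; case: (Z4P j) => ->; case: (Z4P k) => ->;
  case: (Z4P l) => ->.
Qed.

(** * Label jumps around an edge *)

Section Labeling.
Context (G : cmap) (r : dart G) (sqG : square_34_angulation r).
Context (L : dart (dual G) -> 'Z_4) (GS : dual_4GS_labeling r L).

Local Notation D := (dart G).
Local Notation tau := (@flip G : D -> D).
Local Notation sg := (face_perm G).
Local Notation psi := (face_perm (dual G)).
Local Notation rho := (root_arc r).
Local Notation at_infty := (at_infty r).

Let tauK : involutive tau := @flip_involutive G.

(* [vjump a] is the jump from li(a) to ri(a), [fjump a] the one from ri(a) to rt(a). *)
Definition vjump (a : D) : nat := jump (L ((sg^-1)%g a)) (L a).
Definition fjump (a : D) : nat := jump (L a) (L (psi a)).
Definition inner (a : D) : bool := ~~ at_infty a && ~~ at_infty (tau a).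

Lemma at_infty_sgV a : at_infty ((sg^-1)%g a) = at_infty a.
Proof. by apply: at_infty_porbit; rewrite -porbitV porbit1. Qed.

Lemma at_infty_psi a : at_infty (psi a) = at_infty (tau a).
Proof. by rewrite -sg_psiE (at_infty_porbit r (porbit1 _ _)). Qed.

Lemma vjump_gt0 a : ~~ at_infty a -> (0 < vjump a)%N.
Proof.
move=> na; rewrite lt0n /vjump jump0.
have na' : nonroot_corner r ((sg^-1)%g a) by rewrite /nonroot_corner -/(at_infty _)
  at_infty_sgV.
by have := GS_L2 GS na'; rewrite /= permKV.
Qed.

Lemma vjump_sum a : ~~ at_infty a -> (\sum_(b in porbit sg a) vjump b = 4)%N.
Proof.
move=> na; rewrite -(GS_L1_vertex GS na) /vert /=.
rewrite (reindex_inj (@perm_inj _ sg)) /=; apply: eq_big => b.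
  rewrite -!eq_porbit_mem; have := porbit_perm sg 1 b.
  by rewrite expg1 => ->.
by rewrite /vjump permK.
Qed.

Lemma fjump_sum a : nonroot_face r a -> (\sum_(b in porbit psi a) fjump b = 4)%N.
Proof. by move=> na; exact: (GS_L1_face GS na). Qed.

Lemma degree a : ~~ at_infty a -> (3 <= #|porbit sg a|)%N.
Proof.
by move=> na; case: (angulation_inner_degree sqG na); rewrite /rface => ->.
Qed.

(** At least three jumps, each at least 1, share a total of 4. *)
Lemma vjump_le2 a : ~~ at_infty a -> (vjump a <= 2)%N.
Proof.
move=> na; have := vjump_sum na; rewrite (bigD1 a) ?porbit_id //=.
have h : (\sum_(b in porbit sg a | b != a) 1 <= \sum_(b in porbit sg a | b != a)
  vjump b)%N.
  apply: leq_sum => b /andP[o _]; apply: vjump_gt0.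
  by rewrite (at_infty_porbit r o).
have := degree na; rewrite -sum1_card (bigD1 a) ?porbit_id //=.
by move: h; set s1 := (\sum_(b in _ | _) 1)%N; set s2 := (\sum_(b in _ | _)
  vjump b)%N; lia.
Qed.

Lemma lab_root i : L (rho i) = i + 1 /\ L ((sg^-1)%g (rho i)) = i.
Proof.
split.
  by apply: (GS_L0 GS); [rewrite /nonroot_corner -/(at_infty _)
    at_infty_root_arc | exact: in_root_face_rootS].
apply: (GS_L0 GS).
  by rewrite /nonroot_corner -/(at_infty _) at_infty_sgV at_infty_root_arc.
by rewrite -psi_tau in_root_face_psi in_root_face_root.
Qed.

Lemma vjump_root i : vjump (rho i) = 1%N.
Proof. by rewrite /vjump; have [-> ->] := lab_root i; apply/eqP; rewrite jump1. Qed.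

Lemma root_out : [set a | ~~ at_infty a && at_infty (tau a)] = [set rho i | i : 'Z_4].
Proof.
apply/setP => a; rewrite inE; apply/andP/imsetP => [[na /at_inftyP ext_]|[i _ ->]].
  by case: ext_ => // i /(can_inj tauK) ->; exists i.
by rewrite at_infty_root_arc // at_infty_root.
Qed.

Lemma sum_nonroot_corners F : (\sum_(a : D | ~~ at_infty a) F a =
  \sum_(a | inner a) F a + \sum_(i : 'Z_4) F (rho i))%N.
Proof.
rewrite (bigID (fun a => at_infty (tau a))) /= addnC; congr (_ + _)%N.
rewrite -(big_imset _ (in2W (root_arc_inj sqG))) -root_out.
by apply: eq_bigl => a; rewrite inE.
Qed.

Lemma sum_inner_flip F :
  (\sum_(a : D | inner a) F (tau a) = \sum_(a | inner a) F a)%N.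
Proof.
rewrite [RHS](reindex_inj (can_inj tauK)); apply: eq_bigl => a.
by rewrite /inner tauK andbC.
Qed.

Definition ejump (a : D) : nat := (vjump a + fjump a + vjump (tau a) + fjump (tau a))%N.

(** The labels close up around the edge, so the sum is a multiple of 4, and it is positive since
    consecutive labels at a vertex differ. *)
Lemma ejump_ge4 a : inner a -> (4 <= ejump a)%N.
Proof.
case/andP => na _; have d : (4 %| ejump a)%N.
  rewrite /ejump /vjump /fjump psi_tau -(psi_tau (tau a)) tauK.
  exact: jump_cycle.
apply: dvdn_leq d; have := vjump_gt0 na; rewrite /ejump; lia.
Qed.

(* Each sum is a positive multiple of 4, and by Euler's formula they are 4 on
   average. *)
Lemma ejump_eq4 a : inner a -> ejump a = 4%N.
Proof.
have Sv : (\sum_(a | inner a) vjump a + 4 =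
   #|[set porbit sg x | x in [pred a | ~~ at_infty a]]| * 4)%N.
  rewrite -(@sum_porbits _ sg [pred a | ~~ at_infty a] vjump 4) //=.
  - rewrite sum_nonroot_corners; congr (_ + _)%N.
    by rewrite (eq_bigr (fun=> 1%N)) ?sum1_card ?card_ord // => i _; rewrite vjump_root.
  - by move=> x y nx /(at_infty_porbit r) ->.
  - exact: vjump_sum.
have Sf : (\sum_(a | inner a) fjump a = #|[set porbit psi x | x in nonroot_face r]| * 4)%N.
  rewrite -(@sum_porbits _ psi (nonroot_face r) fjump 4) //=; last exact: fjump_sum.
    rewrite (bigID (nonroot_face r)) /= [X in (_ + X)%N]big1 ?addn0.
      apply: eq_bigl => b; apply: andb_idl => na.
      by rewrite /inner nonroot_face_init // nonroot_face_term.
    (* Along a root face all labels agree, so these jumps vanish. *)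
    move=> b /andP[/andP[na nt]]; rewrite negb_forall => /existsP[i].
    rewrite negbK => ra; apply/eqP; rewrite jump0.
    rewrite (GS_L0 GS na ra) (GS_L0 (c := psi b) (i := i) GS) //.
      by rewrite /nonroot_corner -/(at_infty _) at_infty_psi.
    by rewrite in_root_face_psi.
  move=> x y nx /porbitP[n ->]; elim: n => [|n IH]; first by rewrite expg0 perm1.
  rewrite expgSr permM; apply/forallP => i; rewrite in_root_face_psi.
  exact: (forallP IH i).
have cI : (#|inner| + 8 = #|D|)%N.
  have ce : #|[pred a | at_infty a]| = 4%N.
    by rewrite -(angulation_outer_degree sqG); apply: eq_card => b; rewrite !inE.
  have h := sum_nonroot_corners (fun=> 1%N); rewrite !sum1_card (card_ord _ :
    #|'Z_4| = 4%N) in h.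
  rewrite -(cardC [pred a | at_infty a]) ce (_ :
    #|[predC _]| = #|[pred a | ~~ at_infty a]|).
    rewrite (_ : #|[pred b | ~~ at_infty b]| = (#|inner| + 4)%N);
      first by rewrite addnCA.
    exact: h.
  by apply: eq_card => b; rewrite !inE.
have Eu : (#|porbits (cw G)| + #|porbits sg| = #|porbits (flip G)| + 2)%N.
  by case: (angulation_planar sqG).
have := card_darts G; have := card_nonroot_vertices r; have :=
  card_nonroot_faces sqG; have := card_faces G.
move=> e1 e2 e3 e4.
(* With V non-root vertices and F non-root faces, the left side is 2(4V - 4 + 4F). Euler's formula
   (F + 4) + (V + 1) = E + 2 turns it into 8(E - 4), which is 4 times the number 2E - 8 of inner
   arcs. *)
have tot : (\sum_(a | inner a) ejump a = \sum_(a | inner a) 4)%N.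
  rewrite sum_nat_const /ejump !big_split /= !sum_inner_flip Sf.
  rewrite [X in _ = (X * 4)%N](_ : _ = #|inner|) //.
  by move: Sv cI Eu e1 e2 e3 e4; lia.
have le b : inner b -> (4 <= ejump b ?= iff (ejump b == 4))%N.
  by move=> ib; split; rewrite ?ejump_ge4 // eq_sym.
have [_] := leqif_sum le; rewrite tot eqxx => /esym/forall_inP h ia.
by apply/eqP; exact: h.
Qed.

End Labeling.

(* In the next definitions [l1 l2 l3 l4] are the labels li, ri, rt, lt of an
   arc; those of the opposite arc are [l3 l4 l1 l2]. *)
Definition quad (l1 l2 l3 l4 : 'Z_4) : bool :=
  [&& (0 < jump l1 l2 <= 2)%N, (0 < jump l3 l4 <= 2)%N &
      (jump l1 l2 + jump l2 l3 + jump l3 l4 + jump l4 l1 == 4)%N].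

(** An arc with two colors takes the one opposite to a color of the reverse arc, which makes the
    edge straight. With four colors both qualify and the first is taken, in agreement with the last
    clauses of [qodd] and [qeven]. *)
Definition qdir (l1 l2 l3 : 'Z_4) : 'Z_4 :=
  if (jump l1 l2 == 2)%N && (jump l2 l3 == 1)%N then l1 + 1 else l1.

Definition qodd (l1 l2 l3 l4 : 'Z_4) : bool :=
  [|| cyc_itv l2 l3 4, cyc_itv l4 l1 2 |
      [&& l2 == 1, l3 == 1, l4 == 3 & l1 == 3]].

Definition qeven (l1 l2 l3 l4 : 'Z_4) : bool :=
  [|| cyc_itv l2 l3 3, cyc_itv l4 l1 1 |
      [&& l2 == 4, l3 == 4, l4 == 2 & l1 == 2]].

(** Leaving east or west must agree with the orientation of odd arcs, leaving north or south with
    that of even arcs. *)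
Lemma quad_dir l1 l2 l3 l4 : quad l1 l2 l3 l4 ->
  let d := qdir l1 l2 l3 in let d' := qdir l3 l4 l1 in
  [/\ (d == 3 -> qodd l1 l2 l3 l4), (d == 1 -> qodd l3 l4 l1 l2),
      (d == 2 -> qeven l1 l2 l3 l4) & (d == 0 -> qeven l3 l4 l1 l2)].
Proof.
by case: (Z4P l1) => ->; case: (Z4P l2) => ->; case: (Z4P l3) => ->;
  case: (Z4P l4) => ->.
Qed.

(** A straight edge is contracted in the orientation of the perpendicular direction, so its ends
    share that coordinate. *)
Lemma quad_straight l1 l2 l3 l4 : quad l1 l2 l3 l4 ->
  let d := qdir l1 l2 l3 in let d' := qdir l3 l4 l1 in d' == d + 2 ->
  if odd d then ~~ qeven l1 l2 l3 l4 && ~~ qeven l3 l4 l1 l2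
  else ~~ qodd l1 l2 l3 l4 && ~~ qodd l3 l4 l1 l2.
Proof.
by case: (Z4P l1) => ->; case: (Z4P l2) => ->; case: (Z4P l3) => ->;
  case: (Z4P l4) => ->.
Qed.

Lemma quad_table l1 l2 l3 l4 : quad l1 l2 l3 l4 ->
  let d := qdir l1 l2 l3 in let d' := qdir l3 l4 l1 in
  [|| (l3 == l2) && [|| (d == l2 + 2) && (d' == l2),
                        (d == l2 + 3) && (d' == l2 + 1) |
                        (d == l2 + 3) && (d' == l2)],
      [&& l3 == l2 + 1, d == l2 + 3 & d' == l2 + 1] |
      [&& l3 == l2 + 2, d == l2 + 3 & d' == l2 + 2]].
Proof.
by case: (Z4P l1) => ->; case: (Z4P l2) => ->; case: (Z4P l3) => ->;
  case: (Z4P l4) => ->.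
Qed.

(** The colors of an edge that is not straight are just its two directions, as the drawing rule
    asks; disjointness tells which arc has which color. *)
Lemma quad_colors l1 l2 l3 l4 k : quad l1 l2 l3 l4 ->
  let d := qdir l1 l2 l3 in let d' := qdir l3 l4 l1 in
  ~~ (cyc_itv l1 l2 k && cyc_itv l3 l4 k) /\
  (d' != d + 2 -> odd d != odd d' /\
     cyc_itv l1 l2 k || cyc_itv l3 l4 k = (k == d) || (k == d')).
Proof.
by case: (Z4P k) => ->; case: (Z4P l1) => ->; case: (Z4P l2) => ->;
  case: (Z4P l3) => ->; case: (Z4P l4) => ->.
Qed.

Lemma qdir_color l1 l2 l3 : l1 != l2 -> cyc_itv l1 l2 (qdir l1 l2 l3).
Proof.
by case: (Z4P l1) => ->; case: (Z4P l2) => ->; case: (Z4P l3) => ->.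
Qed.

Lemma Z4_natr (i : 'Z_4) : (nat_of_ord i)%:R = i.
Proof. exact: natr_Zp. Qed.

Lemma jump_natr (i j : 'Z_4) : i + (jump i j)%:R = j.
Proof. by rewrite /jump Z4_natr addrC subrK. Qed.

Lemma natr_jump (i : 'Z_4) m n : (m <= n < 4)%N ->
  jump (i + m%:R) (i + n%:R) = (n - m)%N.
Proof.
case/andP=> mn n4; rewrite /jump opprD addrACA subrr add0r -natrB //.
by rewrite Zp_nat /= modn_small //; apply: leq_ltn_trans n4; exact: leq_subr.
Qed.

(** * Directions of the arcs around a vertex *)

Section Directions.
Context (G : cmap) (r : dart G) (sqG : square_34_angulation r).
Context (L : dart (dual G) -> 'Z_4) (GS : dual_4GS_labeling r L).

Local Notation D := (dart G).
Local Notation tau := (@flip G : D -> D).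
Local Notation sg := (face_perm G).
Local Notation psi := (face_perm (dual G)).
Local Notation rho := (root_arc r).
Local Notation at_infty := (at_infty r).
Local Notation inner := (@inner G r).

Let tauK : involutive tau := @flip_involutive G.

Definition dirn (a : D) : 'Z_4 := qdir (L ((sg^-1)%g a)) (L a) (L (psi a)).

Lemma dirn_color a : ~~ at_infty a -> (jump (L ((sg^-1)%g a)) (dirn a) < vjump L a)%N.
Proof.
move=> na; apply: qdir_color; rewrite -jump0 -lt0n.
exact: (vjump_gt0 GS na).
Qed.

(** The number of quarter turns from the label before [a] to the direction of the [n]-th arc after
    [a]. It stays below 4 over one turn, so directions are compared as integers. *)
Definition offset (a : D) (n : nat) : nat :=
  (\sum_(i < n) vjump L (iter i sg a) +
   jump (L ((sg^-1)%g (iter n sg a))) (dirn (iter n sg a)))%N.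

Lemma at_infty_iter n a : at_infty (iter n sg a) = at_infty a.
Proof. by apply: at_infty_porbit; rewrite -permX mem_porbit. Qed.

Lemma offset_dirn a n : dirn (iter n sg a) = L ((sg^-1)%g a) + (offset a n)%:R.
Proof.
suff e : L ((sg^-1)%g (iter n sg a)) =
   L ((sg^-1)%g a) + (\sum_(i < n) vjump L (iter i sg a))%:R.
  by rewrite /offset natrD addrA -e jump_natr.
elim: n => [|n IHn]; first by rewrite big_ord0 addr0.
by rewrite big_ord_recr /= natrD addrA -IHn permK jump_natr.
Qed.

(** The direction of an arc is one of its colors, and successive arcs have successive disjoint
    intervals of colors. *)
Lemma offset_lt a m n : ~~ at_infty a -> (m < n)%N -> (offset a m < offset a n)%N.
Proof.
move=> na mn; apply: (@leq_trans (\sum_(i < m.+1) vjump L (iter i sg a))%N).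
  by rewrite big_ord_recr /= /offset ltn_add2l; apply: dirn_color;
    rewrite at_infty_iter.
rewrite -(subnKC mn) /offset; set k := (n - m.+1)%N.
by rewrite big_split_ord /= -addnA leq_addr.
Qed.

Lemma offset_lt4 a n : ~~ at_infty a -> (n < #|porbit sg a|)%N -> (offset a n < 4)%N.
Proof.
move=> na nN; set N := #|_| in nN.
have <- : (\sum_(i < N) vjump L (iter i sg a) = 4)%N.
  rewrite -(vjump_sum GS na) (eq_bigl _ _ (porbit_traject sg a)).
  rewrite -big_uniq ?uniq_traject_porbit //=.
  rewrite (big_nth a) size_traject big_mkord; apply: eq_bigr => i _.
  by rewrite nth_traject.
rewrite -(subnKC nN); set k := (N - n.+1)%N.
rewrite big_split_ord /= big_ord_recr /=; apply: leq_trans (leq_addr _ _).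
by rewrite /offset ltn_add2l; apply: dirn_color; rewrite at_infty_iter.
Qed.

Lemma dirn_inj a b : ~~ at_infty a -> b \in porbit sg a -> dirn a = dirn b -> a = b.
Proof.
move=> na; rewrite porbit_traject => /trajectP[[|n] nN ->] //.
rewrite -[a in LHS]/(iter 0 sg a) !offset_dirn => /addrI e.
have lt := @offset_lt a 0 n.+1 na isT; have l4 := offset_lt4 na nN.
move/(congr1 (@nat_of_ord _)): e; rewrite !Zp_nat /= !modn_small //.
  by move=> e; rewrite e ltnn in lt.
exact: ltn_trans l4.
Qed.

Lemma dirn_rotation a b : ~~ at_infty a -> b \in porbit sg a -> b != a ->
  (0 < jump (dirn a) (dirn (sg a)) <= jump (dirn a) (dirn b))%N.
Proof.
move=> na; rewrite porbit_traject => /trajectP[[|n] nN ->]; first by rewrite eqxx.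
move=> _; rewrite -[a in dirn a]/(iter 0 sg a) -[sg (iter 0 _ _)]/(iter 1 sg a).
rewrite !offset_dirn.
have l1 := @offset_lt a 0 1 na isT; have l4 := offset_lt4 na nN.
have ln := @offset_lt a 0 n.+1 na isT.
have l1n : (offset a 1 <= offset a n.+1)%N.
  by case: n {nN l4 ln} => // n; apply/ltnW/offset_lt.
rewrite !natr_jump ?l4 ?andbT; [lia | exact: ltnW | rewrite (ltnW l1) /=].
exact: leq_ltn_trans l4.
Qed.

(** Degree at least 3 gives three distinct directions, which cannot all be among [i + 1] and
    [i + 3]. *)
Lemma dirn_ex a i : ~~ at_infty a ->
  exists2 b, b \in porbit sg a & dirn b = i \/ dirn b = i + 2.
Proof.
move=> na; pose I := [set dirn b | b in porbit sg a].
have cI : (2 < #|I|)%N.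
  rewrite card_in_imset; first exact: degree sqG _ na.
  move=> b c ob oc; apply: dirn_inj; first by rewrite (at_infty_porbit r ob).
  rewrite -!eq_porbit_mem in ob oc *; by rewrite (eqP oc) eq_sym.
have [b bI|e] := pickP [pred b in porbit sg a | (dirn b == i) || (dirn b == i + 2)].
  by case/andP: bI => o /orP[]/eqP; exists b; auto.
suff : (#|I| <= 2)%N by rewrite leqNgt cI.
have : I \subset [set i + 1; i + 3].
  apply/subsetP => _ /imsetP[b o ->]; have := e b; rewrite /= o /= !inE.
  by case: (Z4P i) => ->; case: (Z4P (dirn b)) => ->; rewrite ?Z4E.
by move/subset_leq_card; rewrite cards2 => h; apply: leq_trans h _; case: (_ != _).
Qed.

Lemma inner_quad a : inner a ->
  quad (L ((sg^-1)%g a)) (L a) (L (psi a)) (L (tau a)).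
Proof.
move=> ia; have /andP[na nt] := ia; have := ejump_eq4 sqG GS ia.
rewrite /ejump /fjump psi_tau -{2}(tauK a).
have e : psi a = (sg^-1)%g (tau a) by rewrite -psi_tau tauK.
have h1 := vjump_gt0 GS na; have h2 := vjump_le2 sqG GS na.
have h3 := vjump_gt0 GS nt; have h4 := vjump_le2 sqG GS nt.
move: h1 h2 h3 h4; rewrite /vjump /quad -!e !tauK => -> -> -> -> ->.
by [].
Qed.

Lemma dirn_tau a : dirn (tau a) = qdir (L (psi a)) (L (tau a)) (L ((sg^-1)%g a)).
Proof. by rewrite /dirn psi_tau -{1}psi_tau tauK. Qed.

Lemma dirn_root i : dirn (rho i) = i.
Proof.
rewrite /dirn /qdir; have [-> ->] := lab_root sqG GS i.
by rewrite ifF //; case: (Z4P i) => ->.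
Qed.

End Directions.

(** * The structure given by a labeling and two increasing functions *)

Section Instance.
Context (R : realFieldType) (G : cmap) (r : dart G) (sqG : square_34_angulation r).
Context (L : dart (dual G) -> 'Z_4) (GS : dual_4GS_labeling r L).
Context (ho he : {set dart (dual G)} -> R).

Local Notation D := (dart G).
Local Notation tau := (@flip G : D -> D).
Local Notation sg := (face_perm G).
Local Notation psi := (face_perm (dual G)).
Local Notation rho := (root_arc r).
Local Notation at_infty := (at_infty r).
Local Notation inner := (@inner G r).
Local Notation dirn := (@dirn G L).

Let tauK : involutive tau := @flip_involutive G.

Context (ho_flat : forall a, nonroot_arc r a -> ~~ odd_arc r L a ->
  ~~ odd_arc r L (tau a) -> ho (@vert (dual G) a) = ho (@vert (dual G) (tau a))).
Context (ho_lt : forall a, odd_arc r L a ->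
  ho (@vert (dual G) a) < ho (@vert (dual G) (tau a))).
Context (ho_diag : forall c c', odd_diagonal r L c c' ->
  ho (@vert (dual G) c) < ho (@vert (dual G) c')).
Context (he_flat : forall a, nonroot_arc r a -> ~~ even_arc r L a ->
  ~~ even_arc r L (tau a) -> he (@vert (dual G) a) = he (@vert (dual G) (tau a))).
Context (he_lt : forall a, even_arc r L a ->
  he (@vert (dual G) a) < he (@vert (dual G) (tau a))).
Context (he_diag : forall c c', even_diagonal r L c c' ->
  he (@vert (dual G) c) < he (@vert (dual G) c')).
Context (B : R) (hoB : forall v, `|ho v| < B) (heB : forall v, `|he v| < B).

Definition edir (a : D) : 'Z_4 := if at_infty a then dirn (tau a) + 2 else dirn a.

(** The end of a root edge is moved out to [B] or [- B] in the direction of the edge and keeps the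
    other coordinate of the vertex it comes from, so root edges are straight. *)
Definition xpos (a : D) : R :=
  if at_infty a then
    if dirn (tau a) == 3 then B else if dirn (tau a) == 1 then - B
    else ho (@vert (dual G) (tau a))
  else ho (@vert (dual G) a).

Definition ypos (a : D) : R :=
  if at_infty a then
    if dirn (tau a) == 2 then B else if dirn (tau a) == 0 then - B
    else he (@vert (dual G) (tau a))
  else he (@vert (dual G) a).

Definition coord (k : 'Z_4) (a : D) : R :=
  if k == 3 then xpos a else if k == 1 then - xpos a
  else if k == 2 then ypos a else - ypos a.

Lemma coordE a : (coord 0 a = - ypos a) * (coord 1 a = - xpos a) *
  (coord 2 a = ypos a) * (coord 3 a = xpos a).
Proof. by []. Qed.

Lemma coord_opp k a : coord (k + 2) a = - coord k a.
Proof. by case: (Z4P k) => ->; rewrite Z4E !coordE ?opprK. Qed.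

Lemma coord_bound i a : ~~ at_infty a -> - B < coord i a < B.
Proof.
move=> na; rewrite -ltr_norml.
by case: (Z4P i) => ->; rewrite coordE ?normrN /xpos /ypos (negPf na).
Qed.

Lemma coord_ext i j : coord i (tau (rho j)) =
  if i == j then B else if i == j + 2 then - B else coord i (rho j).
Proof.
by case: (Z4P i) => ->; case: (Z4P j) => ->; rewrite !coordE /xpos /ypos
  ?(at_infty_root sqG) ?(at_infty_root_arc sqG) ?tauK ?(dirn_root sqG GS)
    ?Z4E ?opprK ?tauK.
Qed.

Lemma coord_sg k a : ~~ at_infty a -> coord k (sg a) = coord k a.
Proof.
move=> na; have e : @vert (dual G) (sg a) = @vert (dual G) a.
  by rewrite /vert /=; have := porbit_perm sg 1 a; rewrite expg1.
by rewrite /coord /xpos /ypos (at_infty_porbit r (porbit1 sg a)) (negPf na) e.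
Qed.

Lemma coord_max i a : a != tau (rho i) -> coord i a < coord i (tau (rho i)).
Proof.
move=> ne; rewrite [coord i (tau (rho i))]coord_ext eqxx.
have B0 : - B < B by have /andP[] := coord_bound 0 (negbT (at_infty_root_arc sqG 0));
  exact: lt_trans.
have [/(at_inftyP sqG)[j ej]|na] := boolP (at_infty a); last by have /andP[] :=
  coord_bound i na.
rewrite ej coord_ext; case: eqP => [eij|_]; first by rewrite ej eij eqxx in ne.
case: ifP => // _; have /andP[] := coord_bound i (negbT (at_infty_root_arc sqG j)).
by [].
Qed.

Lemma edir_root i : edir (rho i) = i.
Proof. by rewrite /edir (at_infty_root_arc sqG) (dirn_root sqG GS). Qed.

Lemma edir_tau_root i : edir (tau (rho i)) = i + 2.
Proof. by rewrite /edir (at_infty_root sqG) tauK (dirn_root sqG GS). Qed.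

Lemma root_cases a : [\/ exists i, a = tau (rho i), exists i, a = rho i | inner a].
Proof.
have [/(at_inftyP sqG)|na] := boolP (at_infty a); first by apply: Or31.
have [/(at_inftyP sqG)[i /(can_inj tauK)]|nt] := boolP (at_infty (tau a)).
  by move=> ->; apply: Or32; exists i.
by apply: Or33; rewrite /inner /inner na.
Qed.

Lemma root_ne i : rho i != tau (rho i).
Proof. by rewrite eq_sym flip_neq. Qed.

Lemma oddE a : inner a -> odd_arc r L a =
  qodd (L ((sg^-1)%g a)) (L a) (L (psi a)) (L (tau a)).
Proof.
move=> ia; have -> : psi a = (sg^-1)%g (tau a) by rewrite -psi_tau tauK.
have -> : odd_arc r L a = inner a && qodd (L ((sg^-1)%g a)) (L a)
   (L ((sg^-1)%g (tau a))) (L (tau a)) by [].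
by rewrite ia.
Qed.

Lemma evenE a : inner a -> even_arc r L a =
  qeven (L ((sg^-1)%g a)) (L a) (L (psi a)) (L (tau a)).
Proof.
move=> ia; have -> : psi a = (sg^-1)%g (tau a) by rewrite -psi_tau tauK.
have -> : even_arc r L a = inner a && qeven (L ((sg^-1)%g a)) (L a)
   (L ((sg^-1)%g (tau a))) (L (tau a)) by [].
by rewrite ia.
Qed.

Lemma inner_tau a : inner a -> inner (tau a).
Proof. by rewrite /inner /inner tauK andbC. Qed.

Lemma oddE' a : inner a -> odd_arc r L (tau a) =
  qodd (L (psi a)) (L (tau a)) (L ((sg^-1)%g a)) (L a).
Proof. by move=> ia; rewrite oddE ?inner_tau // psi_tau tauK -psi_tau tauK. Qed.

Lemma evenE' a : inner a -> even_arc r L (tau a) =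
  qeven (L (psi a)) (L (tau a)) (L ((sg^-1)%g a)) (L a).
Proof. by move=> ia; rewrite evenE ?inner_tau // psi_tau tauK -psi_tau tauK. Qed.

Lemma xpos_inner a : inner a -> xpos a = ho (@vert (dual G) a) /\
  xpos (tau a) = ho (@vert (dual G) (tau a)).
Proof. by case/andP => /negPf na /negPf nt; rewrite /xpos na nt. Qed.

Lemma ypos_inner a : inner a -> ypos a = he (@vert (dual G) a) /\
  ypos (tau a) = he (@vert (dual G) (tau a)).
Proof. by case/andP => /negPf na /negPf nt; rewrite /ypos na nt. Qed.

Lemma edir_inner a : inner a -> edir a = dirn a /\ edir (tau a) = dirn (tau a).
Proof. by case/andP => /negPf na /negPf nt; rewrite /edir na nt. Qed.

Lemma coord_dir a : coord (edir a) a < coord (edir a) (tau a).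
Proof.
case: (root_cases a) => [[i ->]|[i ->]|ia].
- by rewrite edir_tau_root tauK !coord_opp ltrN2; apply/coord_max/root_ne.
- by rewrite edir_root; apply/coord_max/root_ne.
have [-> _] := edir_inner ia; have [xa xt] := xpos_inner ia.
have [ya yt] := ypos_inner ia.
have := quad_dir (inner_quad sqG GS ia); rewrite /= -/(dirn a).
rewrite -oddE // -oddE' // -evenE // -evenE' //.
case=> h3 h1 h2 h0; case: (Z4P (dirn a)) => d; rewrite d !coordE ?ltrN2 ?xa ?xt ?ya ?yt.
- by rewrite -[a in X in _ < X]tauK; apply: he_lt; apply: h0; rewrite d.
- by rewrite -[a in X in _ < X]tauK; apply: ho_lt; apply: h1; rewrite d.
- by apply: he_lt; apply: h2; rewrite d.
- by apply: ho_lt; apply: h3; rewrite d.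
Qed.

Lemma coord_straight a : edir (tau a) = edir a + 2 ->
  coord (edir a + 1) a = coord (edir a + 1) (tau a).
Proof.
case: (root_cases a) => [[i ->]|[i ->]|ia].
- rewrite edir_tau_root tauK coord_ext => _.
  by rewrite ifF; [rewrite ifF //|]; case: (Z4P i) => ->.
- rewrite edir_root coord_ext => _.
  by rewrite ifF; [rewrite ifF //|]; case: (Z4P i) => ->.
have [-> ->] := edir_inner ia; have [xa xt] := xpos_inner ia.
have [ya yt] := ypos_inner ia.
have := quad_straight (inner_quad sqG GS ia); rewrite /= -/(dirn a) -dirn_tau.
rewrite -oddE // -oddE' // -evenE // -evenE' // => h /eqP /h.
case: (Z4P (dirn a)) => d; rewrite d ?Z4E !coordE /= ?xa ?xt ?ya ?yt;
  case/andP => h1 h2; rewrite ?(ho_flat ia h1 h2) ?(he_flat ia h1 h2) //.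
Qed.

Lemma inst_table a : ~~ at_infty a -> ~~ at_infty (tau a) ->
  [\/ L (psi a) = L a /\
        [\/ edir a = L a + 2 /\ edir (tau a) = L a,
            edir a = L a + 3 /\ edir (tau a) = L a + 1 |
            edir a = L a + 3 /\ edir (tau a) = L a],
      [/\ L (psi a) = L a + 1, edir a = L a + 3 &
          edir (tau a) = L a + 1] |
      [/\ L (psi a) = L a + 2, edir a = L a + 3 &
          edir (tau a) = L a + 2]].
Proof.
move=> na nt; have ia : inner a by apply/andP.
have [-> ->] := edir_inner ia.
have := quad_table (inner_quad sqG GS ia); rewrite /= -/(dirn a) -dirn_tau.
case/or3P => [/andP[/eqP e1 /or3P h]|/and3P[/eqP ? /eqP ? /eqP ?]|/and3P[/eqP ? /eqP ? /eqP ?]].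
- apply: Or31; split=> //.
  case: h => /andP[/eqP ? /eqP ?]; by [apply: Or31 | apply: Or32 | apply: Or33].
- exact: Or32.
- exact: Or33.
Qed.

(** Labels [k = 0] and [k = 3] give the diagonal arcs as defined; 2 and 1 give them reversed, with
    the opposite coordinate. *)
Lemma inst_diag k c c' : (forall i, ~~ in_root_face r i c) -> c' \in porbit psi c ->
  L c = k -> L (psi c) != k -> L c' = k + 2 -> L (psi c') != k + 2 ->
  coord (k + 3) c < coord (k + 3) c'.
Proof.
move=> hc o; have nc : nonroot_face r c by apply/forallP.
have nc' : nonroot_face r c'.
  case/porbitP: (o) => n ->; elim: n => [|n IH]; first by rewrite expg0 perm1.
  by rewrite expgSr permM; apply/forallP => i; rewrite in_root_face_psi;
    exact: (forallP IH i).
have [/negPf n1 /negPf n2] : ~~ at_infty c /\ ~~ at_infty c' by rewrite !(nonroot_face_init sqG).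
have o' : c \in porbit psi c' by rewrite porbit_sym.
have Z4_4 : (4 : 'Z_4) = 0 by exact: val_inj.
have dg l m x x' : nonroot_face r x -> x' \in porbit psi x -> L x = l -> L (psi x)
  != l ->
    L x' = m -> L (psi x') != m -> diagonal r L l m x x'.
  move=> nx ox e1 e2 e3 e4.
  have -> : diagonal r L l m x x' = [&& nonroot_face r x, x' \in porbit psi x,
    last_corner L l x & last_corner L m x'] by [].
  by rewrite nx ox /last_corner e1 eqxx e2 e3 eqxx e4.
case: (Z4P k) => ->; rewrite ?Z4E !coordE ?ltrN2 /xpos /ypos n1 n2 => e1 e2 e3 e4.
- by apply: ho_diag; apply: dg => //; rewrite Z4_4.
- by apply: he_diag; apply: dg.
- by apply: ho_diag; apply: dg => //; rewrite Z4_4.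
- by apply: he_diag; apply: dg.
Qed.

Definition drawing : ortho R D.
Proof.
refine (@Ortho R D sg psi tau at_infty rho (in_root_face r)
  L edir coord tauK (@sg_psiE G)
  _ (@at_infty_flip G r sqG) (at_inftyP sqG) (at_infty_root sqG) (psi_root_arc sqG)
    coord_opp
  coord_sg coord_dir coord_straight coord_max edir_root edir_tau_root _ _ inst_table
  (@in_root_face_psi G r) (@in_root_face_orbit G r) (in_root_face_root r)
    (@in_root_face_uniq G r sqG) _ _ inst_diag).
- by move=> a; exact: at_infty_porbit (porbit1 sg a).
- move=> a b na o; rewrite /edir (at_infty_porbit r o) (negPf na); exact: (dirn_inj GS).
- move=> a i na; have [b o h] := dirn_ex sqG GS i na; exists b => //.
  by rewrite /edir (at_infty_porbit r o) (negPf na).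
- by move=> i a na ra; exact: (GS_L0 GS).
- by move=> a /forallP na; exact: (fjump_sum GS).
Defined.

End Instance.

(** * Drawings in the plane *)

From mathcomp Require Import all_classical all_reals all_analysis.
Import numFieldNormedType.Exports.
Local Open Scope classical_set_scope.

Section Polylines.
Context (R : realType) (D : finType) (S : ortho R D).

Local Notation tau := (om_flip S).
Local Notation dir := (om_dir S).
Local Notation x := (om_coord S 3).
Local Notation y := (om_coord S 2).
Local Notation position := (position S).
Local Notation line := (line S).
Local Notation bend := (bend S).

Lemma segment_between (A B P : R * R) : segment A B P ->
  between A.1 B.1 P.1 /\ between A.2 B.2 P.2.
Proof.
case=> t /andP[t0 t1] -> /=.
have h (u v : R) : between u v (u + t * (v - u)).
  rewrite /between; apply/orP; case: (leP u v) => uv; [left | right]; nra.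
by split; exact: h.
Qed.

Lemma line_on a P : polyline (line a) P ->
  on_line S a P \/ on_line S (tau a) P.
Proof.
have main b (Q : R * R) : segment (position b) (if dir (tau b) == dir b + 2
    then position (tau b) else bend b) Q -> on_line S b Q \/ on_line S (tau b) Q.
  move/segment_between; rewrite /bend /position.
  have [par|par] := boolP (odd (dir b)).
    case: ifP => [/eqP e|_] /= [h1 h2]; apply: on_horizontal => //.
      by move: h2 par e; rewrite /between; case: (xyP S b) => // hY _; lra.
    by move: h2; rewrite /between; lra.
  case: ifP => [/eqP e|_] /= [h1 h2]; apply: on_vertical => //.
    by move: h1 par e; rewrite /between; case: (xyP S b) => // _ hX; lra.
  by move: h1; rewrite /between; lra.
case=> i; rewrite /side /pt /line; case: ifP => e.
  by case: i => // _ /= h; apply: main; rewrite e.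
case: i => [|[|]] //= _ h; first by apply: main; rewrite e.
(* The second side of a bent line is the first side of the reversed line. *)
rewrite or_comm -{2}(om_flipK S a); apply: main.
have -> : dir (tau (tau a)) == dir (tau a) + 2 = false.
  by rewrite om_flipK; move: e; case: (xyP S a).
have -> : bend (tau a) = bend a.
  by rewrite /bend om_flipK; move: e; case: (xyP S a).
case: h => t /andP[t0 t1] ->; exists (1 - t); first by apply/andP; split; lra.
by congr pair; lra.
Qed.

Lemma line_orthogonal a : orthogonal_polyline (line a).
Proof.
move=> i; rewrite /pt /line /bend; case: (xyP S a) => hY hX /=;
  case: i => [|[|]] //= _; auto.
Qed.

Lemma line_start a : pt (line a) 0 = position a.
Proof. by rewrite /pt /line; case: ifP. Qed.

Lemma line_simple a : simple_polyline (line a).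
Proof.
rewrite /line; case: ifP => e; split=> //.
- case=> //= _; rewrite /pt /= => -[]; move: e; case: (xyP S a) => // *; lra.
- by move=> [|i] [|j].
- rewrite /pt /bend; case=> [|[|]] //= _; move: e; case: (xyP S a) => //= hY hX _ [];
  lra.
move=> i j P ij /= jl h1 h2; have [ei ej] : i = 0%N /\ j = 1%N by lia.
rewrite ei ej in h1 h2 *; left; split=> //; move: h1 h2;
  rewrite /side /pt /= => /segment_between[h1 h2].
move=> /segment_between[]; move: h1 h2 e; case: P => p1 p2.
rewrite /between /bend; case: (xyP S a) => //= hY hX h1 h2 _ h3 h4; congr pair; lra.
Qed.

Lemma line_dir a k : half_line k (position a) (pt (line a) 1) -> k = dir a.
Proof.
rewrite /half_line /= /line /pt /bend; case: (xyP S a) => hY hX /=;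
  case=> -[-> [h1 h2]]; first [exfalso; lra | exact: val_inj].
Qed.

Lemma line_bend a : dir (tau a) != dir a + 2 ->
  half_line (dir a) (position a) (bend a) /\
  half_line (dir (tau a)) (position (tau a)) (bend a).
Proof.
have e4 : (4 : 'Z_4) = 0 by exact: val_inj.
rewrite /half_line /= e4 /bend; case: (xyP S a) => //= hY hX _; split; clear e4;
 first [apply: Or41; split; [done | by split; lra] | apply: Or42; split;
   [done | by split; lra]
   | apply: Or43; split; [done | by split; lra] | apply: Or44; split;
     [done | by split; lra]].
Qed.

Lemma bend_uniq a (X : R * R) : dir (tau a) != dir a + 2 ->
  half_line (dir a) (position a) X -> half_line (dir (tau a)) (position (tau a)) X ->
  X = bend a.
Proof.
case: X => X1 X2; rewrite /half_line /bend; case: (xyP S a) => //= hY hX _;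
  by case=> [] [] // _ [h1 h2]; case=> [] [] // _ [h3 h4]; congr pair.
Qed.

End Polylines.

(** * Rays are connected and unbounded *)

Section Rays.
Context (R : realType).

Definition unit_vector (i : 'Z_4) : R * R :=
  (if i == 3 then 1 else if i == 1 then -1 else 0,
   if i == 2 then 1 else if i == 0 then -1 else 0).

Definition ray (i : 'Z_4) (A : R * R) (s : R) : R * R :=
  (A.1 + s * (unit_vector i).1, A.2 + s * (unit_vector i).2).

Lemma ray0 i A : ray i A 0 = A.
Proof. by case: A => a b; rewrite /ray !mul0r !addr0. Qed.

Lemma affine_continuous (a b : R) : continuous (fun s : R => a + s * b).
Proof.
move=> s; apply: cvgD; first exact: cvg_cst.
by apply: cvgMr_tmp; exact: cvg_id.
Qed.

Lemma ray_connected i A : connected [set ray i A s | s in [set s | 0 < s]].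
Proof.
apply: connected_continuous_connected.
  apply/connected_intervalP => a b /= a0 _ c /andP[ac _].
  exact: lt_le_trans ac.
apply: continuous_subspaceT => s.
apply: (@cvg_pair _ _ _ (nbhs s) (nbhs (A.1 + s * (unit_vector i).1))
  (nbhs (A.2 + s * (unit_vector i).2)) _ _ _
  (fun s => A.1 + s * (unit_vector i).1) (fun s => A.2 + s * (unit_vector i).2));
  exact: affine_continuous.
Qed.

Lemma ray_unbounded i A : ~ bounded_set [set ray i A s | s in [set s | 0 < s]].
Proof.
case=> M [_ hM]; have := hM (`|M| + 1); rewrite (le_lt_trans (ler_norm M)) ?ltrDl //.
(* This parameter brings one coordinate beyond [|M| + 1] in absolute value, whatever the direction
   and the starting point. *)
move=> /(_ isT) h; pose s := `|M| + 2 + `|A.1| + `|A.2|.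
have s0 : 0 < s by rewrite /s; have := normr_ge0 M; have := normr_ge0 A.1;
  have := normr_ge0 A.2; lra.
have := h (ray i A s); rewrite /= => /(_ (ex_intro2 _ _ s s0 erefl)).
rewrite leNgt => /negP; apply.
have h1 := ler_norm A.1; have h2 := ler_norm A.2.
have h3 := ler_norm (- A.1); have h4 := ler_norm (- A.2); rewrite !normrN in h3 h4.
have hs : s - `|A.1| - `|A.2| = `|M| + 2 by rewrite /s; lra.
have [n1 n2] := (normr_ge0 A.1, normr_ge0 A.2).
rewrite prod_normE /= lt_max /ray /unit_vector /=; apply/orP.
have nrm (u : R) : u <= `|u| /\ - u <= `|u| by split; [|rewrite -normrN];
  exact: ler_norm.
case: (Z4P i) => -> /=; [right | left | right | left].
- by have [] := nrm (A.2 + s * -1); lra.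
- by have [] := nrm (A.1 + s * -1); lra.
- by have [] := nrm (A.2 + s * 1); lra.
- by have [] := nrm (A.1 + s * 1); lra.
Qed.

End Rays.

(** * The drawing with its arrows *)

Section Drawing.
Context (R : realType) (G : cmap) (r : dart G) (sqG : square_34_angulation r).
Context (L : dart (dual G) -> 'Z_4) (GS : dual_4GS_labeling r L).
Context (ho he : {set dart (dual G)} -> R).
Context (Ho : odd_increasing r L ho) (He : even_increasing r L he).

Local Notation D := (dart G).
Local Notation tau := (@flip G : D -> D).
Local Notation sg := (face_perm G).
Local Notation psi := (face_perm (dual G)).
Local Notation rho := (root_arc r).
Local Notation at_infty := (at_infty r).
Local Notation inner := (@inner G r).
Local Notation dirn := (@dirn G L).
Local Notation vert := (@vert (dual G)).
Local Notation pos := (fun v : {set dart (dual G)} => (ho v, he v)).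

Let tauK : involutive tau := @flip_involutive G.

(* The ends of the root edges are placed at coordinate [B] in their direction, for
   any [B] beyond this bound. *)
Definition radius : R := 1 + \sum_(v : {set D}) (`|ho v| + `|he v|).

Lemma radius_ho B : radius <= B -> forall v, `|ho v| < B.
Proof.
move=> rB v; apply: lt_le_trans rB; rewrite /radius (bigD1 v) //= .
have : 0 <= \sum_(i | i != v) (`|ho i| + `|he i|).
  by apply: sumr_ge0 => i _; rewrite addr_ge0.
have := normr_ge0 (he v); lra.
Qed.

Lemma radius_he B : radius <= B -> forall v, `|he v| < B.
Proof.
move=> rB v; apply: lt_le_trans rB; rewrite /radius (bigD1 v) //= .
have : 0 <= \sum_(i | i != v) (`|ho i| + `|he i|).
  by apply: sumr_ge0 => i _; rewrite addr_ge0.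
have := normr_ge0 (ho v); lra.
Qed.

Definition plan (B : R) (rB : radius <= B) : ortho R D :=
  match Ho, He with
  | And3 o1 o2 o3, And3 e1 e2 e3 =>
    drawing sqG GS o1 o2 o3 e1 e2 e3 (radius_ho rB) (radius_he rB)
  end.

Section Plan.
Context (B : R) (rB : radius <= B).
Local Notation S := (plan rB).

Lemma plan_tau : om_flip S = tau.
Proof. by rewrite /plan; case: Ho He => ? ? ? []. Qed.

Lemma plan_ext : om_ext S = at_infty.
Proof. by rewrite /plan; case: Ho He => ? ? ? []. Qed.

Lemma plan_rho : om_root S = rho.
Proof. by rewrite /plan; case: Ho He => ? ? ? []. Qed.

Lemma plan_dir a : ~~ at_infty a -> om_dir S a = dirn a.
Proof. by move=> /negPf na; rewrite /plan; case: Ho He => ? ? ? [] * /=;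
  rewrite /edir na. Qed.

Lemma plan_x a : ~~ at_infty a -> om_coord S 3 a = ho (vert a).
Proof.
move=> /negPf na; rewrite /plan; case: Ho He => ? ? ? [] * /=.
by rewrite coordE /xpos na.
Qed.

Lemma plan_y a : ~~ at_infty a -> om_coord S 2 a = he (vert a).
Proof.
move=> /negPf na; rewrite /plan; case: Ho He => ? ? ? [] * /=.
by rewrite coordE /ypos na.
Qed.

Lemma plan_x_ext i : om_coord S 3 (tau (rho i)) =
  if i == 3 then B else if i == 1 then - B else ho (vert (rho i)).
Proof.
rewrite /plan; case: Ho He => ? ? ? [] * /=.
by rewrite coordE /xpos (at_infty_root sqG) tauK (dirn_root sqG GS).
Qed.

Lemma plan_y_ext i : om_coord S 2 (tau (rho i)) =
  if i == 2 then B else if i == 0 then - B else he (vert (rho i)).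
Proof.
rewrite /plan; case: Ho He => ? ? ? [] * /=.
by rewrite coordE /ypos (at_infty_root sqG) tauK (dirn_root sqG GS).
Qed.

Lemma plan_point a : ~~ at_infty a -> position S a = pos (vert a).
Proof. by move=> na; rewrite /position plan_x // plan_y. Qed.

Lemma plan_vt a b : ~~ at_infty a -> vertex_of S a = vertex_of S b ->
  vert a = vert b /\ ~~ at_infty b.
Proof.
move=> na /vt_eqP [<-//|[_]].
have -> : om_cw S = sg by rewrite /plan; case: Ho He => ? ? ? [].
move=> o; rewrite (at_infty_porbit r o); split=> //.
by apply/esym/eqP; rewrite /Defs.vert eq_porbit_mem.
Qed.

End Plan.

Definition plan0 : ortho R D := plan (lexx radius).

Definition draw (a : D) : seq (R * R) := line plan0 a.

(* Lengthening the arrows does not change the drawing of the other edges. *)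
Definition drawn (a : D) (P : R * R) : Prop :=
  exists B1, forall B (rB : radius <= B), B1 <= B ->
    on_line (plan rB) a P \/ on_line (plan rB) (tau a) P.

Lemma drawn_cross a b P : drawn a P -> drawn b P ->
  [\/ a = b, a = tau b | exists2 c, ~~ at_infty c & P = pos (vert c)].
Proof.
case=> B1 h1 [B2 h2].
(* Besides both thresholds, [B] exceeds the coordinates of [P], so that [P] is not the end of an
   arrow. *)
pose B := Num.max (Num.max B1 B2) (Num.max radius (1 + `|P.1| + `|P.2|)).
have rB : radius <= B by rewrite !le_max lexx orbT.
have [b1 b2] : B1 <= B /\ B2 <= B by rewrite !le_max !lexx ?orbT.
have b3 : 1 + `|P.1| + `|P.2| <= B by rewrite !le_max !lexx ?orbT.
have h := on_cross (S := plan rB) (P := P).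
have tauE := plan_tau rB; rewrite tauE in h.
have vtx c : om_coord (plan rB) 3 c = P.1 /\ om_coord (plan rB) 2 c = P.2 ->
    exists2 c, ~~ at_infty c & P = pos (vert c).
  case=> ex ey; have [/(at_inftyP sqG)[i ei]|nc] := boolP (at_infty c); last first.
    by exists c => //; rewrite -(plan_point rB nc) /position ex ey; case: (P).
  exfalso; move: ex ey; rewrite ei plan_x_ext plan_y_ext.
  have := ler_norm P.1; have := ler_norm P.2.
  have := ler_norm (- P.1); have := ler_norm (- P.2); rewrite !normrN.
  have := normr_ge0 P.1; have := normr_ge0 P.2.
  by case: (Z4P i) => -> /=; move: b3; lra.
have key u v : u = a \/ u = tau a -> v = b \/ v = tau b ->
    on_line (plan rB) u P -> on_line (plan rB) v P ->
    [\/ a = b, a = tau b | exists2 c, ~~ at_infty c & P = pos (vert c)].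
  move=> hu hv ou ov; case: (h u v ou ov) => [e|e|[c /vtx]]; last exact: Or33.
  - case: hu hv e => -> [] -> => [e|e|e|e].
    + exact: Or31.
    + exact: Or32.
    + by apply: Or32; rewrite -e tauK.
    + by apply: Or31; exact: (can_inj tauK).
  - case: hu hv e => -> [] -> => [e|e|e|e].
    + exact: Or32.
    + by apply: Or31; rewrite e tauK.
    + by apply: Or31; exact: (can_inj tauK).
    + by apply: Or32; rewrite -(tauK a) e tauK.
case: (h1 B rB b1) => o1; case: (h2 B rB b2) => o2.
all: by apply: (key _ _ _ _ o1 o2); auto.
Qed.

Lemma drawn_vertex a v : ~~ at_infty a -> ~~ at_infty v -> drawn a (pos (vert v)) ->
  vert v = vert a \/ vert v = vert (tau a) /\ ~~ at_infty (tau a).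
Proof.
move=> na nv [B1 h1]; pose B := Num.max B1 radius.
have rB : radius <= B by rewrite !le_max lexx orbT.
have b1 : B1 <= B by rewrite !le_max !lexx.
have h := on_vertex (S := plan rB) (v := v).
rewrite plan_ext plan_tau plan_x // plan_y // in h.
have tauE := plan_tau rB.
case: (h1 B rB b1) => /(h _ nv)[] /(plan_vt nv)[]; rewrite ?tauK; auto.
Qed.

Lemma drawn_inner a P : inner a -> polyline (draw a) P -> drawn a P.
Proof.
case/andP => na nt /line_on; rewrite plan_tau => h.
exists 0 => B rB _; move: h.
have e c : c = a \/ c = tau a -> on_line plan0 c P -> on_line (plan rB) c P.
  have cc : c = a \/ c = tau a -> ~~ at_infty c /\ ~~ at_infty (tau c).
    by case=> ->; rewrite ?tauK.
  move=> /cc[nc ntc].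
  rewrite /on_line /vx /hy !plan_tau !plan_dir // !plan_x // !plan_y //.
by case=> o; [left | right]; apply: e; auto.
Qed.

(** A point of the infinite arrow is on the finite one as soon as [B] is at least [radius + s]. *)
Lemma drawn_ray (i : 'Z_4) (s : R) : 0 <= s -> drawn (rho i)
  (ray i (pos (vert (rho i))) s).
Proof.
move=> s0; exists (radius + s) => B rB b1; have nr := negbT (at_infty_root_arc sqG i).
have hb := radius_ho (lexx radius) (vert (rho i)).
have eb := radius_he (lexx radius) (vert (rho i)).
have := @on_horizontal _ _ (plan rB) (rho i); have := @on_vertical _ _ (plan rB)
  (rho i).
rewrite plan_tau plan_dir // (dirn_root sqG GS)
  plan_x // plan_y // plan_x_ext plan_y_ext.
have pos_ u : u < radius -> between u B (u + s * 1).
  by move=> hu; apply/orP; left; lra.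
have neg_ u : - radius < u -> between u (- B) (u + s * -1).
  by move=> hu; apply/orP; right; lra.
move: hb eb; rewrite !ltr_norml => /andP[x1 x2] /andP[y1 y2].
case: (Z4P i) x1 x2 y1 y2 => -> x1 x2 y1 y2 v h.
- by apply: v; [ | rewrite /= mulr0 addr0 | exact: neg_].
- by apply: h; [ | rewrite /= mulr0 addr0 | exact: neg_].
- by apply: v; [ | rewrite /= mulr0 addr0 | exact: pos_].
- by apply: h; [ | rewrite /= mulr0 addr0 | exact: pos_].
Qed.

Lemma draw_root (i : 'Z_4) : exists2 s : R, 0 < s &
  draw (rho i) = [:: pos (vert (rho i)); ray i (pos (vert (rho i))) s].
Proof.
have nr := negbT (at_infty_root_arc sqG i).
have e : draw (rho i) = [:: position plan0 (rho i); position plan0 (tau (rho i))].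
  rewrite /draw /line plan_tau.
  have := om_dir_flip_root plan0 i; rewrite plan_tau plan_rho => ->.
  by rewrite plan_dir // (dirn_root sqG GS) eqxx.
have hb := radius_ho (lexx radius) (vert (rho i)).
have eb := radius_he (lexx radius) (vert (rho i)).
move: hb eb; rewrite !ltr_norml => /andP[x1 x2] /andP[y1 y2].
rewrite e plan_point // /position plan_x_ext plan_y_ext /ray /=.
set u := ho _ in x1 x2 *; set w := he _ in y1 y2 *.
case: (Z4P i) => -> /=.
- by exists (w + radius); [lra | congr [:: _; (_, _)]; lra].
- by exists (u + radius); [lra | congr [:: _; (_, _)]; lra].
- by exists (radius - w); [lra | congr [:: _; (_, _)]; lra].
- by exists (radius - u); [lra | congr [:: _; (_, _)]; lra].
Qed.

Lemma polyline_root (i : 'Z_4) P : polyline (draw (rho i)) P ->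
  exists2 s : R, 0 <= s & P = ray i (pos (vert (rho i))) s.
Proof.
have [s s0 ->] := draw_root i; case=> -[|[]] //= _ [t /andP[t0 t1] ->].
exists (t * s); first by rewrite mulr_ge0 // ltW.
by rewrite /ray /=; congr pair; ring.
Qed.

Lemma drawn_line a P : ~~ at_infty a -> polyline (draw a) P -> drawn a P.
Proof.
move=> na; have [/(at_inftyP sqG)[i /(can_inj tauK) ->]|nt] := boolP (at_infty (tau a)).
  by case/polyline_root => s s0 ->; exact: drawn_ray.
by apply: drawn_inner; apply/andP.
Qed.

Lemma ray_fixed (i : 'Z_4) (A : R * R) (s : R) : ray i A s = A -> s = 0.
Proof.
case: A => a b; rewrite /ray /unit_vector /=.
by case: (Z4P i) => -> /= [] h1 h2; lra.
Qed.

Lemma ray_skeleton (i : 'Z_4) (s : R) : 0 < s ->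
  ~ skeleton r pos draw (ray i (pos (vert (rho i))) s).
Proof.
move=> s0; have dr := drawn_ray i (ltW s0); have nr := negbT (at_infty_root_arc sqG i).
have vtx v : ~~ at_infty v -> ray i (pos (vert (rho i))) s <> pos (vert v).
  move=> nv e; rewrite e in dr.
  case: (drawn_vertex nr nv dr) => [ev|[_]]; last by rewrite (at_infty_root sqG).
  by move: e; rewrite ev => /ray_fixed e; rewrite e ltxx in s0.
case=> [[v nv]|[b ib]]; first exact: vtx.
have /andP[nb nt] : inner b := ib.
move/(drawn_inner ib)/(drawn_cross dr) => [e|e|[c nc]]; last exact: vtx.
  by rewrite -e (at_infty_root sqG) in nt.
by rewrite -(tauK b) -e (at_infty_root sqG) in nb.
Qed.

Lemma half_line_ray (i : 'Z_4) (A : R * R) (s : R) : 0 <= s ->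
  half_line i A (ray i A s).
Proof.
move=> s0; rewrite /half_line /ray /unit_vector /=.
have e4 : (4 : 'Z_4) = 0 by exact: val_inj.
by rewrite e4; case: (Z4P i) => -> /=; clear e4;
  [apply: Or44|apply: Or41|apply: Or42|apply: Or43]; (split; [done|split; lra]).
Qed.

Lemma mem_colors a k : (k \in colors L a) = cyc_itv (L ((sg^-1)%g a)) (L a) k.
Proof. by rewrite inE. Qed.

(** Each direction is a color of its own arc and no color is shared by both arcs, so two colors in
    all must be the two directions. *)
Lemma bent_colorsP a i j : inner a -> bent_colors L a i j <->
  [/\ dirn (tau a) != dirn a + 2, i = dirn a & j = dirn (tau a)].
Proof.
move=> ia; have /andP[na nt] := ia.
have qd := inner_quad sqG GS ia.
have disj k := quad_colors k qd; rewrite /= -/(dirn a) -dirn_tau in disj.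
have ca k : (k \in colors L a) = cyc_itv (L ((sg^-1)%g a)) (L a) k := mem_colors a k.
have ct k : (k \in colors L (tau a)) = cyc_itv (L (psi a)) (L (tau a)) k.
  by rewrite mem_colors -psi_tau tauK.
have ma : dirn a \in colors L a by rewrite ca; exact: (dirn_color GS na).
have mt : dirn (tau a) \in colors L (tau a) by rewrite mem_colors;
  exact: (dirn_color GS nt).
split.
  case/and4P => mi mj /eqP /setP e par.
  have d1 : i = dirn a.
    have := e (dirn a); rewrite finset.in_setU ma !inE => /esym/orP[/eqP->//|/eqP dj].
    by have [] := disj j; rewrite -ca -ct mj -dj ma.
  have d2 : j = dirn (tau a).
    have := e (dirn (tau a)); rewrite finset.in_setU mt orbT !inE => /esym/orP[/eqP dj|/eqP->//].
    by have [] := disj i; rewrite -ca -ct mi -dj mt.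
  split=> //; apply: contraNneq par; rewrite -d1 -d2 => ->.
  by case: (Z4P i) => ->.
case=> ns -> ->; apply/and4P; split=> //; last by have [_ /(_ ns) []] := disj 0.
by apply/eqP/setP => k; have [_ /(_ ns) [_]] := disj k; rewrite !inE -ca -ct !inE.
Qed.

Lemma Lstar_draw a p : inner a -> Lstar_rule L pos a p <-> p = draw a.
Proof.
move=> ia; have /andP[na nt] := ia.
have bc := bent_colorsP _ _ ia.
have lb := @line_bend _ _ plan0 a; have bu := @bend_uniq _ _ plan0 a.
rewrite plan_tau !plan_dir // !plan_point // in lb bu.
have e : draw a = if dirn (tau a) == dirn a + 2 then [:: pos (vert a);
  pos (vert (tau a))]
    else [:: pos (vert a); bend plan0 a; pos (vert (tau a))].
  by rewrite /draw /line plan_tau !plan_dir // !plan_point.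
split.
  case=> [[i [j [X [/bc[ns -> ->] h1 h2 ->]]]]|[nb ->]].
    by rewrite e (negPf ns) (bu X ns h1 h2).
  rewrite e; case: eqP => // /eqP ns; case: nb.
  by exists (dirn a), (dirn (tau a)); apply/bc.
move=> ->; rewrite e; case: (eqVneq (dirn (tau a)) (dirn a + 2)) => [st|ns].
  by right; split=> // -[i [j /bc[]]]; rewrite st eqxx.
left; exists (dirn a), (dirn (tau a)), (bend plan0 a); have [h1 h2] := lb ns.
by split=> //; apply/bc.
Qed.

Lemma draw_dir a k : ~~ at_infty a ->
  half_line k (pos (vert a)) (pt (draw a) 1) -> k = dirn a.
Proof.
by move=> na; have := @line_dir _ _ plan0 a k; rewrite plan_point // plan_dir.
Qed.

Lemma vert_porbit a b : b \in vert a -> vert b = vert a.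
Proof. by move=> o; apply/eqP; rewrite /Defs.vert eq_porbit_mem. Qed.

Lemma draw_SPO : SPO_drawing r pos draw.
Proof.
split.
- move=> a b na nb [ex ey].
  have := @position_inj _ _ plan0 a b; rewrite plan_ext !plan_x // !plan_y //.
  by move=> /(_ na nb ex ey) /(plan_vt na)[].
- by move=> a na; rewrite /draw line_start plan_point.
- by move=> a ia; rewrite /draw -(plan_tau (lexx radius)) line_rev.
- by move=> a na; exact: line_simple.
- by move=> a na; exact: line_orthogonal.
- move=> a b na nb /(drawn_line na)/(drawn_vertex na nb)[|[]]; auto.
- move=> a b P na nb ne ne' /(drawn_line na) da /(drawn_line nb) db.
  case: (drawn_cross da db) => [e|e|//]; first by rewrite e eqxx in ne.
  by rewrite e /= tauK eqxx in ne'.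
- move=> a b i j k na ob ne hi hj hk.
  have oc : sg a \in vert a by exact: porbit1.
  have nb : ~~ at_infty b by rewrite (at_infty_porbit r ob).
  have nc : ~~ at_infty (sg a) by rewrite (at_infty_porbit r oc).
  rewrite (draw_dir na hi); rewrite -(vert_porbit oc) in hj.
  rewrite (draw_dir nc hj); rewrite -(vert_porbit ob) in hk.
  by rewrite (draw_dir nb hk); exact: (dirn_rotation GS).
- move=> i a; have [s s0 e] := draw_root i.
  by exists (ray i (pos (vert a)) s); [exact: half_line_ray (ltW s0) | ].
move=> i P a /polyline_root[s s0 eP] neP.
have {}s0 : 0 < s.
  by rewrite lt_def s0 andbT; apply/eqP => e; apply: neP; rewrite eP e ray0.
(* The open ray is connected, unbounded and avoids the skeleton, so the component of [P] contains it
   and is unbounded. *)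
pose W := [set ray i (pos (vert a)) s | s in [set s : R | 0 < s]].
have sub : W `<=` ~` skeleton r pos draw by move=> _ [s' s'0 <-]; exact: ray_skeleton.
have WP : W P by exists s.
split; first exact: sub.
move=> bd; apply: (@ray_unbounded R i (pos (vert a))).
have cW : connected W by exact: ray_connected.
have incl := connected_component_max WP sub cW.
case: bd => M [Mr hM]; exists M; split=> // x xM y /incl; exact: hM.
Qed.

End Drawing.

Theorem theorem4p6 (R : realType) (G : cmap) (r : dart G)
    (L : dart (dual G) -> 'Z_4) (ho he : {set dart (dual G)} -> R) :
  square_34_angulation r -> adapted G ->
  dual_4GS_labeling r L ->
  odd_increasing r L ho -> even_increasing r L he ->
  let pos := fun v : {set dart (dual G)} => (ho v, he v) in
  (forall a, nonroot_arc r a -> exists p, Lstar_rule L pos a p) /\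
  (forall edge : dart (dual G) -> seq (R * R),
     (forall a, nonroot_arc r a -> Lstar_rule L pos a (edge a)) ->
     exists draw : dart (dual G) -> seq (R * R),
       (forall a, nonroot_arc r a -> draw a = edge a) /\
       SPO_drawing r pos draw).
Proof.
move=> sqG _ GS Ho He pos; split.
  by move=> a ia; exists (draw sqG GS Ho He a); exact: (Lstar_draw sqG GS Ho He _ ia).2.
(* The rule determines the line of a non-root edge, so [edge] agrees there with [draw], which
   supplies the arrows as well. *)
move=> edge hedge; exists (draw sqG GS Ho He); split; last exact: draw_SPO.
by move=> a ia; apply/esym/(Lstar_draw sqG GS Ho He (edge a) ia); exact: hedge.
Qed.
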